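(* Let $\alpha\ge-1$, $n$ a positive integer, $\psi_0,\psi_n$ analytic on $\mathbb D$ and $\varphi_0,\varphi_n$ analytic self-maps of $\mathbb D$ such that $C_{\psi_0,\varphi_0}$ and $D_{\psi_n,\varphi_n,n}$ are bounded on $\mathcal H_\alpha$. Suppose $w\in\mathbb D$ satisfies $\varphi_0(w)=\varphi_n(w)=w$ and $\psi_n$ has a zero at $w$ of order at least $n$. If $C_{\psi_0,\varphi_0}+D_{\psi_n,\varphi_n,n}$ is compact on $\mathcal H_\alpha$, then $$\sigma_\alpha(C_{\psi_0,\varphi_0}+D_{\psi_n,\varphi_n,n})=\{0\}\cup\{\psi_0(w)\}\cup\{\psi_0(w)(\varphi_0'(w))^l:\ 1\le l\le n-1\}\cup\Big\{\psi_0(w)(\varphi_0'(w))^l+\binom{l}{n}\psi_n^{(n)}(w)(\varphi_n'(w))^{l-n}:\ l\ge n\Big\}.$$ In particular, if $D_{\psi_n,\varphi_n,n}$ is compact on $\mathcal H_\alpha$, $\varphi_n(w)=w\in\mathbb D$, and $\psi_n^{(j)}(w)=0$ for all $0\le j\le n$, then $D_{\psi_n,\varphi_n,n}$ is quasinilpotent, i.e. $\sigma_\alpha(D_{\psi_n,\varphi_n,n})=\{0\}$.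
   Context: For $\alpha=-1$, $\mathcal H_\alpha$ denotes the Hardy space $H^2$ on the open unit disk $\mathbb D$; for $\alpha>-1$, $\mathcal H_\alpha$ denotes the weighted Bergman space $A^2_\alpha$ of analytic $f$ on $\mathbb D$ with $\int_{\mathbb D}|f(z)|^2(\alpha+1)(1-|z|^2)^\alpha\,dA(z)<\infty$, $dA$ normalized area measure. For $\psi$ analytic on $\mathbb D$, $\varphi$ an analytic self-map of $\mathbb D$ and $n$ a positive integer: $C_{\psi,\varphi}f=\psi\cdot(f\circ\varphi)$ and $D_{\psi,\varphi,n}f=\psi\cdot(f^{(n)}\circ\varphi)$. $\sigma_\alpha(T)$ denotes the spectrum of $T$ on $\mathcal H_\alpha$. A function $\psi$ has a zero at $w$ of order at least $k$ if $\psi^{(j)}(w)=0$ for $0\le j\le k-1$. Convention: $0^0=1$. *)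

(* Defs.v *)
From Stdlib Require Import Reals ClassicalEpsilon.
From Coquelicot Require Import Coquelicot.

Open Scope R_scope.

Definition CC := Complex.C.

Definition inD (z : CC) : Prop := Cmod z < 1.

Definition cdiff (f : CC -> CC) (z : CC) : Prop :=
  exists l : CC, @is_derive C_AbsRing C_NormedModule f z l.

Definition analytic_D (f : CC -> CC) : Prop := forall z, inD z -> cdiff f z.

Definition selfmap_D (phi : CC -> CC) : Prop :=
  analytic_D phi /\ forall z, inD z -> inD (phi z).

(* the complex derivative (chosen value; meaningful where f is differentiable) *)
Definition cderiv (f : CC -> CC) : CC -> CC := fun z =>
  epsilon (inhabits (RtoC 0))
    (fun l : CC => @is_derive C_AbsRing C_NormedModule f z l).

Fixpoint cderiv_n (n : nat) (f : CC -> CC) : CC -> CC :=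
  match n with O => f | S m => cderiv (cderiv_n m f) end.

Definition polar (r t : R) : CC := (r * cos t, r * sin t).

Definition circ_mean (f : CC -> CC) (r : R) : R :=
  / (2 * PI) * RInt (fun t => (Cmod (f (polar r t))) ^ 2) 0 (2 * PI).

(* int_{|z|<rho} |f|^2 (alpha+1)(1-|z|^2)^alpha dA(z), with dA = dx dy / pi
   written in polar coordinates: dA = r dr dt / pi *)
Definition bergman_partial (alpha : R) (f : CC -> CC) (rho : R) : R :=
  RInt (fun r => 2 * r * circ_mean f r * (alpha + 1) * Rpower (1 - r ^ 2) alpha)
    0 rho.

(* the quantity whose supremum over rho in [0,1) is ||f||^2 in H_alpha *)
Definition Hpartial (alpha : R) (f : CC -> CC) (rho : R) : R :=
  if Req_EM_T alpha (-1) then circ_mean f rho else bergman_partial alpha f rho.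

Definition normsq_le (alpha : R) (f : CC -> CC) (M : R) : Prop :=
  forall rho, 0 <= rho < 1 -> Hpartial alpha f rho <= M.

Definition inH (alpha : R) (f : CC -> CC) : Prop :=
  analytic_D f /\ exists M, normsq_le alpha f M.

Definition eqD (f g : CC -> CC) : Prop := forall z, inD z -> f z = g z.

Definition fadd (f g : CC -> CC) : CC -> CC := fun z => Cplus (f z) (g z).
Definition fscal (a : CC) (f : CC -> CC) : CC -> CC := fun z => Cmult a (f z).
Definition fsub (f g : CC -> CC) : CC -> CC := fun z => Cminus (f z) (g z).

Definition Op := (CC -> CC) -> (CC -> CC).

Definition op_add (S T : Op) : Op := fun f => fadd (S f) (T f).

Definition bounded_op (alpha : R) (T : Op) : Prop :=
  (forall f g a, inH alpha f -> inH alpha g ->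
     eqD (T (fadd f (fscal a g))) (fadd (T f) (fscal a (T g)))) /\
  (forall f g, inH alpha f -> eqD f g -> eqD (T f) (T g)) /\
  exists K, 0 <= K /\
    forall f, inH alpha f ->
      inH alpha (T f) /\ forall M, normsq_le alpha f M -> normsq_le alpha (T f) (K * M).

Definition compact_op (alpha : R) (T : Op) : Prop :=
  bounded_op alpha T /\
  forall u : nat -> (CC -> CC),
    (forall k, inH alpha (u k) /\ normsq_le alpha (u k) 1) ->
    exists (s : nat -> nat) (g : CC -> CC),
      (forall j, (s j < s (S j))%nat) /\ inH alpha g /\
      forall eps, 0 < eps -> exists N, forall j, (N <= j)%nat ->
        normsq_le alpha (fsub (T (u (s j))) g) eps.

Definition in_spectrum (alpha : R) (T : Op) (lam : CC) : Prop :=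
  ~ exists S : Op, bounded_op alpha S /\
      forall f, inH alpha f ->
        eqD (S (fsub (T f) (fscal lam f))) f /\
        eqD (fsub (T (S f)) (fscal lam (S f))) f.

Definition Cop (psi phi : CC -> CC) : Op := fun f z => Cmult (psi z) (f (phi z)).

Definition Dop (psi phi : CC -> CC) (n : nat) : Op :=
  fun f z => Cmult (psi z) (cderiv_n n f (phi z)).

(* Main.v *)
(** Both operators respect the order of vanishing at [w]: if [f] has leading term
    [c (z - w)^j] at [w], then [T f] has leading term [mu_j c (z - w)^j], where
    the [mu_j] are the numbers in the statement.  So [T - mu_l] maps no function
    onto [(z - w)^m] for the least [m] with [mu_m = mu_l], and [mu_l] lies in
    the spectrum.  Conversely, if [lam] is nonzero and differs from every
    [mu_j], a function killed by [T - lam] vanishes to infinite order at [w],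
    hence is zero, and the Fredholm alternative for compact operators makes
    [T - lam] invertible.  Finally [0] is in the spectrum because the space is
    infinite-dimensional.

    Analyticity is complex differentiability only, so Cauchy's theory is derived
    from Goursat's lemma for triangles. *)

Require Import Defs.
From Stdlib Require Import Reals Factorial Compare_dec Lra Lia.
From Stdlib Require Import Classical ClassicalEpsilon FunctionalExtensionality.
From Coquelicot Require Import Coquelicot.
Open Scope R_scope.
Open Scope C_scope.

(** * Complex continuity and differentiability *)

(** Cauchy's formula at z comes from integrating the difference quotient of f at z. That quotient is
    differentiable off z but a priori only continuous at z, so Goursat's lemma is extended to
    functions with one exceptional point. The quotient's singularity then turns out to be removable,
    which gives division by z - w inside the class of analytic functions; all statements about
    orders of vanishing rest on it.

    The norm stays squared throughout and is a supremum of integrals over radii below 1, so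
    estimates are inherited from inequalities between squared moduli, at the price of a factor 2 in
    the triangle inequality. In Riesz's argument every limit is produced by the compactness of T:
    when T v tends to h and (T - lam) v tends to g, v itself tends to (h - g) / lam, and this is
    where lam must be nonzero. Functions are total but matter only on the disc, hence the constant
    passage through [eqD]. *)

Lemma continuous_C_pair {U : UniformSpace} (f : U -> C) (x : U) :
  continuous (fun y => fst (f y)) x -> continuous (fun y => snd (f y)) x ->
  continuous f x.
Proof.
intros H1 H2.
apply filterlim_locally. intros eps.
generalize (proj1 (filterlim_locally _ _) H1 eps) (proj1 (filterlim_locally _ _) H2 eps).
intros K1 K2. generalize (filter_and _ _ K1 K2).
apply filter_imp. intros y [A B]. split; assumption.
Qed.

Lemma continuous_C_fst {U : UniformSpace} (f : U -> C) (x : U) :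
  continuous f x -> continuous (fun y => fst (f y)) x.
Proof.
intros H. apply filterlim_locally. intros eps.
generalize (proj1 (filterlim_locally _ _) H eps).
apply filter_imp. intros y [A B]. assumption.
Qed.

Lemma continuous_C_snd {U : UniformSpace} (f : U -> C) (x : U) :
  continuous f x -> continuous (fun y => snd (f y)) x.
Proof.
intros H. apply filterlim_locally. intros eps.
generalize (proj1 (filterlim_locally _ _) H eps).
apply filter_imp. intros y [A B]. assumption.
Qed.

Lemma continuous_Cplus {U : UniformSpace} (f g : U -> C) (x : U) :
  continuous f x -> continuous g x -> continuous (fun y => f y + g y) x.
Proof. intros. apply (continuous_plus (V := C_R_NormedModule)); assumption. Qed.

Lemma continuous_Copp {U : UniformSpace} (f : U -> C) (x : U) :
  continuous f x -> continuous (fun y => - f y) x.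
Proof. intros. apply (continuous_opp (V := C_R_NormedModule)); assumption. Qed.

Lemma continuous_Cminus {U : UniformSpace} (f g : U -> C) (x : U) :
  continuous f x -> continuous g x -> continuous (fun y => f y - g y) x.
Proof. intros. apply (continuous_minus (V := C_R_NormedModule)); assumption. Qed.

Lemma continuous_Cmult {U : UniformSpace} (f g : U -> C) (x : U) :
  continuous f x -> continuous g x -> continuous (fun y => f y * g y) x.
Proof.
intros Hf Hg.
apply continuous_C_fst in Hf as F1. apply continuous_C_snd in Hf as F2.
apply continuous_C_fst in Hg as G1. apply continuous_C_snd in Hg as G2.
apply continuous_C_pair; simpl.
- apply (continuous_minus (V := R_NormedModule));
  apply (continuous_mult (K := R_AbsRing)); assumption.
- apply (continuous_plus (V := R_NormedModule));
  apply (continuous_mult (K := R_AbsRing)); assumption.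
Qed.

Lemma continuous_Rpow2 {U : UniformSpace} (f : U -> R) (x : U) :
  continuous f x -> continuous (fun y => f y ^ 2)%R x.
Proof.
intros H. apply (continuous_ext (fun y => f y * f y)%R); [intros; simpl; ring|].
apply (continuous_mult (K := R_AbsRing)); assumption.
Qed.

Lemma continuous_Cinv {U : UniformSpace} (f : U -> C) (x : U) :
  f x <> 0 -> continuous f x -> continuous (fun y => / f y) x.
Proof.
intros H0 Hf.
apply continuous_C_fst in Hf as F1. apply continuous_C_snd in Hf as F2.
assert (Hd : (fst (f x) ^ 2 + snd (f x) ^ 2 <> 0)%R).
{ intros E. apply H0. apply injective_projections; simpl; nra. }
assert (D : continuous (fun y => / (fst (f y) ^ 2 + snd (f y) ^ 2))%R x).
{ apply (continuous_comp (fun y => fst (f y) ^ 2 + snd (f y) ^ 2)%R Rinv).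
  - apply (continuous_plus (V := R_NormedModule));
    apply continuous_Rpow2; assumption.
  - apply continuous_Rinv. exact Hd. }
apply continuous_C_pair; simpl;
(apply (continuous_mult (K := R_AbsRing)); [|exact D]).
- exact F1.
- apply (continuous_opp (V := R_NormedModule)). exact F2.
Qed.

Lemma continuous_Cdiv {U : UniformSpace} (f g : U -> C) (x : U) :
  g x <> 0 -> continuous f x -> continuous g x ->
  continuous (fun y => f y / g y) x.
Proof. intros. apply continuous_Cmult; [|apply continuous_Cinv]; assumption. Qed.

Lemma continuous_Cpow {U : UniformSpace} (f : U -> C) (x : U) (k : nat) :
  continuous f x -> continuous (fun y => f y ^ k) x.
Proof.
intros Hf. induction k; simpl.
- apply continuous_const.
- apply continuous_Cmult; assumption.
Qed.

Lemma continuous_Cmod {U : UniformSpace} (f : U -> C) (x : U) :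
  continuous f x -> continuous (fun y => Cmod (f y)) x.
Proof.
intros Hf. apply (continuous_comp f Cmod); [assumption|].
apply (continuous_ext (fun z : C => norm (V := C_R_NormedModule) z)).
- intros z. symmetry. apply Cmod_norm.
- apply (filterlim_norm (V := C_R_NormedModule)).
Qed.

Lemma ball_C (x y : C) (e : R) : Cmod (y - x) < e -> ball (M := C_UniformSpace) x e y.
Proof. apply C_NormedModule_mixin_compat1. Qed.

(** A [ball] of [C_UniformSpace] is a square, the product of two real balls, so the modulus can
    exceed the radius by a factor sqrt 2, rounded up to 2 here. *)
Lemma ball_C_inv (x y : C) (e : posreal) :
  ball (M := C_UniformSpace) x e y -> Cmod (y - x) < 2 * e.
Proof.
intros H. apply C_NormedModule_mixin_compat2 in H.
eapply Rlt_le_trans; [apply H|]. apply Rmult_le_compat_r; [left; apply cond_pos|].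
pose proof (sqrt_sqrt 2). pose proof (sqrt_pos 2). nra.
Qed.

Lemma continuous_C_eps (f : C -> C) (z : C) :
  continuous (T := C_UniformSpace) (U := C_UniformSpace) f z <->
  forall eps, 0 < eps -> exists delta, 0 < delta /\
    forall y, Cmod (y - z) < delta -> Cmod (f y - f z) < eps.
Proof.
split.
- intros H eps He.
  assert (He2 : 0 < eps / 2) by lra.
  destruct (proj1 (filterlim_locally _ _) H (mkposreal _ He2)) as [d Hd].
  exists d. split; [apply cond_pos|].
  intros y Hy. apply ball_C in Hy. apply Hd in Hy. apply ball_C_inv in Hy.
  simpl in Hy. lra.
- intros H. apply filterlim_locally. intros eps.
  destruct (H eps (cond_pos eps)) as [d [Hd K]].
  assert (Hd2 : 0 < d / 2) by lra.
  exists (mkposreal _ Hd2). intros y Hy. apply ball_C. apply K.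
  apply ball_C_inv in Hy. simpl in Hy. lra.
Qed.

Lemma is_derive_C_eps (f : C -> C) (z l : C) :
  @is_derive C_AbsRing C_NormedModule f z l <->
  forall eps, 0 < eps -> exists delta, 0 < delta /\
    forall y, Cmod (y - z) < delta ->
      Cmod (f y - f z - l * (y - z)) <= eps * Cmod (y - z).
Proof.
split.
- intros [_ H] eps He.
  destruct (H z (fun P HP => HP) (mkposreal eps He)) as [d Hd].
  exists d. split; [apply cond_pos|].
  intros y Hy. specialize (Hd y Hy). simpl in Hd.
  change (Cmod (f y - f z - (y - z) * l) <= eps * Cmod (y - z)) in Hd.
  rewrite Cmult_comm. exact Hd.
- intros H. split.
  + apply is_linear_scal_l.
  + intros x Hx eps.
    assert (E : x = z).
    { symmetry. apply (is_filter_lim_locally_unique (K := C_AbsRing) (V := AbsRing_NormedModule C_AbsRing)). exact Hx. }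
    subst x.
    destruct (H eps (cond_pos eps)) as [d [Hd K]].
    exists (mkposreal d Hd). intros y Hy. specialize (K y Hy).
    change (Cmod (f y - f z - (y - z) * l) <= eps * Cmod (y - z)).
    rewrite (Cmult_comm (y - z) l). exact K.
Qed.

(** The derivative as the value at z of a slope function continuous there. Product and chain rules
    become algebraic identities between slope functions, and Cauchy's formula integrates the slope
    function itself. *)
Definition caratheodory (f : C -> C) (z l : C) : Prop :=
  exists phi : C -> C,
    continuous (T := C_UniformSpace) (U := C_UniformSpace) phi z /\ phi z = l /\
    forall y, f y = f z + phi y * (y - z).

Lemma Cminus_eq_0 (a b : C) : a - b = 0 -> a = b.
Proof. intros H. replace a with ((a - b) + b) by ring. rewrite H. ring. Qed.

Lemma Cminus_neq_0 (a b : C) : a <> b -> a - b <> 0.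
Proof. intros H E. apply H, Cminus_eq_0, E. Qed.

Lemma is_derive_caratheodory (f : C -> C) (z l : C) :
  @is_derive C_AbsRing C_NormedModule f z l <-> caratheodory f z l.
Proof.
rewrite is_derive_C_eps. split.
- intros H.
  exists (fun y => if excluded_middle_informative (y = z) then l else (f y - f z) / (y - z)).
  repeat split.
  + apply continuous_C_eps. intros eps He.
    destruct (H (eps / 2)%R) as [d [Hd K]]; [lra|].
    exists d. split; [assumption|]. intros y Hy. specialize (K y Hy).
    destruct (excluded_middle_informative (z = z)) as [_|n]; [|now elim n].
    destruct (excluded_middle_informative (y = z)) as [E|n].
    * replace (l - l) with (RtoC 0) by ring. rewrite Cmod_0. assumption.
    * assert (n' := Cminus_neq_0 _ _ n).
      replace ((f y - f z) / (y - z) - l) with ((f y - f z - l * (y - z)) / (y - z))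
        by (field; assumption).
      rewrite Cmod_div by assumption.
      apply Cmod_gt_0 in n'.
      apply Rle_lt_trans with (eps / 2)%R; [|lra].
      apply Rle_div_l; assumption.
  + destruct (excluded_middle_informative (z = z)) as [_|n]; [reflexivity|now elim n].
  + intros y. destruct (excluded_middle_informative (y = z)) as [E|n].
    * subst. ring.
    * field. apply Cminus_neq_0, n.
- intros [phi [H1 [H2 H3]]] eps He.
  destruct (proj1 (continuous_C_eps _ _) H1 eps He) as [d [Hd K]].
  exists d. split; [assumption|]. intros y Hy. specialize (K y Hy).
  rewrite (H3 y). replace (f z + phi y * (y - z) - f z - l * (y - z))
    with ((phi y - phi z) * (y - z)) by (rewrite H2; ring).
  rewrite Cmod_mult. apply Rmult_le_compat_r; [apply Cmod_ge_0|lra].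
Qed.

Definition cder (f : C -> C) (z l : C) : Prop := @is_derive C_AbsRing C_NormedModule f z l.

Lemma cder_continuous (f : C -> C) (z l : C) :
  cder f z l -> continuous (T := C_UniformSpace) (U := C_UniformSpace) f z.
Proof.
intros H. apply is_derive_caratheodory in H as [phi [H1 [H2 H3]]].
apply (continuous_ext (fun y => f z + phi y * (y - z))); [intros; symmetry; apply H3|].
apply continuous_Cplus; [apply continuous_const|].
apply continuous_Cmult; [assumption|].
apply continuous_Cminus; [apply continuous_id | apply continuous_const].
Qed.

Lemma cder_const (c z : C) : cder (fun _ => c) z 0.
Proof.
apply is_derive_caratheodory. exists (fun _ => RtoC 0). repeat split.
- apply continuous_const.
- intros; ring.
Qed.

Lemma cder_id (z : C) : cder (fun y => y) z 1.
Proof.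
apply is_derive_caratheodory. exists (fun _ => RtoC 1). repeat split.
- apply continuous_const.
- intros; ring.
Qed.

Lemma cder_plus (f g : C -> C) (z l m : C) :
  cder f z l -> cder g z m -> cder (fun y => f y + g y) z (l + m).
Proof.
unfold cder. rewrite !is_derive_caratheodory.
intros [p [P1 [P2 P3]]] [q [Q1 [Q2 Q3]]].
exists (fun y => p y + q y). repeat split.
- apply continuous_Cplus; assumption.
- now rewrite P2, Q2.
- intros y. rewrite P3, Q3. ring.
Qed.

Lemma cder_mult (f g : C -> C) (z l m : C) :
  cder f z l -> cder g z m -> cder (fun y => f y * g y) z (l * g z + f z * m).
Proof.
intros Hf Hg. assert (G := cder_continuous _ _ _ Hg). revert Hf Hg.
unfold cder. rewrite !is_derive_caratheodory.
intros [p [P1 [P2 P3]]] [q [Q1 [Q2 Q3]]].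
exists (fun y => p y * g y + f z * q y). repeat split.
- apply continuous_Cplus; apply continuous_Cmult; try assumption. apply continuous_const.
- now rewrite P2, Q2.
- intros y. rewrite (P3 y). rewrite (Q3 y). ring.
Qed.

Lemma cder_comp (f g : C -> C) (z l m : C) :
  cder f (g z) l -> cder g z m -> cder (fun y => f (g y)) z (l * m).
Proof.
intros Hf Hg. assert (G := cder_continuous _ _ _ Hg). revert Hf Hg.
unfold cder. rewrite !is_derive_caratheodory.
intros [p [P1 [P2 P3]]] [q [Q1 [Q2 Q3]]].
exists (fun y => p (g y) * q y). repeat split.
- apply continuous_Cmult; [|assumption].
  apply (continuous_comp g p); assumption.
- now rewrite P2, Q2.
- intros y. rewrite (P3 (g y)). rewrite (Q3 y) at 2. ring.
Qed.

Lemma cder_inv (f : C -> C) (z l : C) :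
  f z <> 0 -> cder f z l -> cder (fun y => / f y) z (- l / (f z * f z)).
Proof.
intros Hz Hf. assert (F := cder_continuous _ _ _ Hf).
apply is_derive_C_eps. intros eps He.
apply is_derive_caratheodory in Hf as [p [P1 [P2 P3]]].
assert (K : continuous (T := C_UniformSpace) (U := C_UniformSpace)
  (fun y => - p y / (f z * f y)) z).
{ apply continuous_Cdiv.
  - apply Cmult_neq_0; assumption.
  - now apply continuous_Copp.
  - apply continuous_Cmult; [apply continuous_const|assumption]. }
destruct (proj1 (continuous_C_eps _ _) K eps He) as [d [Hd D]].
destruct (proj1 (continuous_C_eps _ _) F (Cmod (f z))) as [d' [Hd' D']].
{ now apply Cmod_gt_0. }
exists (Rmin d d'). split; [now apply Rmin_glb_lt|].
intros y Hy.
assert (Hy1 : Cmod (y - z) < d) by (eapply Rlt_le_trans; [apply Hy|apply Rmin_l]).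
assert (Hy2 : Cmod (y - z) < d') by (eapply Rlt_le_trans; [apply Hy|apply Rmin_r]).
assert (Hfy : f y <> 0).
{ intros E. specialize (D' y Hy2). rewrite E in D'.
  replace (0 - f z) with (- f z) in D' by ring. rewrite Cmod_opp in D'. lra. }
specialize (D y Hy1).
replace (/ f y - / f z - - l / (f z * f z) * (y - z))
  with ((- p y / (f z * f y) - - p z / (f z * f z)) * (y - z)).
- rewrite Cmod_mult. apply Rmult_le_compat_r; [apply Cmod_ge_0|lra].
- rewrite P2.
  assert (E : / f y - / f z = - (p y * (y - z)) / (f z * f y)).
  { replace (p y * (y - z)) with (f y - f z) by (rewrite (P3 y); ring).
    field. now split. }
  rewrite E. field. now split.
Qed.

Lemma cder_unique (f : C -> C) (z l m : C) : cder f z l -> cder f z m -> l = m.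
Proof.
intros Hl Hm. apply is_C_derive_unique in Hl. apply is_C_derive_unique in Hm. congruence.
Qed.

Lemma cder_cderiv (f : C -> C) (z : C) : cdiff f z -> cder f z (cderiv f z).
Proof. intros H. unfold cder, cderiv. apply epsilon_spec. exact H. Qed.

Lemma cderiv_eq (f : C -> C) (z l : C) : cder f z l -> cderiv f z = l.
Proof.
intros H. apply (cder_unique f z); [|exact H].
apply cder_cderiv. now exists l.
Qed.

(** Functions are total on [C] while identities between them hold only on the disc, so derivatives
    have to be transported along equality near a point. *)
Lemma cder_ext_loc (f g : C -> C) (z0 m : C) (r : R) :
  0 < r -> (forall y, Cmod (y - z0) < r -> f y = g y) -> cder f z0 m -> cder g z0 m.
Proof.
intros Hr E. unfold cder. rewrite !is_derive_C_eps.
intros H eps He. destruct (H eps He) as [d0 [Hd K]].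
exists (Rmin d0 r). split; [now apply Rmin_glb_lt|].
intros y Hy.
assert (Hy1 : Cmod (y - z0) < d0) by (eapply Rlt_le_trans; [apply Hy|apply Rmin_l]).
assert (Hy2 : Cmod (y - z0) < r) by (eapply Rlt_le_trans; [apply Hy|apply Rmin_r]).
rewrite <- (E y Hy2), <- (E z0); [now apply K|].
replace (z0 - z0) with (RtoC 0) by ring. now rewrite Cmod_0.
Qed.

Lemma cder_eq (f : C -> C) (z l m : C) : cder f z l -> l = m -> cder f z m.
Proof. intros H E. now rewrite <- E. Qed.

Lemma cder_minus_const (z0 z : C) : cder (fun z => z - z0) z 1.
Proof.
apply (cder_eq _ _ (1 + 0)); [|ring].
apply cder_plus; [apply cder_id|apply cder_const].
Qed.

Lemma cder_scal (c : C) (f : C -> C) (z l : C) : cder f z l -> cder (fun y => c * f y) z (c * l).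
Proof.
intros H. apply (cder_eq _ _ (0 * f z + c * l)); [|ring].
apply (cder_mult (fun _ => c) f); [apply cder_const|exact H].
Qed.

(** * Integrals of complex-valued functions *)

Definition cint (f : R -> C) (a b : R) : C := @RInt C_R_CompleteNormedModule f a b.

Lemma ex_cint (f : R -> C) (a b : R) :
  (forall t, (Rmin a b <= t <= Rmax a b)%R -> continuous f t) ->
  @ex_RInt C_R_NormedModule f a b.
Proof. intros H. apply (ex_RInt_continuous (V := C_R_CompleteNormedModule)). exact H. Qed.

Lemma cint_plus (f g : R -> C) (a b : R) :
  (forall t, (Rmin a b <= t <= Rmax a b)%R -> continuous f t) ->
  (forall t, (Rmin a b <= t <= Rmax a b)%R -> continuous g t) ->
  cint (fun t => f t + g t) a b = cint f a b + cint g a b.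
Proof.
intros Hf Hg. apply (RInt_plus (V := C_R_CompleteNormedModule)); apply ex_cint; assumption.
Qed.

Lemma cint_minus (f g : R -> C) (a b : R) :
  (forall t, (Rmin a b <= t <= Rmax a b)%R -> continuous f t) ->
  (forall t, (Rmin a b <= t <= Rmax a b)%R -> continuous g t) ->
  cint (fun t => f t - g t) a b = cint f a b - cint g a b.
Proof.
intros Hf Hg. apply (RInt_minus (V := C_R_CompleteNormedModule)); apply ex_cint; assumption.
Qed.

(** The integral lives in [C] as a real normed module, whose linearity covers real scalars; a
    complex constant is handled coordinate by coordinate. *)
Lemma cint_scal (c : C) (f : R -> C) (a b : R) :
  (forall t, (Rmin a b <= t <= Rmax a b)%R -> continuous f t) ->
  cint (fun t => c * f t) a b = c * cint f a b.
Proof.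
intros Hf. apply (is_RInt_unique (V := C_R_CompleteNormedModule)).
assert (K := RInt_correct (V := C_R_CompleteNormedModule) f a b (ex_cint _ _ _ Hf)).
fold (cint f a b) in K.
assert (K1 := is_RInt_fct_extend_fst (U := R_NormedModule) (V := R_NormedModule) _ _ _ _ K).
assert (K2 := is_RInt_fct_extend_snd (U := R_NormedModule) (V := R_NormedModule) _ _ _ _ K).
apply (is_RInt_fct_extend_pair (U := R_NormedModule) (V := R_NormedModule)); simpl.
- apply (is_RInt_minus (V := R_NormedModule));
  apply (is_RInt_scal (V := R_NormedModule)); assumption.
- apply (is_RInt_plus (V := R_NormedModule));
  apply (is_RInt_scal (V := R_NormedModule)); assumption.
Qed.

Lemma cint_ext (f g : R -> C) (a b : R) :
  (forall t, (Rmin a b <= t <= Rmax a b)%R -> f t = g t) -> cint f a b = cint g a b.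
Proof. intros H. apply (RInt_ext (V := C_R_CompleteNormedModule)). intros t Ht. apply H. lra. Qed.

Lemma cint_bound (f : R -> C) (a b M : R) : (a <= b)%R ->
  (forall t, (a <= t <= b)%R -> continuous f t) ->
  (forall t, (a <= t <= b)%R -> (Cmod (f t) <= M)%R) ->
  (Cmod (cint f a b) <= (b - a) * M)%R.
Proof.
intros Hab Hc HM. rewrite Cmod_norm.
apply (norm_RInt_le_const (V := C_R_NormedModule) f); [exact Hab| |].
- intros t Ht. rewrite <- Cmod_norm. now apply HM.
- apply (RInt_correct (V := C_R_CompleteNormedModule)). apply ex_cint.
  intros t. rewrite Rmin_left, Rmax_right by assumption. apply Hc.
Qed.

Definition rder (f : R -> C) (x : R) (l : C) : Prop :=
  @is_derive R_AbsRing C_R_NormedModule f x l.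

Lemma rder_eps (f : R -> C) (x : R) (l : C) :
  rder f x l <->
  forall eps, 0 < eps -> exists delta, 0 < delta /\
    forall y, (Rabs (y - x) < delta)%R ->
      (Cmod (f y - f x - l * RtoC (y - x)) <= eps * Rabs (y - x))%R.
Proof.
assert (N : forall y, norm (V := C_R_NormedModule) (minus (minus (f y) (f x)) (scal (V := C_R_NormedModule) (minus y x) l))
   = Cmod (f y - f x - l * RtoC (y - x))).
{ intros y. rewrite <- Cmod_norm. f_equal. rewrite scal_R_Cmult.
  change (minus y x) with (y - x)%R.
  change ((f y - f x) - (y - x)%R * l = f y - f x - l * (y - x)%R). ring. }
split.
- intros [_ H] eps He.
  destruct (H x (fun P HP => HP) (mkposreal eps He)) as [d Hd].
  exists d. split; [apply cond_pos|].
  intros y Hy. rewrite <- N. exact (Hd y Hy).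
- intros H. split.
  + apply is_linear_scal_l.
  + intros z Hx eps.
    assert (E : z = x).
    { symmetry. apply (is_filter_lim_locally_unique (K := R_AbsRing) (V := R_NormedModule)). exact Hx. }
    subst z.
    destruct (H eps (cond_pos eps)) as [d [Hd K]].
    exists (mkposreal d Hd). intros y Hy. specialize (K y Hy).
    rewrite <- N in K. exact K.
Qed.

Lemma Cmod_le_Rabs (z : C) : (Cmod z <= Rabs (fst z) + Rabs (snd z))%R.
Proof.
replace z with (RtoC (fst z) + Ci * RtoC (snd z)) at 1.
- eapply Rle_trans; [apply Cmod_triangle|].
  rewrite Cmod_mult, Cmod_Ci, !Cmod_R. lra.
- apply injective_projections; simpl; ring.
Qed.

Lemma rder_pair (f : R -> C) (x : R) (l : C) :
  is_derive (fun t => fst (f t)) x (fst l) -> is_derive (fun t => snd (f t)) x (snd l) ->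
  rder f x l.
Proof.
intros [_ H1] [_ H2]. apply rder_eps. intros eps He.
assert (He2 : (0 < eps / 2)%R) by lra.
destruct (H1 x (fun P HP => HP) (mkposreal _ He2)) as [d1 D1].
destruct (H2 x (fun P HP => HP) (mkposreal _ He2)) as [d2 D2].
exists (Rmin d1 d2). split; [apply Rmin_glb_lt; apply cond_pos|].
intros y Hy.
specialize (D1 y (Rlt_le_trans _ _ _ Hy (Rmin_l _ _))).
specialize (D2 y (Rlt_le_trans _ _ _ Hy (Rmin_r _ _))).
change (Rabs (fst (f y) - fst (f x) - (y - x) * fst l) <= eps / 2 * Rabs (y - x))%R in D1.
change (Rabs (snd (f y) - snd (f x) - (y - x) * snd l) <= eps / 2 * Rabs (y - x))%R in D2.
eapply Rle_trans; [apply Cmod_le_Rabs|]. simpl.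
replace (fst (f y) + - fst (f x) + - (fst l * (y - x) - snd l * 0))%R
  with (fst (f y) - fst (f x) - (y - x) * fst l)%R by ring.
replace (snd (f y) + - snd (f x) + - (fst l * 0 + snd l * (y - x)))%R
  with (snd (f y) - snd (f x) - (y - x) * snd l)%R by ring.
lra.
Qed.

Lemma rder_continuous (f : R -> C) (x : R) (l : C) : rder f x l -> continuous f x.
Proof.
intros H. apply (ex_derive_continuous (V := C_R_NormedModule)). now exists l.
Qed.

Lemma rder_comp (G : C -> C) (g : R -> C) (x : R) (l m : C) :
  cder G (g x) l -> rder g x m -> rder (fun t => G (g t)) x (l * m).
Proof.
intros HG Hg. assert (Cg := rder_continuous _ _ _ Hg).
apply is_derive_caratheodory in HG as [p [P1 [P2 P3]]].
assert (Cp : continuous (fun t => p (g t)) x).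
{ apply (continuous_comp g p); assumption. }
apply rder_eps. intros eps He.
set (A := (Cmod l + 1)%R). set (B := (Cmod m + 1)%R).
assert (HA : (0 < A)%R) by (unfold A; pose proof (Cmod_ge_0 l); lra).
assert (HB : (0 < B)%R) by (unfold B; pose proof (Cmod_ge_0 m); lra).
(* The bound 1 keeps the slope of G along the curve below A = |l| + 1 near x; the bound eps/(2B)
   makes its deviation from l cost at most eps/2. The other eps/2 pays for the linearisation error
   of g. *)
set (e1 := Rmin 1 (eps / (2 * B))%R).
assert (He1 : (0 < e1 / 2)%R).
{ apply Rdiv_lt_0_compat; [|lra]. unfold e1. apply Rmin_glb_lt; [lra|].
  apply Rdiv_lt_0_compat; nra. }
destruct (proj1 (rder_eps _ _ _) Hg (eps / (2 * A))%R) as [d1 [D1 K1]].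
{ apply Rdiv_lt_0_compat; nra. }
destruct (proj1 (filterlim_locally _ _) Cp (mkposreal _ He1)) as [d2 K2].
exists (Rmin d1 d2). split; [apply Rmin_glb_lt; [assumption|apply cond_pos]|].
intros y Hy.
specialize (K1 y (Rlt_le_trans _ _ _ Hy (Rmin_l _ _))).
specialize (K2 y (Rlt_le_trans _ _ _ Hy (Rmin_r _ _))).
apply ball_C_inv in K2. rewrite P2 in K2. simpl in K2.
assert (K3 : (Cmod (p (g y) - l) <= e1)%R) by lra.
replace (G (g y) - G (g x) - l * m * RtoC (y - x))
  with (p (g y) * (g y - g x - m * RtoC (y - x)) + (p (g y) - l) * (m * RtoC (y - x)))
  by (rewrite (P3 (g y)); ring).
eapply Rle_trans; [apply Cmod_triangle|]. rewrite !Cmod_mult, Cmod_R.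
assert (L1 : (Cmod (p (g y)) <= A)%R).
{ replace (p (g y)) with (l + (p (g y) - l)) by ring.
  eapply Rle_trans; [apply Cmod_triangle|]. unfold A.
  assert (e1 <= 1)%R by apply Rmin_l. lra. }
assert (L2 : (Cmod (p (g y) - l) * Cmod m <= eps / 2)%R).
{ apply Rle_trans with (eps / (2 * B) * B)%R.
  - apply Rmult_le_compat; try apply Cmod_ge_0.
    + eapply Rle_trans; [apply K3|]. apply Rmin_r.
    + unfold B; lra.
  - right. field. lra. }
assert (L3 : (Cmod (p (g y)) * Cmod (g y - g x - m * RtoC (y - x)) <= A * (eps / (2 * A) * Rabs (y - x)))%R).
{ apply Rmult_le_compat; try apply Cmod_ge_0; assumption. }
replace (A * (eps / (2 * A) * Rabs (y - x)))%R with (eps / 2 * Rabs (y - x))%R in L3 by (field; lra).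
assert (0 <= Rabs (y - x))%R by apply Rabs_pos.
rewrite <- Rmult_assoc. nra.
Qed.

Lemma cint_path (G g : C -> C) (gam dgam : R -> C) (a b : R) :
  (forall t, (Rmin a b <= t <= Rmax a b)%R ->
     cder G (gam t) (g (gam t)) /\ rder gam t (dgam t) /\
     continuous g (gam t) /\ continuous dgam t) ->
  cint (fun t => g (gam t) * dgam t) a b = G (gam b) - G (gam a).
Proof.
intros H. apply (is_RInt_unique (V := C_R_CompleteNormedModule)).
apply (is_RInt_derive (V := C_R_CompleteNormedModule) (fun t => G (gam t))).
- intros t Ht. destruct (H t Ht) as [H1 [H2 _]]. now apply rder_comp.
- intros t Ht. destruct (H t Ht) as [H1 [H2 [H3 H4]]].
  apply continuous_Cmult; [|assumption].
  apply (continuous_comp gam g); [|assumption].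
  eapply rder_continuous; eassumption.
Qed.

(** * Integrals along line segments *)

Definition lin (p v : C) (s : R) : C := p + RtoC s * v.

Lemma rder_lin (p v : C) (s : R) : rder (lin p v) s v.
Proof.
apply rder_eps. intros eps He. exists 1%R. split; [lra|]. intros y _.
unfold lin.
replace (p + y * v - (p + s * v) - v * RtoC (y - s)) with (RtoC 0)
  by (rewrite RtoC_minus; ring).
rewrite Cmod_0. apply Rmult_le_pos; [lra|apply Rabs_pos].
Qed.

(** The contour integral of f from p to p + v. Using a base point and a direction makes the
    subdivision of triangles plain vector algebra. *)
Definition seg (f : C -> C) (p v : C) : C := v * cint (fun s => f (lin p v s)) 0 1.

Lemma seg_primitive (G g : C -> C) (p v : C) :
  (forall s, (0 <= s <= 1)%R ->
     cder G (lin p v s) (g (lin p v s)) /\ continuous g (lin p v s)) ->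
  seg g p v = G (p + v) - G p.
Proof.
intros H. unfold seg.
assert (M : forall t, (Rmin 0 1 <= t <= Rmax 0 1)%R -> (0 <= t <= 1)%R).
{ intros t. rewrite Rmin_left, Rmax_right by lra. tauto. }
rewrite <- cint_scal.
- rewrite (cint_ext _ (fun s => g (lin p v s) * v)).
  + rewrite (cint_path G g (lin p v) (fun _ => v)).
    * unfold lin. f_equal; [f_equal; ring|f_equal; f_equal; ring].
    * intros t Ht. destruct (H t (M t Ht)).
      split; [assumption|]. split; [apply rder_lin|]. split; [assumption|].
      apply continuous_const.
  + intros; ring.
- intros t Ht. apply (continuous_comp (lin p v) g); [|now apply H, M].
  eapply rder_continuous, rder_lin.
Qed.

(** An affine change of parameter. No order between a and b is assumed, so a = 1, b = 0 yields
    reversal, and intermediate values yield splitting. *)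
Lemma seg_sub (f : C -> C) (p v : C) (a b : R) :
  (forall s, (Rmin a b <= s <= Rmax a b)%R -> continuous f (lin p v s)) ->
  seg f (p + RtoC a * v) (RtoC (b - a) * v) = v * cint (fun s => f (lin p v s)) a b.
Proof.
intros H. unfold seg.
assert (Cf : forall s, (Rmin a b <= s <= Rmax a b)%R -> continuous (fun s => f (lin p v s)) s).
{ intros s Hs. apply (continuous_comp (lin p v) f); [|now apply H].
  eapply rder_continuous, rder_lin. }
assert (Ex := ex_cint _ _ _ Cf).
assert (E := RInt_comp_lin (V := C_R_CompleteNormedModule) (fun s => f (lin p v s)) (b - a)%R a 0 1).
replace ((b - a) * 0 + a)%R with a in E by ring.
replace ((b - a) * 1 + a)%R with b in E by ring.
specialize (E Ex). unfold cint. rewrite <- E.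
rewrite (Cmult_comm (RtoC (b - a)) v), <- Cmult_assoc. f_equal.
fold (cint (fun s => f (lin (p + RtoC a * v) (v * RtoC (b - a)) s)) 0 1).
rewrite <- cint_scal.
- apply cint_ext. intros t _. rewrite scal_R_Cmult. do 2 f_equal.
  unfold lin. rewrite RtoC_plus, RtoC_mult. ring.
- intros t Ht. rewrite Rmin_left, Rmax_right in Ht by lra.
  apply (continuous_comp (lin _ _) f); [eapply rder_continuous, rder_lin|].
  replace (lin (p + a * v) (v * (b - a)%R) t) with (lin p v (a + t * (b - a))).
  + apply H. unfold Rmin, Rmax. destruct (Rle_dec a b); nra.
  + unfold lin. rewrite RtoC_plus, RtoC_mult. ring.
Qed.

Lemma seg_split (f : C -> C) (p v : C) (r : R) : (0 <= r <= 1)%R ->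
  (forall s, (0 <= s <= 1)%R -> continuous f (lin p v s)) ->
  seg f p v = seg f p (RtoC r * v) + seg f (p + RtoC r * v) (RtoC (1 - r) * v).
Proof.
intros Hr H.
rewrite (seg_sub f p v r 1).
2:{ intros s. rewrite Rmin_left, Rmax_right by lra. intros Hs. apply H. lra. }
assert (E := seg_sub f p v 0 r). rewrite Rmin_left, Rmax_right in E by lra.
replace (p + RtoC 0 * v) with p in E by ring. rewrite Rminus_0_r in E.
rewrite E.
2:{ intros s Hs. apply H. lra. }
rewrite <- Cmult_plus_distr_l. unfold seg. f_equal. symmetry.
assert (Cf : forall s, (0 <= s <= 1)%R -> continuous (fun s => f (lin p v s)) s).
{ intros s Hs. apply (continuous_comp (lin p v) f); [|now apply H].
  eapply rder_continuous, rder_lin. }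
apply (RInt_Chasles (V := C_R_CompleteNormedModule)); apply ex_cint; intros s;
rewrite Rmin_left, Rmax_right by lra; intros Hs; apply Cf; lra.
Qed.

Lemma seg_rev (f : C -> C) (p v : C) :
  (forall s, (0 <= s <= 1)%R -> continuous f (lin p v s)) ->
  seg f (p + v) (- v) = - seg f p v.
Proof.
intros H.
assert (E := seg_sub f p v 1 0). rewrite Rmin_right, Rmax_left in E by lra.
specialize (E H).
replace (p + RtoC 1 * v) with (p + v) in E by ring.
replace (RtoC (0 - 1) * v) with (- v) in E by (rewrite RtoC_minus; ring).
rewrite E. unfold cint.
rewrite <- (opp_RInt_swap (V := C_R_CompleteNormedModule)).
- unfold seg, cint. change (opp ?x) with (- x).
  match goal with |- v * ?x = _ => change x with (- (RInt (V := C_R_CompleteNormedModule) (fun s => f (lin p v s)) 0 1)) end.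
  ring.
- apply ex_cint. intros s. rewrite Rmin_left, Rmax_right by lra. intros Hs.
  apply (continuous_comp (lin p v) f); [|apply H; lra].
  eapply rder_continuous, rder_lin.
Qed.

Lemma continuous_lin (f : C -> C) (p v : C) (s : R) :
  continuous f (lin p v s) -> continuous (fun s => f (lin p v s)) s.
Proof.
intros H. apply (continuous_comp (lin p v) f); [|assumption].
eapply rder_continuous, rder_lin.
Qed.

Lemma seg_bound (f : C -> C) (p v : C) (M : R) :
  (forall s, (0 <= s <= 1)%R -> continuous f (lin p v s)) ->
  (forall s, (0 <= s <= 1)%R -> (Cmod (f (lin p v s)) <= M)%R) ->
  (Cmod (seg f p v) <= Cmod v * M)%R.
Proof.
intros Hc HM. unfold seg. rewrite Cmod_mult.
apply Rmult_le_compat_l; [apply Cmod_ge_0|].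
replace M with ((1 - 0) * M)%R by ring.
apply cint_bound; [lra| |exact HM].
intros t Ht. now apply continuous_lin, Hc.
Qed.

Lemma seg_minus (f g : C -> C) (p v : C) :
  (forall s, (0 <= s <= 1)%R -> continuous f (lin p v s)) ->
  (forall s, (0 <= s <= 1)%R -> continuous g (lin p v s)) ->
  seg (fun z => f z - g z) p v = seg f p v - seg g p v.
Proof.
intros Hf Hg. unfold seg. rewrite cint_minus; [ring| |];
intros t; rewrite Rmin_left, Rmax_right by lra; intros Ht; now apply continuous_lin; auto.
Qed.

(** * Goursat's lemma *)

Definition cconvex (K : C -> Prop) : Prop :=
  forall x v s, K x -> K (x + v) -> (0 <= s <= 1)%R -> K (lin x v s).

Definition cclosed (K : C -> Prop) : Prop :=
  forall x, (forall eps, 0 < eps -> exists y, K y /\ (Cmod (y - x) < eps)%R) -> K x.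

(** The contour integral around the triangle with vertices p, p + u, p + v; the third edge is
    traversed backwards, hence the minus sign. *)
Definition tri (f : C -> C) (p u v : C) : C :=
  seg f p u + seg f (p + u) (v - u) - seg f p v.

Lemma C_complete (p : nat -> C) :
  (forall eps, 0 < eps -> exists N, forall m, (N <= m)%nat -> (Cmod (p m - p N) <= eps)%R) ->
  exists l, forall eps, 0 < eps -> exists N, forall m, (N <= m)%nat -> (Cmod (p m - l) <= eps)%R.
Proof.
intros H.
assert (A : forall h : C -> R, (forall x y, (Rabs (h x - h y) <= Cmod (x - y))%R) ->
  ex_finite_lim_seq (fun k => h (p k))).
{ intros h Hh. apply ex_lim_seq_cauchy_corr. intros eps.
  destruct (H (eps / 3)%R) as [N HN]; [pose proof (cond_pos eps); lra|].
  exists N. intros n m Hn Hm.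
  pose proof (HN n Hn). pose proof (HN m Hm).
  replace (h (p n) - h (p m))%R with ((h (p n) - h (p N)) - (h (p m) - h (p N)))%R by ring.
  eapply Rle_lt_trans; [apply Rabs_triang|]. rewrite Rabs_Ropp.
  pose proof (Hh (p n) (p N)). pose proof (Hh (p m) (p N)).
  pose proof (cond_pos eps). lra. }
assert (B : forall x y : C, (Rmax (Rabs (fst x - fst y)) (Rabs (snd x - snd y)) <= Cmod (x - y))%R).
{ intros x y. apply (Rmax_Cmod (x - y)). }
destruct (A fst) as [a Ha].
{ intros x y. eapply Rle_trans; [apply Rmax_l|apply B]. }
destruct (A snd) as [b Hb].
{ intros x y. eapply Rle_trans; [apply Rmax_r|apply B]. }
exists (a, b). intros eps He.
apply is_lim_seq_spec in Ha. apply is_lim_seq_spec in Hb.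
assert (He2 : (0 < eps / 2)%R) by lra.
destruct (Ha (mkposreal _ He2)) as [N1 H1]. destruct (Hb (mkposreal _ He2)) as [N2 H2].
exists (max N1 N2). intros m Hm.
specialize (H1 m ltac:(lia)). specialize (H2 m ltac:(lia)). simpl in H1, H2.
eapply Rle_trans; [apply Cmod_le_Rabs|]. simpl. unfold Rminus in *. lra.
Qed.

(** Joining the midpoints of the edges, each inner edge is traversed twice in opposite directions
    and cancels. The middle triangle is a half-size copy after a half turn, which is why both its
    vectors carry a minus sign. *)
Lemma tri_split (K : C -> Prop) (f : C -> C) (p u v : C) :
  cconvex K -> (forall z, K z -> continuous f z) ->
  K p -> K (p + u) -> K (p + v) ->
  tri f p u v = tri f p (u / 2) (v / 2) + tri f (p + u / 2) (u / 2) (v / 2)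
    + tri f (p + v / 2) (u / 2) (v / 2) + tri f (p + (u + v) / 2) (- (u / 2)) (- (v / 2)).
Proof.
intros HK Hf Kp Ku Kv.
assert (Kvu : K (p + u + (v - u))) by (replace (p + u + (v - u)) with (p + v) by ring; assumption).
assert (half : forall x w, K x -> K (x + w) -> K (x + w / 2)).
{ intros x w Hx Hw. replace (x + w / 2) with (lin x w (/ 2)).
  - apply HK; [assumption|assumption|lra].
  - unfold lin. rewrite RtoC_inv by lra. field. }
assert (S : forall x w, K x -> K (x + w) -> seg f x w = seg f x (w / 2) + seg f (x + w / 2) (w / 2)).
{ intros x w Hx Hw. rewrite (seg_split f x w (/ 2)); [|lra|].
  - replace (1 - / 2)%R with (/ 2)%R by field. rewrite RtoC_inv by lra.
    replace (/ 2 * w) with (w / 2) by field. reflexivity.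
  - intros s Hs. apply Hf, HK; assumption. }
assert (R : forall x y w, K x -> K (x + w) -> y = x + w -> seg f y (- w) = - seg f x w).
{ intros x y w Hx Hw ->. apply seg_rev. intros s Hs. apply Hf, HK; assumption. }
unfold tri.
rewrite (S p u Kp Ku), (S p v Kp Kv), (S (p + u) (v - u) Ku Kvu).
assert (K1 := half p u Kp Ku). assert (K2 := half p v Kp Kv).
assert (K3 := half _ _ Ku Kvu).
replace (p + u + (v - u) / 2) with (p + (u + v) / 2) in * by field.
replace (p + u / 2 + u / 2) with (p + u) by field.
replace (p + v / 2 + u / 2) with (p + (u + v) / 2) by field.
replace (v / 2 - u / 2) with ((v - u) / 2) by field.
replace (- (v / 2) - - (u / 2)) with (- ((v - u) / 2)) by field.
replace (p + (u + v) / 2 + - (u / 2)) with (p + v / 2) by field.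
rewrite (R (p + v / 2) (p + (u + v) / 2) (u / 2)); [| assumption | | field].
2:{ replace (p + v / 2 + u / 2) with (p + (u + v) / 2) by field. assumption. }
rewrite (R (p + u / 2) (p + v / 2) ((v - u) / 2)); [| assumption | | field].
2:{ replace (p + u / 2 + (v - u) / 2) with (p + v / 2) by field. assumption. }
rewrite (R (p + u / 2) (p + (u + v) / 2) (v / 2)); [| assumption | | field].
2:{ replace (p + u / 2 + v / 2) with (p + (u + v) / 2) by field. assumption. }
ring.
Qed.

Lemma tri_affine (p u v z0 a b : C) : tri (fun z => a + b * (z - z0)) p u v = 0.
Proof.
set (g := fun z => a + b * (z - z0)).
assert (Hg : forall z, cder g z b).
{ intros z. unfold g. apply (cder_eq _ _ (0 + b * 1)); [|ring].
  apply cder_plus; [apply cder_const|]. apply cder_scal, cder_minus_const. }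
set (G := fun z => a * z + (b / 2) * ((z - z0) * (z - z0))).
assert (HG : forall z, cder G z (g z)).
{ intros z. unfold G, g. assert (D := cder_minus_const z0 z).
  apply (cder_eq _ _ (a * 1 + b / 2 * (1 * (z - z0) + (z - z0) * 1))); [|field].
  apply cder_plus; apply cder_scal; [apply cder_id|].
  apply (cder_mult (fun z => z - z0) (fun z => z - z0)); exact D. }
unfold tri. rewrite !(seg_primitive G g).
- replace (p + u + (v - u)) with (p + v) by ring. ring.
- intros s _. split; [apply HG|]. eapply cder_continuous, Hg.
- intros s _. split; [apply HG|]. eapply cder_continuous, Hg.
- intros s _. split; [apply HG|]. eapply cder_continuous, Hg.
Qed.

(** The perimeter is at most twice |u| + |v|. The bound on f is required only within |u| + |v| of p,
    so that it can come from a local estimate around a point. *)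
Lemma tri_bound (K : C -> Prop) (f : C -> C) (p u v : C) (M : R) :
  cconvex K -> (forall z, K z -> continuous f z) -> (0 <= M)%R ->
  K p -> K (p + u) -> K (p + v) ->
  (forall z, K z -> (Cmod (z - p) <= Cmod u + Cmod v)%R -> (Cmod (f z) <= M)%R) ->
  (Cmod (tri f p u v) <= 2 * (Cmod u + Cmod v) * M)%R.
Proof.
intros HK Hf HM Kp Ku Kv Hb.
assert (Kvu : K (p + u + (v - u))) by (replace (p + u + (v - u)) with (p + v) by ring; assumption).
pose proof (Cmod_ge_0 u). pose proof (Cmod_ge_0 v).
assert (B : forall x w, K x -> K (x + w) ->
  (forall s, (0 <= s <= 1)%R -> (Cmod (lin x w s - p) <= Cmod u + Cmod v)%R) ->
  (Cmod (seg f x w) <= Cmod w * M)%R).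
{ intros x w Hx Hw Hs. apply seg_bound.
  - intros s Hs'. apply Hf, HK; assumption.
  - intros s Hs'. apply Hb; [apply HK; assumption|]. now apply Hs. }
assert (B1 := B p u Kp Ku). assert (B2 := B p v Kp Kv). assert (B3 := B (p + u) (v - u) Ku Kvu).
unfold lin in B1, B2, B3.
assert (L1 : (Cmod (seg f p u) <= Cmod u * M)%R).
{ apply B1. intros s Hs. replace (p + s * u - p) with (s * u) by ring.
  rewrite Cmod_mult, Cmod_R, Rabs_pos_eq by lra. nra. }
assert (L2 : (Cmod (seg f p v) <= Cmod v * M)%R).
{ apply B2. intros s Hs. replace (p + s * v - p) with (s * v) by ring.
  rewrite Cmod_mult, Cmod_R, Rabs_pos_eq by lra. nra. }
assert (L3 : (Cmod (seg f (p + u) (v - u)) <= Cmod (v - u) * M)%R).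
{ apply B3. intros s Hs.
  replace (p + u + s * (v - u) - p) with (RtoC (1 - s) * u + s * v) by (rewrite RtoC_minus; ring).
  eapply Rle_trans; [apply Cmod_triangle|].
  rewrite !Cmod_mult, !Cmod_R, !Rabs_pos_eq by lra. nra. }
assert (L4 : (Cmod (v - u) <= Cmod u + Cmod v)%R).
{ eapply Rle_trans; [apply Cmod_triangle|]. rewrite Cmod_opp. lra. }
unfold tri.
eapply Rle_trans; [apply Cmod_triangle|]. rewrite Cmod_opp.
eapply Rle_trans; [apply Rplus_le_compat_r, Cmod_triangle|]. nra.
Qed.

Lemma tri_minus (K : C -> Prop) (f g : C -> C) (p u v : C) :
  cconvex K -> (forall z, K z -> continuous f z) -> (forall z, K z -> continuous g z) ->
  K p -> K (p + u) -> K (p + v) ->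
  tri (fun z => f z - g z) p u v = tri f p u v - tri g p u v.
Proof.
intros HK Hf Hg Kp Ku Kv.
assert (Kvu : K (p + u + (v - u))) by (replace (p + u + (v - u)) with (p + v) by ring; assumption).
unfold tri. rewrite !seg_minus; [ring|..]; intros s Hs;
(apply Hf || apply Hg); apply HK; assumption.
Qed.

Theorem goursat_triangle (K : C -> Prop) (f : C -> C) (p u v : C) :
  cconvex K -> cclosed K -> (forall z, K z -> exists l, cder f z l) ->
  K p -> K (p + u) -> K (p + v) -> tri f p u v = 0.
Proof.
intros HK HKc Hf Kp Ku Kv.
assert (Cf : forall z, K z -> continuous f z).
{ intros z Hz. destruct (Hf z Hz) as [l Hl]. eapply cder_continuous, Hl. }
set (L := (Cmod u + Cmod v)%R).
assert (HL : (0 <= L)%R) by (unfold L; pose proof (Cmod_ge_0 u); pose proof (Cmod_ge_0 v); lra).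
assert (Main : forall eps, (0 < eps)%R -> (Cmod (tri f p u v) <= eps * L ^ 2)%R).
{ intros eps He. apply Rnot_lt_le. intros Hbad.
  set (T := (C * (C * C))%type).
  (* |a| + |b| serves as the size of a triangle: it halves exactly at each subdivision, while at
     least one of the four pieces keeps a quarter of the integral. *)
  set (bad := fun (k : nat) (s : T) => let '(q, (a, b)) := s in
    K q /\ K (q + a) /\ K (q + b) /\ (Cmod a + Cmod b = L / 2 ^ k)%R /\
    (eps * (L / 2 ^ k) ^ 2 < Cmod (tri f q a b))%R).
  assert (step : forall k s, bad k s -> exists s', bad (S k) s' /\
     (Cmod (fst s' - fst s) <= L / 2 ^ k)%R).
  { intros k [q [a b]] [Kq [Ka [Kb [Hl Ht]]]].
    set (Lk := (L / 2 ^ k)%R) in *.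
    assert (HLk : (L / 2 ^ (S k) = Lk / 2)%R).
    { unfold Lk. simpl. field. apply pow_nonzero. lra. }
    pose proof (Cmod_ge_0 a). pose proof (Cmod_ge_0 b).
    assert (half : forall x w, K x -> K (x + w) -> K (x + w / 2)).
    { intros x w Hx Hw. replace (x + w / 2) with (lin x w (/ 2)).
      - apply HK; [assumption|assumption|lra].
      - unfold lin. rewrite RtoC_inv by lra. field. }
    assert (M2 : forall w, Cmod (w / 2) = (Cmod w / 2)%R).
    { intros w. rewrite Cmod_div. rewrite Cmod_R, Rabs_pos_eq by lra. reflexivity.
      intros E. apply RtoC_inj in E. lra. }
    assert (K1 := half q a Kq Ka). assert (K2 := half q b Kq Kb).
    assert (K3 : K (q + (a + b) / 2)).
    { replace (q + (a + b) / 2) with (q + a + (b - a) / 2) by field. apply half; [assumption|].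
      replace (q + a + (b - a)) with (q + b) by ring. assumption. }
    rewrite (tri_split K) in Ht; try assumption.
    set (t1 := tri f q (a / 2) (b / 2)) in *.
    set (t2 := tri f (q + a / 2) (a / 2) (b / 2)) in *.
    set (t3 := tri f (q + b / 2) (a / 2) (b / 2)) in *.
    set (t4 := tri f (q + (a + b) / 2) (- (a / 2)) (- (b / 2))) in *.
    assert (Ht' : (eps * Lk ^ 2 < Cmod t1 + Cmod t2 + Cmod t3 + Cmod t4)%R).
    { eapply Rlt_le_trans; [apply Ht|].
      eapply Rle_trans; [apply Cmod_triangle|]. apply Rplus_le_compat_r.
      eapply Rle_trans; [apply Cmod_triangle|]. apply Rplus_le_compat_r. apply Cmod_triangle. }
    assert (Hq : (eps * (Lk / 2) ^ 2 < Cmod t1 \/ eps * (Lk / 2) ^ 2 < Cmod t2 \/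
      eps * (Lk / 2) ^ 2 < Cmod t3 \/ eps * (Lk / 2) ^ 2 < Cmod t4)%R).
    { destruct (Rlt_le_dec (eps * (Lk / 2) ^ 2) (Cmod t1)); [tauto|].
      destruct (Rlt_le_dec (eps * (Lk / 2) ^ 2) (Cmod t2)); [tauto|].
      destruct (Rlt_le_dec (eps * (Lk / 2) ^ 2) (Cmod t3)); [tauto|].
      destruct (Rlt_le_dec (eps * (Lk / 2) ^ 2) (Cmod t4)); [tauto|]. nra. }
    unfold bad. rewrite HLk.
    assert (Hlen : (Cmod (a / 2) + Cmod (b / 2) = Lk / 2)%R) by (rewrite !M2; lra).
    destruct Hq as [Hq|[Hq|[Hq|Hq]]].
    - exists (q, (a / 2, b / 2)). split; [tauto|]. simpl.
      replace (q - q) with (RtoC 0) by ring. rewrite Cmod_0. lra.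
    - exists (q + a / 2, (a / 2, b / 2)).
      replace (q + a / 2 + a / 2) with (q + a) by field.
      replace (q + a / 2 + b / 2) with (q + (a + b) / 2) by field.
      split; [tauto|]. simpl.
      replace (q + a / 2 - q) with (a / 2) by ring. rewrite M2. lra.
    - exists (q + b / 2, (a / 2, b / 2)).
      replace (q + b / 2 + b / 2) with (q + b) by field.
      replace (q + b / 2 + a / 2) with (q + (a + b) / 2) by field.
      split; [tauto|]. simpl.
      replace (q + b / 2 - q) with (b / 2) by ring. rewrite M2. lra.
    - exists (q + (a + b) / 2, (- (a / 2), - (b / 2))).
      replace (q + (a + b) / 2 + - (a / 2)) with (q + b / 2) by field.
      replace (q + (a + b) / 2 + - (b / 2)) with (q + a / 2) by field.
      rewrite !Cmod_opp.
      split; [tauto|]. simpl.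
      replace (q + (a + b) / 2 - q) with (a / 2 + b / 2) by field.
      eapply Rle_trans; [apply Cmod_triangle|]. lra. }
  set (nxt := fun k s => epsilon (inhabits s) (fun s' => bad (S k) s' /\
     (Cmod (fst s' - fst s) <= L / 2 ^ k)%R)).
  set (sq := fix sq (k : nat) : T := match k with O => (p, (u, v)) | S k => nxt k (sq k) end).
  assert (Hsq : forall k, bad k (sq k)).
  { induction k.
    - simpl. repeat split; try assumption.
      + unfold L. field.
      + replace (L / 1)%R with L by field. exact Hbad.
    - apply (epsilon_spec (inhabits (sq k)) _ (step k (sq k) IHk)). }
  assert (Hd : forall k, (Cmod (fst (sq (S k)) - fst (sq k)) <= L / 2 ^ k)%R).
  { intros k. apply (epsilon_spec (inhabits (sq k)) _ (step k (sq k) (Hsq k))). }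
  assert (Hgeo : forall k m, (Cmod (fst (sq (k + m)%nat) - fst (sq k)) <= 2 * L / 2 ^ k - 2 * L / 2 ^ (k + m))%R).
  { intros k m. induction m.
    - rewrite Nat.add_0_r. replace (fst (sq k) - fst (sq k)) with (RtoC 0) by ring.
      rewrite Cmod_0. lra.
    - rewrite Nat.add_succ_r.
      replace (fst (sq (S (k + m))) - fst (sq k)) with
        ((fst (sq (S (k + m))) - fst (sq (k + m)%nat)) + (fst (sq (k + m)%nat) - fst (sq k))) by ring.
      eapply Rle_trans; [apply Cmod_triangle|].
      specialize (Hd (k + m)%nat).
      assert (E : (2 * L / 2 ^ (k + m) = L / 2 ^ (k + m) + 2 * L / 2 ^ S (k + m))%R).
      { simpl. field. apply pow_nonzero; lra. }
      lra. }
  assert (pow2pos : forall k, (0 < 2 ^ k)%R) by (intros; apply pow_lt; lra).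
  assert (Hgeo' : forall k m, (k <= m)%nat -> (Cmod (fst (sq m) - fst (sq k)) <= 2 * L / 2 ^ k)%R).
  { intros k m Hm. replace m with (k + (m - k))%nat by lia.
    eapply Rle_trans; [apply Hgeo|].
    assert (0 <= 2 * L / 2 ^ (k + (m - k)))%R by (apply Rdiv_le_0_compat; [lra|apply pow2pos]).
    lra. }
  assert (small : forall e, (0 < e)%R -> exists k, (L / 2 ^ k < e)%R).
  { intros e He'.
    destruct (pow_lt_1_zero (/ 2) ltac:(rewrite Rabs_pos_eq; lra) (e / (L + 1))%R) as [N HN].
    { apply Rdiv_lt_0_compat; lra. }
    exists N. specialize (HN N (le_n N)).
    rewrite Rabs_pos_eq in HN by (apply pow_le; lra).
    rewrite pow_inv in HN.
    apply Rmult_lt_compat_l with (r := (L + 1)%R) in HN; [|lra].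
    replace ((L + 1) * (e / (L + 1)))%R with e in HN by (field; lra).
    assert (0 < / 2 ^ N)%R by (apply Rinv_0_lt_compat, pow2pos).
    unfold Rdiv. nra. }
  destruct (C_complete (fun k => fst (sq k))) as [z0 Hz0].
  { intros e He'. destruct (small (e / 2)%R) as [N HN]; [lra|].
    exists N. intros m Hm. specialize (Hgeo' N m Hm).
    replace (2 * L / 2 ^ N)%R with (2 * (L / 2 ^ N))%R in Hgeo' by (unfold Rdiv; ring). lra. }
  assert (Hz0' : forall k, (Cmod (fst (sq k) - z0) <= 2 * (L / 2 ^ k))%R).
  { intros k. apply le_epsilon. intros e He'. destruct (Hz0 e He') as [N HN].
    specialize (HN (max N k) ltac:(lia)). specialize (Hgeo' k (max N k) ltac:(lia)).
    replace (fst (sq k) - z0) with (- (fst (sq (max N k)) - fst (sq k)) + (fst (sq (max N k)) - z0)) by ring.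
    eapply Rle_trans; [apply Cmod_triangle|]. rewrite Cmod_opp.
    replace (2 * L / 2 ^ k)%R with (2 * (L / 2 ^ k))%R in Hgeo' by (unfold Rdiv; ring). lra. }
  assert (Kz0 : K z0).
  { apply HKc. intros e He'. destruct (small (e / 2)%R) as [N HN]; [lra|].
    exists (fst (sq N)). split.
    - specialize (Hsq N). destruct (sq N) as [q [a b]]. apply Hsq.
    - specialize (Hz0' N). lra. }
  destruct (Hf z0 Kz0) as [l Hl].
  (* Points within Lk of the k-th base vertex are within 3 Lk of z0, so the remainder there is at
     most (eps/6) 3 Lk; the perimeter bound 2 Lk turns this into eps Lk^2, a contradiction. *)
  destruct (proj1 (is_derive_C_eps _ _ _) Hl (eps / 6)%R) as [d [Hd' D]]; [lra|].
  destruct (small (d / 3)%R) as [k Hk]; [lra|].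
  specialize (Hz0' k). specialize (Hsq k).
  destruct (sq k) as [q [a b]]. destruct Hsq as [Kq [Ka [Kb [Hlen Ht]]]].
  simpl in Hz0'. set (Lk := (L / 2 ^ k)%R) in *.
  assert (HLk : (0 <= Lk)%R).
  { unfold Lk. apply Rdiv_le_0_compat; [assumption|apply pow2pos]. }
  set (g := fun z => f z0 + l * (z - z0)).
  assert (Cg : forall z, K z -> continuous g z).
  { intros z _. unfold g. apply continuous_Cplus; [apply continuous_const|].
    apply continuous_Cmult; [apply continuous_const|].
    apply continuous_Cminus; [apply continuous_id|apply continuous_const]. }
  assert (E : tri f q a b = tri (fun z => f z - g z) q a b).
  { rewrite (tri_minus K); try assumption. unfold g. rewrite tri_affine. ring. }
  rewrite E in Ht.
  apply (Rlt_irrefl (eps * Lk ^ 2)). eapply Rlt_le_trans; [apply Ht|].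
  eapply Rle_trans; [apply (tri_bound K _ _ _ _ (eps / 6 * (3 * Lk))%R)|]; try assumption.
  - intros z Hz. apply continuous_Cminus; auto.
  - nra.
  - intros z Hz Hzq.
    assert (Hzz : (Cmod (z - z0) <= 3 * Lk)%R).
    { replace (z - z0) with ((z - q) + (q - z0)) by ring.
      eapply Rle_trans; [apply Cmod_triangle|]. lra. }
    unfold g. replace (f z - (f z0 + l * (z - z0))) with (f z - f z0 - l * (z - z0)) by ring.
    eapply Rle_trans; [apply D; lra|]. apply Rmult_le_compat_l; lra.
  - rewrite Hlen. right. field. }
apply Cmod_eq_0. apply Rle_antisym; [|apply Cmod_ge_0].
apply le_epsilon. intros e He. rewrite Rplus_0_l.
(* The added 1 covers the degenerate case L = 0. *)
eapply Rle_trans; [apply (Main (e / (L ^ 2 + 1))%R)|].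
- apply Rdiv_lt_0_compat; nra.
- replace e with (e / (L ^ 2 + 1) * (L ^ 2 + 1))%R at 2 by (field; nra).
  apply Rmult_le_compat_l; [|lra]. apply Rdiv_le_0_compat; nra.
Qed.

(** * Cauchy's integral formula *)

Lemma inD_convex : cconvex inD.
Proof.
intros x v s Hx Hv Hs. unfold inD, lin in *.
replace (x + s * v) with (RtoC (1 - s) * x + RtoC s * (x + v)) by (rewrite RtoC_minus; ring).
eapply Rle_lt_trans; [apply Cmod_triangle|].
rewrite !Cmod_mult, !Cmod_R, !Rabs_pos_eq by lra.
destruct (Req_dec s 0) as [->|n]; [lra|]. nra.
Qed.

(* The auxiliary half-plane keeps the disc part convex while cutting off [z0]. *)
Definition cut_disc (r : R) (z0 u : C) (d : R) (z : C) : Prop :=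
  (Cmod z <= r)%R /\ (d <= Re ((z - z0) * Cconj u))%R.

Lemma cut_disc_convex (r : R) (z0 u : C) (d : R) : cconvex (cut_disc r z0 u d).
Proof.
intros x v s [Hx Hx'] [Hv Hv'] Hs. split.
- unfold lin.
  replace (x + s * v) with (RtoC (1 - s) * x + RtoC s * (x + v)) by (rewrite RtoC_minus; ring).
  eapply Rle_trans; [apply Cmod_triangle|].
  rewrite !Cmod_mult, !Cmod_R, !Rabs_pos_eq by lra. nra.
- unfold lin.
  replace ((x + s * v - z0) * Cconj u) with
    (RtoC (1 - s) * ((x - z0) * Cconj u) + RtoC s * ((x + v - z0) * Cconj u))
    by (rewrite RtoC_minus; ring).
  rewrite re_plus, !re_scal_l. nra.
Qed.

Lemma cut_disc_closed (r : R) (z0 u : C) (d : R) : cclosed (cut_disc r z0 u d).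
Proof.
intros x H. split.
- apply le_epsilon. intros e He. destruct (H e He) as [y [[Hy _] Hyx]].
  replace x with (y - (y - x)) by ring.
  eapply Rle_trans; [apply Cmod_triangle|]. rewrite Cmod_opp. lra.
- apply le_epsilon. intros e He.
  assert (Hu := Cmod_ge_0 u).
  destruct (H (e / (Cmod u + 1))%R) as [y [[_ Hy] Hyx]].
  { apply Rdiv_lt_0_compat; lra. }
  replace ((x - z0) * Cconj u) with ((y - z0) * Cconj u - (y - x) * Cconj u) by ring.
  unfold Cminus at 1. rewrite re_plus, re_opp.
  assert (K := re_le_Cmod ((y - x) * Cconj u)). rewrite Cmod_mult, Cmod_conj in K.
  assert (K2 : (Cmod (y - x) * Cmod u <= e)%R).
  { apply Rle_trans with (e / (Cmod u + 1) * (Cmod u + 1))%R.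
    - apply Rmult_le_compat; try apply Cmod_ge_0; lra.
    - right. field. lra. }
  assert (K3 := Rle_abs (Re ((y - x) * Cconj u))). lra.
Qed.

Lemma re_mult_conj (u : C) : Re (u * Cconj u) = (Cmod u ^ 2)%R.
Proof.
rewrite Cmod2_alt. destruct u as [a b]. simpl. ring.
Qed.

Section PointedGoursat.

Variables (g : C -> C) (z0 : C).
Hypothesis Hg0 : inD z0.
Hypothesis Hgc : forall z, inD z -> continuous g z.
Hypothesis Hgd : forall z, inD z -> z <> z0 -> exists l, cder g z l.

(** Cutting off a tip at z0, scaled by d, leaves a quadrilateral made of two triangles on which g is
    differentiable; the integral over the tip tends to 0 with d because g is bounded near z0. The
    condition on v - u gives Re (v conj u) >= |u|^2 / 2, so a single half-plane excludes z0 and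
    keeps the quadrilateral. *)
Lemma tri_pointed (u v : C) :
  inD (z0 + u) -> inD (z0 + v) -> u <> 0 -> (Cmod (v - u) <= Cmod u / 2)%R ->
  tri g z0 u v = 0.
Proof using All.
intros Hu Hv Hu0 Huv.
assert (Pu : (0 < Cmod u)%R) by now apply Cmod_gt_0.
assert (Pv := Cmod_ge_0 v).
assert (Pu2 : (0 < Cmod u ^ 2)%R) by (apply pow_lt; assumption).
apply Cmod_eq_0. apply Rle_antisym; [|apply Cmod_ge_0].
apply le_epsilon. intros e He. rewrite Rplus_0_l.
set (M := (Cmod (g z0) + 1)%R).
assert (HM : (0 < M)%R) by (unfold M; pose proof (Cmod_ge_0 (g z0)); lra).
destruct (proj1 (continuous_C_eps _ _) (Hgc z0 Hg0) 1%R) as [d0 [Hd0 Kd0]]; [lra|].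
set (s := (Cmod u + Cmod v)%R).
(* Three demands: the cut lies strictly inside the triangle, the tip lies where |g| <= M, and the
   integral over the tip is at most e. *)
set (d := Rmin (/ 2) (Rmin (d0 / (2 * s)) (e / (2 * s * M)))%R).
assert (Hd : (0 < d)%R).
{ unfold d. repeat apply Rmin_glb_lt; [lra| |]; apply Rdiv_lt_0_compat; unfold s; nra. }
assert (Hd1 : (d <= / 2)%R) by apply Rmin_l.
assert (Hd2 : (d * s < d0)%R).
{ apply Rle_lt_trans with (d0 / (2 * s) * s)%R.
  - apply Rmult_le_compat_r; [unfold s; lra|].
    eapply Rle_trans; [apply Rmin_r|]. apply Rmin_l.
  - replace (d0 / (2 * s) * s)%R with (d0 / 2)%R by (field; unfold s; lra). lra. }
assert (Hd3 : (2 * (d * s) * M <= e)%R).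
{ apply Rle_trans with (2 * (e / (2 * s * M) * s) * M)%R.
  - apply Rmult_le_compat_r; [lra|]. apply Rmult_le_compat_l; [lra|].
    apply Rmult_le_compat_r; [unfold s; lra|].
    eapply Rle_trans; [apply Rmin_r|]. apply Rmin_r.
  - right. field. unfold s; lra. }
set (rr := Rmax (Cmod (z0 + u)) (Rmax (Cmod (z0 + v)) (Cmod z0))).
assert (Hr : (rr < 1)%R) by (unfold rr; repeat apply Rmax_lub_lt; assumption).
assert (Rz0 : (Cmod z0 <= rr)%R) by (unfold rr; eapply Rle_trans; [|apply Rmax_r]; apply Rmax_r).
assert (Ru : (Cmod (z0 + u) <= rr)%R) by (unfold rr; apply Rmax_l).
assert (Rv : (Cmod (z0 + v) <= rr)%R) by (unfold rr; eapply Rle_trans; [|apply Rmax_r]; apply Rmax_l).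
set (K := cut_disc rr z0 u (d * (Cmod u ^ 2 / 2))%R).
assert (KD : forall z, K z -> inD z).
{ intros z [Hz _]. unfold inD. lra. }
assert (Kz0 : forall z, K z -> z <> z0).
{ intros z [_ Hz] ->. replace ((z0 - z0) * Cconj u) with (RtoC 0) in Hz by ring.
  rewrite re_RtoC in Hz. assert (0 < d * (Cmod u ^ 2 / 2))%R by (apply Rmult_lt_0_compat; lra). lra. }
assert (Kd : forall z, K z -> exists l, cder g z l) by (intros; apply Hgd; auto).
assert (Ruv : (Cmod u ^ 2 / 2 <= Re (v * Cconj u))%R).
{ replace (v * Cconj u) with (u * Cconj u + (v - u) * Cconj u) by ring.
  rewrite re_plus, re_mult_conj.
  assert (Q := re_le_Cmod ((v - u) * Cconj u)). rewrite Cmod_mult, Cmod_conj in Q.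
  apply Rabs_le_between in Q. nra. }
assert (Rd : forall w, (Cmod (z0 + w) <= rr)%R -> (Cmod (z0 + d * w) <= rr)%R).
{ intros w Hw. replace (z0 + d * w) with (RtoC (1 - d) * z0 + d * (z0 + w)) by (rewrite RtoC_minus; ring).
  eapply Rle_trans; [apply Cmod_triangle|].
  rewrite !Cmod_mult, !Cmod_R, !Rabs_pos_eq by lra. nra. }
assert (K1 : K (z0 + d * u)).
{ split; [now apply Rd|]. replace ((z0 + d * u - z0) * Cconj u) with (d * (u * Cconj u)) by ring.
  rewrite re_scal_l, re_mult_conj. nra. }
assert (K2 : K (z0 + u)).
{ split; [assumption|]. replace ((z0 + u - z0) * Cconj u) with (u * Cconj u) by ring.
  rewrite re_mult_conj. nra. }
assert (K3 : K (z0 + v)).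
{ split; [assumption|]. replace ((z0 + v - z0) * Cconj u) with (v * Cconj u) by ring. nra. }
assert (K4 : K (z0 + d * v)).
{ split; [now apply Rd|]. replace ((z0 + d * v - z0) * Cconj u) with (d * (v * Cconj u)) by ring.
  rewrite re_scal_l. nra. }
assert (T1 : tri g (z0 + d * u) (RtoC (1 - d) * u) (v - d * u) = 0).
{ apply (goursat_triangle K); [apply cut_disc_convex|apply cut_disc_closed|assumption|assumption| |].
  - replace (z0 + d * u + (1 - d)%R * u) with (z0 + u) by (rewrite RtoC_minus; ring). assumption.
  - replace (z0 + d * u + (v - d * u)) with (z0 + v) by ring. assumption. }
assert (T2 : tri g (z0 + d * u) (v - d * u) (d * v - d * u) = 0).
{ apply (goursat_triangle K); [apply cut_disc_convex|apply cut_disc_closed|assumption|assumption| |].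
  - replace (z0 + d * u + (v - d * u)) with (z0 + v) by ring. assumption.
  - replace (z0 + d * u + (d * v - d * u)) with (z0 + d * v) by ring. assumption. }
assert (E : tri g z0 u v = tri g z0 (d * u) (d * v)).
{ unfold tri in *.
  replace (z0 + d * u + (1 - d)%R * u) with (z0 + u) in T1 by (rewrite RtoC_minus; ring).
  replace (v - d * u - (1 - d)%R * u) with (v - u) in T1 by (rewrite RtoC_minus; ring).
  replace (z0 + d * u + (v - d * u)) with (z0 + v) in T2 by ring.
  replace (d * v - d * u - (v - d * u)) with (- (RtoC (1 - d) * v)) in T2 by (rewrite RtoC_minus; ring).
  assert (S : forall w, inD (z0 + w) -> forall s, (0 <= s <= 1)%R -> continuous g (lin z0 w s)).
  { intros w Hw s' Hs'. apply Hgc, inD_convex; assumption. }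
  rewrite (seg_split g z0 u d); [|lra|now apply S].
  rewrite (seg_split g z0 v d); [|lra|now apply S].
  assert (Rv' : seg g (z0 + v) (- (RtoC (1 - d) * v)) = - seg g (z0 + d * v) (RtoC (1 - d) * v)).
  { replace (z0 + v) with (z0 + d * v + RtoC (1 - d) * v) by (rewrite RtoC_minus; ring).
    apply seg_rev. intros s' Hs'. apply Hgc, inD_convex; [now apply KD| |assumption].
    replace (z0 + d * v + (1 - d)%R * v) with (z0 + v) by (rewrite RtoC_minus; ring). assumption. }
  rewrite Rv' in T2.
  set (A1 := seg g z0 (d * u)) in *. set (A2 := seg g (z0 + d * u) ((1 - d)%R * u)) in *.
  set (A3 := seg g (z0 + u) (v - u)) in *.
  set (A4 := seg g z0 (d * v)) in *. set (A5 := seg g (z0 + d * v) ((1 - d)%R * v)) in *.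
  set (A6 := seg g (z0 + d * u) (d * v - d * u)) in *.
  set (A7 := seg g (z0 + d * u) (v - d * u)) in *.
  replace A3 with (A7 - A2) by (rewrite <- (Cplus_0_l (A7 - A2)), <- T1; ring).
  replace A7 with (A5 + A6) by (rewrite <- (Cplus_0_r (A5 + A6)), <- T2; ring).
  ring. }
rewrite E.
assert (Ld : forall w, Cmod (d * w) = (d * Cmod w)%R).
{ intros w. rewrite Cmod_mult, Cmod_R, Rabs_pos_eq by lra. reflexivity. }
eapply Rle_trans; [apply (tri_bound inD _ _ _ _ M)|].
- apply inD_convex.
- assumption.
- lra.
- assumption.
- now apply KD.
- now apply KD.
- intros z Hz Hzz. rewrite !Ld in Hzz.
  assert (Q : (Cmod (g z - g z0) < 1)%R) by (apply Kd0; unfold s in Hd2; lra).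
  replace (g z) with (g z0 + (g z - g z0)) by ring.
  eapply Rle_trans; [apply Cmod_triangle|]. unfold M. lra.
- rewrite !Ld. replace (d * Cmod u + d * Cmod v)%R with (d * s)%R by (unfold s; ring). assumption.
Qed.

Lemma seg_approx (z : C) (eps : R) : inD z -> (0 < eps)%R ->
  exists d, (0 < d)%R /\ forall h, (Cmod h < d)%R ->
    inD (z + h) /\ (Cmod (seg g z h - g z * h) <= eps * Cmod h)%R.
Proof using Hgc.
intros Hz He.
destruct (proj1 (continuous_C_eps _ _) (Hgc z Hz) eps He) as [d [Hd Kd]].
unfold inD in Hz.
exists (Rmin d (1 - Cmod z)). split; [apply Rmin_glb_lt; lra|].
intros h Hh.
assert (Hh1 := Rlt_le_trans _ _ _ Hh (Rmin_l _ _)).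
assert (Hh2 := Rlt_le_trans _ _ _ Hh (Rmin_r _ _)).
assert (Hzh : inD (z + h)).
{ unfold inD. eapply Rle_lt_trans; [apply Cmod_triangle|]. lra. }
split; [assumption|].
assert (Ec : seg (fun _ => g z) z h = g z * h).
{ rewrite (seg_primitive (fun y => g z * y)); [ring|]. intros s Hs. split.
  - apply (cder_eq _ _ (g z * 1)); [|ring]. apply cder_scal, cder_id.
  - apply continuous_const. }
assert (Cs : forall s, (0 <= s <= 1)%R -> continuous g (lin z h s)).
{ intros s Hs. apply Hgc. now apply inD_convex. }
rewrite <- Ec, <- seg_minus; [|assumption|intros; apply continuous_const].
rewrite (Rmult_comm eps).
apply seg_bound.
- intros s Hs. apply continuous_Cminus; [auto|apply continuous_const].
- intros s Hs. left. apply Kd. unfold lin. replace (z + s * h - z) with (s * h) by ring.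
  rewrite Cmod_mult, Cmod_R, Rabs_pos_eq by lra. pose proof (Cmod_ge_0 h). nra.
Qed.

(** Away from z0, [tri_pointed] turns the increment into the segment integral from z to y as soon as
    y is within |z - z0| / 2 of z; at z0 the increment already is such an integral. Continuity of g
    then suffices, through [seg_approx]. *)
Lemma pointed_primitive (z : C) : inD z -> cder (fun z => seg g z0 (z - z0)) z (g z).
Proof using All.
intros Hz. apply is_derive_C_eps. intros eps He.
destruct (seg_approx z eps Hz He) as [d [Hd Kd]].
destruct (excluded_middle_informative (z = z0)) as [->|Hn].
- exists d. split; [assumption|]. intros y Hy.
  destruct (Kd (y - z0) Hy) as [_ Q].
  replace (seg g z0 (z0 - z0)) with (RtoC 0).
  + replace (seg g z0 (y - z0) - 0) with (seg g z0 (y - z0)) by ring. exact Q.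
  + unfold seg. ring.
- assert (Hu : z - z0 <> 0) by now apply Cminus_neq_0.
  assert (Pu := proj1 (Cmod_gt_0 _) Hu).
  exists (Rmin d (Cmod (z - z0) / 2)%R). split; [apply Rmin_glb_lt; lra|].
  intros y Hy.
  assert (Hy1 := Rlt_le_trans _ _ _ Hy (Rmin_l _ _)).
  assert (Hy2 := Rlt_le_trans _ _ _ Hy (Rmin_r _ _)).
  destruct (Kd (y - z) Hy1) as [Hin Q].
  replace (z + (y - z)) with y in Hin by ring.
  assert (T : tri g z0 (z - z0) (y - z0) = 0).
  { apply tri_pointed; try assumption.
    - now replace (z0 + (z - z0)) with z by ring.
    - now replace (z0 + (y - z0)) with y by ring.
    - replace (y - z0 - (z - z0)) with (y - z) by ring. lra. }
  unfold tri in T. replace (z0 + (z - z0)) with z in T by ring.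
  replace (y - z0 - (z - z0)) with (y - z) in T by ring.
  replace (seg g z0 (y - z0) - seg g z0 (z - z0)) with (seg g z (y - z)).
  + exact Q.
  + rewrite <- (Cplus_0_r (seg g z0 (y - z0) - _)), <- T. ring.
Qed.

End PointedGoursat.

(** * Integrals over circles *)

Lemma rder_polar (r : R) (s t : R) : rder (fun t => polar r (s * t)) t (RtoC s * Ci * polar r (s * t)).
Proof.
apply rder_pair; simpl; auto_derive; trivial; ring.
Qed.

Lemma Cmod_polar (r t : R) : (0 <= r)%R -> Cmod (polar r t) = r.
Proof.
intros Hr. unfold Cmod, polar; simpl.
replace (r * cos t * (r * cos t * 1) + r * sin t * (r * sin t * 1))%R
  with (r ^ 2 * ((sin t)² + (cos t)²))%R by (unfold Rsqr; ring).
rewrite sin2_cos2, Rmult_1_r. rewrite sqrt_pow2; trivial.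
Qed.

Lemma continuous_polar (r t : R) : continuous (fun t => polar r t) t.
Proof.
eapply (rder_continuous _ _ (RtoC 1 * Ci * polar r (1 * t))).
apply rder_pair; simpl; auto_derive; trivial; rewrite ?Rmult_1_l; ring.
Qed.

(** g has a primitive on the disc and the circle is a closed path. The orientation s = 1 serves
    [cauchy_formula], the reversed one the substitution in [circle_winding]. *)
Lemma circle_integral_0 (g : C -> C) (z0 : C) (r s : R) :
  inD z0 -> (forall z, inD z -> continuous g z) ->
  (forall z, inD z -> z <> z0 -> exists l, cder g z l) ->
  (0 <= r < 1)%R -> (s = 1 \/ s = -1)%R ->
  cint (fun t => g (polar r (s * t)) * (RtoC s * Ci * polar r (s * t))) 0 (2 * PI) = 0.
Proof.
intros H0 Hc Hd Hr Hs.
rewrite (cint_path (fun z => seg g z0 (z - z0)) g (fun t => polar r (s * t))).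
- replace (polar r (s * (2 * PI))) with (polar r (s * 0)); [ring|].
  unfold polar. rewrite Rmult_0_r, sin_0, cos_0.
  destruct Hs as [-> | ->].
  + rewrite Rmult_1_l, sin_2PI, cos_2PI. reflexivity.
  + replace (-1 * (2 * PI))%R with (- (2 * PI))%R by ring.
    rewrite sin_neg, cos_neg, sin_2PI, cos_2PI, Ropp_0. reflexivity.
- intros t _. assert (HD : inD (polar r (s * t))).
  { unfold inD. rewrite Cmod_polar; lra. }
  split; [now apply pointed_primitive|]. split; [apply rder_polar|]. split; [now apply Hc|].
  apply continuous_Cmult; [apply continuous_const|].
  eapply rder_continuous, rder_polar.
Qed.

Lemma polar_inv (r t : R) : (0 < r)%R -> polar (/ r) (- t) = / polar r t.
Proof.
intros Hr.
assert (Hn : polar r t <> RtoC 0).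
{ apply Cmod_gt_0. rewrite Cmod_polar; lra. }
assert (E : polar (/ r) (- t) * polar r t = RtoC 1).
{ unfold polar. rewrite cos_neg, sin_neg. apply injective_projections; simpl.
  - replace (/ r * cos t * (r * cos t) - / r * - sin t * (r * sin t))%R
      with ((sin t)² + (cos t)²)%R by (unfold Rsqr; field; lra). apply sin2_cos2.
  - field. lra. }
replace (polar (/ r) (- t)) with (polar (/ r) (- t) * polar r t / polar r t) by (field; assumption).
rewrite E. apply Cmult_1_l.
Qed.

Lemma polar_scal (a r t : R) : polar (a * r) t = RtoC a * polar r t.
Proof. apply injective_projections; simpl; ring. Qed.

Lemma polar_sub_neq_0 (r t : R) (z : C) : (Cmod z < r)%R -> polar r t - z <> RtoC 0.
Proof.
intros Hz. pose proof (Cmod_ge_0 z). assert (0 <= r)%R by lra. apply Cminus_neq_0. intros E.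
rewrite <- E, Cmod_polar in Hz; lra.
Qed.

(** As d zeta = i zeta dt, this says that the circle winds once around z. The integrand is 1 + z /
    (zeta - z), and the point is that the second term integrates to 0. *)
Lemma circle_winding (r : R) (z : C) : (Cmod z < r < 1)%R ->
  cint (fun t => polar r t / (polar r t - z)) 0 (2 * PI) = RtoC (2 * PI).
Proof.
intros [Hz Hr]. pose proof (Cmod_ge_0 z) as Pz.
assert (Cq : forall t, continuous (fun t => / (polar r t - z)) t).
{ intros t. apply continuous_Cinv; [now apply polar_sub_neq_0|].
  apply continuous_Cminus; [apply continuous_polar|apply continuous_const]. }
(* The substitution [s = rho r / zeta] moves the pole out of the disc. *)
assert (Z : cint (fun t => / (polar r t - z)) 0 (2 * PI) = 0).
{ set (rho := ((1 + Cmod z / r) / 2)%R).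
  assert (Hq : (0 <= Cmod z / r < 1)%R).
  { split; [apply Rdiv_le_0_compat; lra|]. apply Rlt_div_l; lra. }
  assert (Hrho : (Cmod z / r < rho < 1)%R) by (unfold rho; lra).
  set (a := z / RtoC (r * rho)).
  assert (Hn : RtoC (r * rho) <> 0).
  { intros E. apply RtoC_inj in E. nra. }
  assert (Ha : (Cmod a <= 1)%R).
  { unfold a. rewrite Cmod_div, Cmod_R, Rabs_pos_eq by (assumption || nra).
    apply Rle_div_l; [nra|]. rewrite Rmult_1_l.
    apply Rle_trans with (r * (Cmod z / r))%R; [right; field; lra|]. nra. }
  set (h := fun s : C => / (1 - a * s)).
  assert (H1 : forall s, inD s -> 1 - a * s <> 0).
  { intros s Hs. apply Cminus_neq_0. intros E.
    assert (Q : Cmod 1 = Cmod (a * s)) by now rewrite <- E.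
    rewrite Cmod_1, Cmod_mult in Q. unfold inD in Hs. pose proof (Cmod_ge_0 s).
    pose proof (Cmod_ge_0 a). nra. }
  assert (Hd : forall s, inD s -> exists l, cder h s l).
  { intros s Hs. eexists. unfold h. apply cder_inv; [now apply H1|].
    apply cder_plus; [apply cder_const|].
    apply is_derive_caratheodory. exists (fun _ => - a). split; [apply continuous_const|].
    split; [reflexivity|]. intros; ring. }
  assert (E := circle_integral_0 h 0 rho (-1)).
  assert (E' : cint (fun t => h (polar rho (-1 * t)) * (RtoC (-1) * Ci * polar rho (-1 * t))) 0 (2 * PI) = 0).
  { apply E; [unfold inD; rewrite Cmod_0; lra| | |lra|lra].
    - intros s Hs. destruct (Hd s Hs) as [l Hl]. eapply cder_continuous, Hl.
    - intros s Hs _. now apply Hd. }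
  rewrite (cint_ext _ (fun t => (RtoC (-1) * Ci * RtoC (r * rho)) * / (polar r t - z))) in E'.
  - rewrite cint_scal in E' by (intros; apply Cq).
    destruct (Ceq_dec (cint (fun t => / (polar r t - z)) 0 (2 * PI)) 0) as [K|K]; [exact K|].
    exfalso. revert E'. apply Cmult_neq_0; [|exact K].
    apply Cmult_neq_0; [|exact Hn]. intros E'. apply (f_equal snd) in E'. simpl in E'. lra.
  - intros t _. unfold h.
    replace (-1 * t)%R with (- t)%R by ring.
    replace rho with ((r * rho) * / r)%R at 1 2 by (field; lra).
    rewrite !polar_scal, polar_inv by lra.
    assert (Hp : polar r t <> RtoC 0) by (apply Cmod_gt_0; rewrite Cmod_polar; lra).
    assert (Hpz := polar_sub_neq_0 r t z Hz).
    replace (1 - a * (RtoC (r * rho) * / polar r t)) with ((polar r t - z) / polar r t)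
      by (unfold a; field; split; assumption).
    field. split; assumption. }
rewrite (cint_ext _ (fun t => 1 + z * / (polar r t - z))).
- rewrite cint_plus, cint_scal, Z.
  + unfold cint. rewrite (RInt_const (V := C_R_CompleteNormedModule)).
    rewrite scal_R_Cmult. rewrite Rminus_0_r. ring.
  + intros; apply Cq.
  + intros; apply continuous_const.
  + intros; apply continuous_Cmult; [apply continuous_const|apply Cq].
- intros t _. field. now apply polar_sub_neq_0.
Qed.

(** The slope function g of f at z is continuous at z and differentiable elsewhere, so its circle
    integral vanishes. Expanding g gives the left-hand integral minus f(z) times the integral of
    [circle_winding]. *)
Theorem cauchy_formula (f : C -> C) (r : R) (z : C) :
  analytic_D f -> (Cmod z < r < 1)%R ->
  cint (fun t => f (polar r t) * polar r t / (polar r t - z)) 0 (2 * PI) = RtoC (2 * PI) * f z.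
Proof.
intros Hf [Hz Hr]. pose proof (Cmod_ge_0 z) as Pz.
assert (Hin : inD z) by (unfold inD; lra).
assert (Cf : forall y, inD y -> continuous f y).
{ intros y Hy. destruct (Hf y Hy) as [m Hm]. eapply cder_continuous, Hm. }
destruct (Hf z Hin) as [l Hl].
apply is_derive_caratheodory in Hl as [g [G1 [G2 G3]]].
assert (Gq : forall y, y <> z -> g y = (f y - f z) * / (y - z)).
{ intros y Hy. rewrite (G3 y). field. now apply Cminus_neq_0. }
assert (Gd : forall y, inD y -> y <> z -> exists m, cder g y m).
{ intros y Hy Hn. destruct (Hf y Hy) as [m Hm].
  assert (Hn' : y - z <> 0) by now apply Cminus_neq_0.
  eexists. eapply (cder_ext_loc (fun y => (f y - f z) * / (y - z)) g y _ (Cmod (y - z))).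
  - now apply Cmod_gt_0.
  - intros x Hx. symmetry. apply Gq. intros ->.
    replace (z - y) with (- (y - z)) in Hx by ring. rewrite Cmod_opp in Hx. lra.
  - apply (cder_mult (fun y => f y - f z) (fun y => / (y - z))).
    + apply cder_plus; [exact Hm|apply cder_const].
    + apply (cder_inv (fun y => y - z)); [assumption|apply cder_minus_const]. }
assert (Gc : forall y, inD y -> continuous g y).
{ intros y Hy. destruct (Ceq_dec y z) as [->|Hn]; [assumption|].
  destruct (Gd y Hy Hn) as [m Hm]. eapply cder_continuous, Hm. }
assert (E := circle_integral_0 g z r 1 Hin Gc Gd ltac:(lra) ltac:(lra)).
assert (Cp : forall t, continuous (fun t => polar r t / (polar r t - z)) t).
{ intros t. apply continuous_Cdiv; [now apply polar_sub_neq_0|apply continuous_polar|].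
  apply continuous_Cminus; [apply continuous_polar|apply continuous_const]. }
assert (Cfp : forall t, continuous (fun t => f (polar r t)) t).
{ intros t. apply (continuous_comp (fun t => polar r t) f); [apply continuous_polar|].
  apply Cf. unfold inD. rewrite Cmod_polar; lra. }
rewrite (cint_ext _ (fun t => Ci * (f (polar r t) * (polar r t / (polar r t - z)) - f z * (polar r t / (polar r t - z))))) in E.
- rewrite cint_scal, cint_minus, cint_scal, circle_winding in E.
  + rewrite (cint_ext _ (fun t => f (polar r t) * (polar r t / (polar r t - z)))).
    * set (I := cint _ _ _) in *.
      assert (E2 : I - f z * RtoC (2 * PI) = 0).
      { replace (I - f z * RtoC (2 * PI)) with (- Ci * (Ci * (I - f z * RtoC (2 * PI)))).
        - rewrite E. ring.
        - apply injective_projections; simpl; ring. }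
      apply Cminus_eq_0 in E2. rewrite E2. ring.
    * intros t _. unfold Cdiv. ring.
  + lra.
  + intros; apply Cp.
  + intros; apply continuous_Cmult; [apply Cfp|apply Cp].
  + intros; apply continuous_Cmult; [apply continuous_const|apply Cp].
  + intros; apply continuous_Cminus; apply continuous_Cmult; try apply Cp; try apply Cfp. apply continuous_const.
- intros t _. rewrite Rmult_1_l, Gq.
  + field. now apply polar_sub_neq_0.
  + intros Ez. apply (polar_sub_neq_0 r t z Hz). rewrite Ez. ring.
Qed.

(** * Consequences of the integral formula *)

(** Differentiation under the integral sign from a remainder that is quadratic in h, uniformly in t;
    for Cauchy kernels the remainder is explicit. *)
Lemma cder_cint (k : C -> R -> C) (k' : R -> C) (z : C) (M d : R) :
  (0 < d)%R -> (0 <= M)%R ->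
  (forall h t, (Cmod h < d)%R -> continuous (k (z + h)) t) ->
  (forall t, continuous k' t) ->
  (forall h t, (Cmod h < d)%R -> (0 <= t <= 2 * PI)%R ->
     (Cmod (k (z + h)%C t - k z t - k' t * h) <= M * Cmod h ^ 2)%R) ->
  cder (fun y => cint (k y) 0 (2 * PI)) z (cint k' 0 (2 * PI)).
Proof.
intros Hd HM Hk Hk' Hb. pose proof PI_RGT_0.
apply is_derive_C_eps. intros eps He.
set (A := (2 * PI * M + 1)%R).
assert (HA : (0 < A)%R) by (unfold A; nra).
exists (Rmin d (eps / A)). split; [apply Rmin_glb_lt; [lra|now apply Rdiv_lt_0_compat]|].
intros y Hy.
assert (Hy1 := Rlt_le_trans _ _ _ Hy (Rmin_l _ _)).
assert (Hy2 := Rlt_le_trans _ _ _ Hy (Rmin_r _ _)).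
set (h := y - z) in *. assert (Ey : y = z + h) by (unfold h; ring).
assert (Hk0 : forall t, continuous (k z) t).
{ intros t. replace z with (z + 0) by ring. apply Hk. rewrite Cmod_0. assumption. }
assert (Hkh : forall t, continuous (k y) t) by (intros t; rewrite Ey; now apply Hk).
replace (cint (k y) 0 (2 * PI) - cint (k z) 0 (2 * PI) - cint k' 0 (2 * PI) * h)
  with (cint (fun t => k y t - k z t - h * k' t) 0 (2 * PI)).
- eapply Rle_trans; [apply (cint_bound _ _ _ (M * Cmod h ^ 2))|].
  + lra.
  + intros t _. apply continuous_Cminus; [apply continuous_Cminus; auto|].
    apply continuous_Cmult; [apply continuous_const|auto].
  + intros t Ht. rewrite (Cmult_comm h), Ey. now apply Hb.
  + pose proof (Cmod_ge_0 h).
    replace ((2 * PI - 0) * (M * Cmod h ^ 2))%R with (2 * PI * M * Cmod h * Cmod h)%R by ring.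
    apply Rmult_le_compat_r; [assumption|].
    apply Rle_trans with (A * (eps / A))%R; [|right; field; lra].
    apply Rmult_le_compat; [nra|assumption|unfold A; lra|lra].
- rewrite cint_minus, cint_minus, cint_scal; auto.
  + ring.
  + intros; apply continuous_Cminus; auto.
  + intros; apply continuous_Cmult; [apply continuous_const|auto].
Qed.

Lemma circle_bounded (g : R -> C) : (forall t, continuous g t) ->
  exists B, (0 < B)%R /\ forall t, (0 <= t <= 2 * PI)%R -> (Cmod (g t) <= B)%R.
Proof.
intros Hg.
destruct (continuity_ab_maj (fun t => Cmod (g t)) 0 (2 * PI)) as [t0 [H0 _]].
- pose proof PI_RGT_0; lra.
- intros t _. apply continuity_pt_filterlim. apply continuous_Cmod, Hg.
- exists (Cmod (g t0) + 1)%R. split; [pose proof (Cmod_ge_0 (g t0)); lra|].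
  intros t Ht. specialize (H0 t Ht). lra.
Qed.

Lemma polar_sub_Cmod (r t : R) (z : C) : (0 <= r)%R -> (r - Cmod z <= Cmod (polar r t - z))%R.
Proof.
intros Hr. rewrite <- (Cmod_polar r t Hr) at 1.
replace (polar r t) with (polar r t - z + z) at 1 by ring.
pose proof (Cmod_triangle (polar r t - z) z). lra.
Qed.

Lemma continuous_cauchy_kernel (g : R -> C) (r : R) (z : C) (k : nat) (t : R) :
  (forall t, continuous g t) -> (Cmod z < r)%R ->
  continuous (fun t => g t / (polar r t - z) ^ k) t.
Proof.
intros Hg Hz. apply continuous_Cdiv; [|apply Hg|].
- apply Cpow_nz. now apply polar_sub_neq_0.
- apply continuous_Cpow, continuous_Cminus; [apply continuous_polar|apply continuous_const].
Qed.

(** Cauchy-type integrals with any continuous density. Differentiating orders 1 and 2 is enough: f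
    has order 1 and f' order 2, so f' is again differentiable, and the higher derivatives follow by
    iteration. *)
Definition cauchy_transform (g : R -> C) (r : R) (k : nat) (z : C) : C :=
  cint (fun t => g t / (polar r t - z) ^ k) 0 (2 * PI).

Lemma half_gap (r : R) (z h : C) (t : R) :
  (Cmod z < r)%R -> (Cmod h < (r - Cmod z) / 2)%R ->
  (Cmod (z + h) < r)%R /\ (r - Cmod z <= Cmod (polar r t - z))%R /\
  ((r - Cmod z) / 2 <= Cmod (polar r t - z - h))%R.
Proof.
intros Hz Hh. pose proof (Cmod_ge_0 z).
assert (A : (r - Cmod z <= Cmod (polar r t - z))%R) by (apply polar_sub_Cmod; lra).
split; [|split].
- eapply Rle_lt_trans; [apply Cmod_triangle|]. lra.
- exact A.
- replace (polar r t - z) with (polar r t - z - h + h) in A by ring.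
  pose proof (Cmod_triangle (polar r t - z - h) h). lra.
Qed.

Lemma cauchy_transform_der1 (g : R -> C) (r : R) (z : C) :
  (forall t, continuous g t) -> (Cmod z < r)%R ->
  cder (cauchy_transform g r 1) z (cauchy_transform g r 2 z).
Proof.
intros Hg Hz. pose proof (Cmod_ge_0 z).
destruct (circle_bounded g Hg) as [B [HB KB]].
set (m := (r - Cmod z)%R). assert (Hm : (0 < m)%R) by (unfold m; lra).
(* With u = zeta - z, the exact remainder of 1/(u - h) is h^2 / (u^2 (u - h)), where |u| >= m and |u
   - h| >= m/2. *)
apply (cder_cint (fun y t => g t / (polar r t - y) ^ 1) _ z (B * (/ m ^ 2 * / (m / 2))) (m / 2)).
- lra.
- apply Rmult_le_pos; [lra|]. left. apply Rmult_lt_0_compat; apply Rinv_0_lt_compat; [apply pow_lt|]; lra.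
- intros h t Hh. apply continuous_cauchy_kernel; [assumption|]. now apply (half_gap r z h t).
- intros t. now apply continuous_cauchy_kernel.
- intros h t Hh Ht. destruct (half_gap r z h t Hz Hh) as [_ [A1 A2]]. fold m in A1, A2.
  set (u := polar r t - z) in *.
  replace (polar r t - (z + h)) with (u - h) by (unfold u; ring).
  assert (U : u <> 0) by (apply Cmod_gt_0; lra).
  assert (V : u - h <> 0) by (apply Cmod_gt_0; lra).
  replace (g t / (u - h) ^ 1 - g t / u ^ 1 - g t / u ^ 2 * h)
    with (g t * (/ u ^ 2 * / (u - h)) * h ^ 2) by (simpl; field; split; assumption).
  rewrite !Cmod_mult, Cmod_pow.
  apply Rmult_le_compat_r; [apply pow2_ge_0|].
  apply Rmult_le_compat; [apply Cmod_ge_0| |now apply KB|].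
  + apply Rmult_le_pos; apply Cmod_ge_0.
  + rewrite !Cmod_inv, Cmod_pow by (try apply Cpow_nz; assumption).
    apply Rmult_le_compat.
    * left. apply Rinv_0_lt_compat, pow_lt. lra.
    * left. apply Rinv_0_lt_compat. lra.
    * apply Rinv_le_contravar; [apply pow_lt; lra|]. apply pow_incr. lra.
    * apply Rinv_le_contravar; lra.
Qed.

Lemma cauchy_transform_der2 (g : R -> C) (r : R) (z : C) :
  (forall t, continuous g t) -> (Cmod z < r)%R ->
  cder (cauchy_transform g r 2) z (2 * cauchy_transform g r 3 z).
Proof.
intros Hg Hz. pose proof (Cmod_ge_0 z).
destruct (circle_bounded g Hg) as [B [HB KB]].
set (m := (r - Cmod z)%R). assert (Hm : (0 < m)%R) by (unfold m; lra).
unfold cauchy_transform. rewrite <- cint_scal by (intros; now apply continuous_cauchy_kernel).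
(* Here the exact remainder is h^2 (3/u^2 - 2h/u^3) / (u - h)^2, and |h| < m/2. *)
apply (cder_cint (fun y t => g t / (polar r t - y) ^ 2) _ z
  (B * ((3 * / m ^ 2 + 2 * (m / 2) * / m ^ 3) * / (m / 2) ^ 2)) (m / 2)).
- lra.
- assert (forall k, 0 < / m ^ k)%R by (intros; apply Rinv_0_lt_compat, pow_lt; lra).
  pose proof (H0 2%nat). pose proof (H0 3%nat).
  apply Rmult_le_pos; [lra|]. apply Rmult_le_pos; [nra|].
  left; apply Rinv_0_lt_compat, pow_lt. lra.
- intros h t Hh. apply continuous_cauchy_kernel; [assumption|]. now apply (half_gap r z h t).
- intros t. apply continuous_Cmult; [apply continuous_const|now apply continuous_cauchy_kernel].
- intros h t Hh Ht. destruct (half_gap r z h t Hz Hh) as [_ [A1 A2]]. fold m in A1, A2.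
  set (u := polar r t - z) in *.
  replace (polar r t - (z + h)) with (u - h) by (unfold u; ring).
  assert (U : u <> 0) by (apply Cmod_gt_0; lra).
  assert (V : u - h <> 0) by (apply Cmod_gt_0; lra).
  replace (g t / (u - h) ^ 2 - g t / u ^ 2 - 2 * (g t / u ^ 3) * h)
    with (g t * ((3 * / u ^ 2 - 2 * h * / u ^ 3) * / (u - h) ^ 2) * h ^ 2)
    by (simpl; field; split; assumption).
  rewrite !Cmod_mult, Cmod_pow.
  apply Rmult_le_compat_r; [apply pow2_ge_0|].
  apply Rmult_le_compat; [apply Cmod_ge_0| |now apply KB|].
  + apply Rmult_le_pos; apply Cmod_ge_0.
  + apply Rmult_le_compat; try apply Cmod_ge_0.
    * eapply Rle_trans; [apply Cmod_triangle|]. rewrite Cmod_opp, !Cmod_mult, !Cmod_R, !Rabs_pos_eq by lra.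
      rewrite !Cmod_inv, !Cmod_pow by (try apply Cpow_nz; assumption).
      apply Rplus_le_compat.
      -- apply Rmult_le_compat_l; [lra|]. apply Rinv_le_contravar; [apply pow_lt; lra|]. apply pow_incr. lra.
      -- pose proof (Cmod_ge_0 h). apply Rmult_le_compat; [lra| |lra|].
         ++ left. apply Rinv_0_lt_compat, pow_lt. lra.
         ++ apply Rinv_le_contravar; [apply pow_lt; lra|]. apply pow_incr. lra.
    * rewrite Cmod_inv, Cmod_pow by (apply Cpow_nz; assumption).
      apply Rinv_le_contravar; [apply pow_lt; lra|]. apply pow_incr. lra.
Qed.

Lemma analytic_continuous (f : C -> C) (z : C) : analytic_D f -> inD z -> continuous f z.
Proof. intros Hf Hz. destruct (Hf z Hz) as [l Hl]. eapply cder_continuous, Hl. Qed.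

Lemma continuous_on_circle (f : C -> C) (r t : R) :
  analytic_D f -> (0 <= r < 1)%R -> continuous (fun t => f (polar r t)) t.
Proof.
intros Hf Hr. apply (continuous_comp (fun t => polar r t) f); [apply continuous_polar|].
apply analytic_continuous; [assumption|]. unfold inD. rewrite Cmod_polar; lra.
Qed.

Lemma RtoC_2PI_neq_0 : RtoC (2 * PI) <> 0.
Proof. intros E. apply RtoC_inj in E. pose proof PI_RGT_0. lra. Qed.

Lemma cauchy_transform_eq (f : C -> C) (r : R) (z : C) :
  analytic_D f -> (Cmod z < r < 1)%R ->
  f z = / RtoC (2 * PI) * cauchy_transform (fun t => f (polar r t) * polar r t) r 1 z.
Proof.
intros Hf Hz. unfold cauchy_transform.
rewrite (cint_ext _ (fun t => f (polar r t) * polar r t / (polar r t - z))).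
- rewrite cauchy_formula by assumption. field. apply RtoC_2PI_neq_0.
- intros t _. simpl. now rewrite Cmult_1_r.
Qed.

Lemma near_in_disc (r : R) (z y : C) : (Cmod (y - z) < r - Cmod z)%R -> (Cmod y < r)%R.
Proof.
intros H. replace y with (z + (y - z)) by ring.
eapply Rle_lt_trans; [apply Cmod_triangle|]. lra.
Qed.

Lemma cderiv_cauchy (f : C -> C) (r : R) (z : C) :
  analytic_D f -> (Cmod z < r < 1)%R ->
  cder f z (/ RtoC (2 * PI) * cauchy_transform (fun t => f (polar r t) * polar r t) r 2 z).
Proof.
intros Hf Hz. pose proof (Cmod_ge_0 z).
apply (cder_ext_loc (fun y => / RtoC (2 * PI) * cauchy_transform (fun t => f (polar r t) * polar r t) r 1 y)
   f z _ (r - Cmod z)%R).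
- lra.
- intros y Hy. symmetry. apply cauchy_transform_eq; [assumption|].
  apply near_in_disc in Hy. lra.
- apply cder_scal. apply cauchy_transform_der1; [|lra].
  intros t. apply continuous_Cmult; [apply continuous_on_circle; [assumption|lra]|apply continuous_polar].
Qed.

Theorem analytic_cderiv (f : C -> C) : analytic_D f -> analytic_D (cderiv f).
Proof.
intros Hf z Hz. unfold inD in Hz. pose proof (Cmod_ge_0 z).
set (r := ((1 + Cmod z) / 2)%R). assert (Hr : (Cmod z < r < 1)%R) by (unfold r; lra).
eexists.
apply (cder_ext_loc (fun y => / RtoC (2 * PI) * cauchy_transform (fun t => f (polar r t) * polar r t) r 2 y)
   _ z _ (r - Cmod z)%R).
- lra.
- intros y Hy. symmetry. apply cderiv_eq, cderiv_cauchy; [assumption|].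
  apply near_in_disc in Hy. lra.
- apply cder_scal. apply cauchy_transform_der2; [|lra].
  intros t. apply continuous_Cmult; [apply continuous_on_circle; [assumption|lra]|apply continuous_polar].
Qed.

Lemma analytic_cderiv_n (n : nat) (f : C -> C) : analytic_D f -> analytic_D (cderiv_n n f).
Proof. intros Hf. induction n; simpl; [assumption|]. now apply analytic_cderiv. Qed.

Lemma analytic_const (c : C) : analytic_D (fun _ => c).
Proof. intros z _. exists (RtoC 0). apply cder_const. Qed.

Lemma analytic_id : analytic_D (fun z => z).
Proof. intros z _. exists (RtoC 1). apply cder_id. Qed.

Lemma analytic_plus (f g : C -> C) : analytic_D f -> analytic_D g -> analytic_D (fun z => f z + g z).
Proof.
intros Hf Hg z Hz. destruct (Hf z Hz) as [l Hl]. destruct (Hg z Hz) as [m Hm].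
eexists. apply cder_plus; eassumption.
Qed.

Lemma analytic_mult (f g : C -> C) : analytic_D f -> analytic_D g -> analytic_D (fun z => f z * g z).
Proof.
intros Hf Hg z Hz. destruct (Hf z Hz) as [l Hl]. destruct (Hg z Hz) as [m Hm].
eexists. apply cder_mult; eassumption.
Qed.

Lemma analytic_pow (f : C -> C) (k : nat) : analytic_D f -> analytic_D (fun z => f z ^ k).
Proof.
intros Hf. induction k; simpl; [apply analytic_const|]. now apply analytic_mult.
Qed.

Lemma analytic_comp (f phi : C -> C) : analytic_D f -> selfmap_D phi -> analytic_D (fun z => f (phi z)).
Proof.
intros Hf [Hp Hs] z Hz. destruct (Hp z Hz) as [m Hm]. destruct (Hf (phi z) (Hs z Hz)) as [l Hl].
eexists. apply cder_comp; eassumption.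
Qed.

(** The difference quotient has a removable singularity at w: near w it is itself a Cauchy integral,
    with density G / (zeta - w), because 1/(zeta - y) - 1/(zeta - w) = (y - w) / ((zeta - w)(zeta -
    y)). *)
Theorem analytic_factor (f : C -> C) (w : C) : analytic_D f -> inD w ->
  exists h : C -> C, analytic_D h /\ (forall z : C, f z = f w + (z - w) * h z) /\ h w = cderiv f w.
Proof.
intros Hf Hw.
exists (fun z => if Ceq_dec z w then cderiv f w else (f z - f w) * / (z - w)).
split; [|split].
- intros z Hz. destruct (Ceq_dec z w) as [->|Hn].
  + unfold inD in Hw. pose proof (Cmod_ge_0 w).
    set (r := ((1 + Cmod w) / 2)%R). assert (Hr : (Cmod w < r < 1)%R) by (unfold r; lra).
    set (G := fun t => f (polar r t) * polar r t).
    assert (HG : forall t, continuous G t).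
    { intros t. apply continuous_Cmult; [apply continuous_on_circle; [assumption|lra]|apply continuous_polar]. }
    eexists.
    apply (cder_ext_loc (fun y => / RtoC (2 * PI) * cauchy_transform (fun t => G t / (polar r t - w) ^ 1) r 1 y)
       _ w _ (r - Cmod w)%R).
    * lra.
    * intros y Hy. apply near_in_disc in Hy.
      destruct (Ceq_dec y w) as [->|Hn].
      -- symmetry. rewrite (cderiv_eq _ _ _ (cderiv_cauchy f r w Hf Hr)). f_equal.
         apply cint_ext. intros t _. fold (G t). simpl. field. apply polar_sub_neq_0. lra.
      -- rewrite (cauchy_transform_eq f r y), (cauchy_transform_eq f r w) by (assumption || lra).
         fold G. unfold cauchy_transform.
         assert (Hyw : y - w <> 0) by now apply Cminus_neq_0.
         set (I1 := cint _ _ _). set (I3 := cint _ _ _) at 2. set (I2 := cint _ _ _).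
         replace (/ RtoC (2 * PI) * I2 - / RtoC (2 * PI) * I3) with (/ RtoC (2 * PI) * (I2 - I3)) by ring.
         rewrite <- Cmult_assoc. f_equal.
         assert (E : I2 - I3 = (y - w) * I1).
         { unfold I1, I2, I3. rewrite <- cint_minus, <- cint_scal.
           - apply cint_ext. intros t _. simpl. field.
             split; apply polar_sub_neq_0; lra.
           - intros t _. apply continuous_cauchy_kernel; [|lra]. intros; apply continuous_cauchy_kernel; [assumption|lra].
           - intros t _. apply continuous_cauchy_kernel; [assumption|lra].
           - intros t _. apply continuous_cauchy_kernel; [assumption|lra]. }
         rewrite E. field. assumption.
    * apply cder_scal, cauchy_transform_der1; [|lra].
      intros t. apply continuous_cauchy_kernel; [assumption|lra].
  + assert (Hn' : z - w <> 0) by now apply Cminus_neq_0.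
    destruct (Hf z Hz) as [l Hl].
    eexists. apply (cder_ext_loc (fun y => (f y - f w) * / (y - w)) _ z _ (Cmod (z - w))).
    * now apply Cmod_gt_0.
    * intros y Hy. destruct (Ceq_dec y w) as [->|_]; [|reflexivity].
      replace (w - z) with (- (z - w)) in Hy by ring. rewrite Cmod_opp in Hy. lra.
    * apply (cder_mult (fun y => f y - f w) (fun y => / (y - w))).
      -- apply cder_plus; [exact Hl|apply cder_const].
      -- apply (cder_inv (fun y => y - w)); [assumption|apply cder_minus_const].
- intros z. destruct (Ceq_dec z w) as [->|Hn]; [ring|].
  field. now apply Cminus_neq_0.
- destruct (Ceq_dec w w) as [_|n]; [reflexivity|now elim n].
Qed.

(** Cruder than the maximum principle, but the factor 1/(r - |z|) is the same for all h, so the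
    geometric decay in [identity_theorem] absorbs it. *)
Lemma cauchy_estimate (h : C -> C) (z : C) (r M : R) :
  analytic_D h -> (Cmod z < r < 1)%R -> (0 <= M)%R ->
  (forall t, (0 <= t <= 2 * PI)%R -> (Cmod (h (polar r t)) <= M)%R) ->
  (Cmod (h z) <= M / (r - Cmod z))%R.
Proof.
intros Hh Hr HM Hb. pose proof (Cmod_ge_0 z). pose proof PI_RGT_0.
assert (E := cauchy_formula h r z Hh Hr).
apply (f_equal Cmod) in E. rewrite Cmod_mult, Cmod_R, (Rabs_pos_eq (2 * PI)) in E by lra.
assert (Q : (2 * PI * Cmod (h z) <= (2 * PI - 0) * (M / (r - Cmod z)))%R).
{ rewrite <- E. apply cint_bound; [lra| |].
  - intros t _. apply continuous_Cdiv; [apply polar_sub_neq_0; lra| |].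
    + apply continuous_Cmult; [apply continuous_on_circle; [assumption|lra]|apply continuous_polar].
    + apply continuous_Cminus; [apply continuous_polar|apply continuous_const].
  - intros t Ht. rewrite Cmod_div, Cmod_mult by (apply polar_sub_neq_0; lra).
    rewrite Cmod_polar by lra.
    apply Rmult_le_compat.
    + apply Rmult_le_pos; [apply Cmod_ge_0|lra].
    + left. apply Rinv_0_lt_compat. apply Cmod_gt_0, polar_sub_neq_0; lra.
    + apply Rle_trans with (M * 1)%R; [|lra]. apply Rmult_le_compat; try lra; try apply Cmod_ge_0.
      now apply Hb.
    + apply Rinv_le_contravar; [lra|]. apply polar_sub_Cmod; lra. }
nra.
Qed.

(** It shows that the Blaschke factor (y - w)/(1 - conj w y) has modulus below 1 in the disc,
    tending to 1 at the boundary. *)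
Lemma blaschke_identity (w y : C) :
  (Cmod (1 - Cconj w * y) ^ 2 = Cmod (y - w) ^ 2 + (1 - Cmod y ^ 2) * (1 - Cmod w ^ 2))%R.
Proof. rewrite !Cmod2_alt. destruct w as [a b], y as [c d]. simpl. ring. Qed.

(** * Order of vanishing at a point *)

(* [lead w j f c]: [f] vanishes to order at least [j] at [w], and [c] is the
   coefficient of [(z - w)^j] in its Taylor expansion at [w]. *)
Definition lead (w : C) (j : nat) (f : C -> C) (c : C) : Prop :=
  exists h : C -> C, analytic_D h /\ (forall z : C, inD z -> f z = (z - w) ^ j * h z) /\ h w = c.

(** [rho] separates the modulus of the Blaschke factor at z from its values on a circle close to the
    boundary, where that modulus is near 1. *)
Lemma blaschke_gap (w z : C) : inD w -> inD z ->
  exists r rho, (Cmod z < r < 1)%R /\ (0 < rho)%R /\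
    (Cmod (z - w) < rho * Cmod (1 - Cconj w * z))%R /\
    forall y, Cmod y = r -> (rho * Cmod (1 - Cconj w * y) <= Cmod (y - w))%R.
Proof.
unfold inD. intros Hw Hz. pose proof (Cmod_ge_0 w). pose proof (Cmod_ge_0 z).
assert (Q : forall y, (Cmod y < 1)%R -> (1 - Cmod w <= Cmod (1 - Cconj w * y))%R).
{ intros y Hy. pose proof (Cmod_triangle (1 - Cconj w * y) (Cconj w * y)) as T.
  replace (1 - Cconj w * y + Cconj w * y) with (RtoC 1) in T by ring.
  rewrite Cmod_1, Cmod_mult, Cmod_conj in T. pose proof (Cmod_ge_0 y). nra. }
assert (Qz := Q z Hz). assert (Bz := blaschke_identity w z).
set (Dz := Cmod (1 - Cconj w * z)) in *. set (Nz := Cmod (z - w)) in *.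
assert (Pn : (0 <= Nz)%R) by apply Cmod_ge_0.
assert (HND : (Nz < Dz)%R).
{ apply Rnot_le_lt. intros F. assert (Dz ^ 2 <= Nz ^ 2)%R by (apply pow_incr; lra).
  assert (0 < (1 - Cmod z ^ 2) * (1 - Cmod w ^ 2))%R by (apply Rmult_lt_0_compat; nra). lra. }
set (b := (Nz / Dz)%R).
assert (Hb : (0 <= b < 1)%R).
{ unfold b. split; [apply Rdiv_le_0_compat; lra|]. apply Rlt_div_l; lra. }
set (rho := ((1 + b) / 2)%R). assert (Hrho : (b < rho < 1)%R) by (unfold rho; lra).
assert (P1 : (0 < (1 - Cmod w) ^ 2)%R) by (apply pow_lt; lra).
assert (P2 : (0 < 1 - rho ^ 2)%R) by (unfold rho in *; nra).
assert (P3 : (0 < 1 - Cmod w ^ 2 <= 1)%R) by nra.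
(* If the factor at a point of the circle were below rho, [blaschke_identity] would give (1 -
   rho^2)(1 - |w|)^2 <= (1 - r^2)(1 - |w|^2). With 1 - r <= e the right side is below 2e, which is
   the left side. *)
set (e := (((1 - rho ^ 2) * (1 - Cmod w) ^ 2) / 2)%R).
assert (He : (0 < e)%R) by (unfold e; apply Rdiv_lt_0_compat; nra).
set (r := Rmax ((1 + Cmod z) / 2) (1 - e)).
assert (Hr1 : (Cmod z < r)%R).
{ unfold r. eapply Rlt_le_trans; [|apply Rmax_l]. lra. }
assert (Hr2 : (1 - e <= r)%R) by apply Rmax_r.
assert (Hr3 : (r < 1)%R) by (unfold r; apply Rmax_lub_lt; lra).
exists r, rho. split; [lra|]. split; [lra|]. split.
- replace Nz with (b * Dz)%R by (unfold b; field; lra). apply Rmult_lt_compat_r; lra.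
- intros y Hy. assert (Qy := Q y ltac:(lra)). assert (By := blaschke_identity w y).
  rewrite Hy in By. set (Dy := Cmod (1 - Cconj w * y)) in *. set (Ny := Cmod (y - w)) in *.
  assert (0 <= Ny)%R by apply Cmod_ge_0.
  apply Rnot_lt_le. intros F.
  assert (F2 : (Ny ^ 2 <= (rho * Dy) ^ 2)%R) by (apply pow_incr; lra).
  assert (D2 : ((1 - Cmod w) ^ 2 <= Dy ^ 2)%R) by (apply pow_incr; lra).
  assert (F3 : ((1 - rho ^ 2) * Dy ^ 2 <= (1 - r ^ 2) * (1 - Cmod w ^ 2))%R).
  { rewrite Rpow_mult_distr in F2. lra. }
  assert (F4 : ((1 - r ^ 2) * (1 - Cmod w ^ 2) < 2 * e)%R).
  { assert (0 <= r)%R by lra.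
    apply Rle_lt_trans with (1 - r ^ 2)%R.
    - assert (0 <= 1 - r ^ 2)%R by nra. nra.
    - replace (1 - r ^ 2)%R with ((1 - r) * (1 + r))%R by ring. nra. }
  assert (F5 : (2 * e <= (1 - rho ^ 2) * Dy ^ 2)%R).
  { replace (2 * e)%R with ((1 - rho ^ 2) * (1 - Cmod w) ^ 2)%R by (unfold e; field).
    apply Rmult_le_compat_l; lra. }
  lra.
Qed.

(* Dividing by powers of the Blaschke factor of [w], rather than of [z - w],
   makes the Cauchy estimate effective on the whole disc. *)
Theorem identity_theorem (f : C -> C) (w : C) : inD w ->
  (forall j, exists c, lead w j f c) -> forall z, inD z -> f z = 0.
Proof.
intros Hw Hl z Hz.
destruct (blaschke_gap w z Hw Hz) as [r [rho [Hr [Hrho [Hbz Hby]]]]].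
pose proof (Cmod_ge_0 z). pose proof (Cmod_ge_0 (z - w)).
set (D := fun y => 1 - Cconj w * y). change (1 - Cconj w * z) with (D z) in Hbz.
assert (Dn : forall y, inD y -> D y <> 0).
{ intros y Hy. unfold D. apply Cminus_neq_0. intros E. apply (f_equal Cmod) in E.
  rewrite Cmod_1, Cmod_mult, Cmod_conj in E. unfold inD in *.
  pose proof (Cmod_ge_0 w). pose proof (Cmod_ge_0 y). nra. }
assert (PD := proj1 (Cmod_gt_0 _) (Dn z Hz)).
assert (Fa : analytic_D f).
{ destruct (Hl 0%nat) as [c [h [Hh [E _]]]]. intros y Hy. destruct (Hh y Hy) as [l Hl'].
  exists l. unfold inD in Hy. apply (cder_ext_loc h f y l (1 - Cmod y)); [lra| |exact Hl'].
  intros x Hx. rewrite E; [simpl; ring|]. unfold inD. replace x with (y + (x - y)) by ring.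
  eapply Rle_lt_trans; [apply Cmod_triangle|]. lra. }
destruct (circle_bounded (fun t => f (polar r t))) as [B [HB KB]].
{ intros t. apply continuous_on_circle; [assumption|lra]. }
set (q := (Cmod (z - w) / (rho * Cmod (D z)))%R).
assert (Hq : (0 <= q < 1)%R).
{ unfold q. split; [apply Rdiv_le_0_compat; nra|]. apply Rlt_div_l; nra. }
assert (Est : forall j, (Cmod (f z) <= B / (r - Cmod z) * q ^ j)%R).
{ intros j. destruct (Hl j) as [c [h [Hh [E _]]]].
  (* k is f divided by the j-th power of the Blaschke factor. On |y| = r it is at most B / rho^j, so
     at z the j-th power of the factor leaves a multiple of q^j with q < 1. *)
  set (k := fun y => D y ^ j * h y).
  assert (Hk : analytic_D k).
  { apply analytic_mult; [|assumption]. apply analytic_pow. unfold D.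
    apply (analytic_plus (fun _ => RtoC 1) (fun y => - (Cconj w * y))); [apply analytic_const|].
    intros y _. exists (- Cconj w). apply is_derive_caratheodory. exists (fun _ => - Cconj w).
    split; [apply continuous_const|]. split; [reflexivity|]. intros; ring. }
  assert (Kb : (Cmod (k z) <= (B / rho ^ j) / (r - Cmod z))%R).
  { apply cauchy_estimate; [assumption|assumption| |].
    - apply Rdiv_le_0_compat; [lra|now apply pow_lt].
    - intros t Ht. set (y := polar r t).
      assert (Hy : Cmod y = r) by (apply Cmod_polar; lra).
      assert (Iy : inD y) by (unfold inD; lra).
      apply Rle_div_r; [now apply pow_lt|].
      unfold k. rewrite Cmod_mult, Cmod_pow.
      apply Rle_trans with (Cmod (f y)); [|now apply KB].
      rewrite (E y Iy), Cmod_mult, Cmod_pow.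
      replace (Cmod (D y) ^ j * Cmod (h y) * rho ^ j)%R with ((rho * Cmod (D y)) ^ j * Cmod (h y))%R
        by (rewrite Rpow_mult_distr; ring).
      apply Rmult_le_compat_r; [apply Cmod_ge_0|].
      apply pow_incr. split; [apply Rmult_le_pos; [lra|apply Cmod_ge_0]|]. now apply Hby. }
  rewrite (E z Hz), Cmod_mult, Cmod_pow.
  unfold k in Kb. rewrite Cmod_mult, Cmod_pow in Kb.
  replace (Cmod (z - w) ^ j)%R with (q ^ j * (rho ^ j * Cmod (D z) ^ j))%R.
  - assert (Pr := pow_lt rho j Hrho). assert (Pq := pow_le q j (proj1 Hq)).
    replace (q ^ j * (rho ^ j * Cmod (D z) ^ j) * Cmod (h z))%R with
      ((rho ^ j * q ^ j) * (Cmod (D z) ^ j * Cmod (h z)))%R by ring.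
    replace (B / (r - Cmod z) * q ^ j)%R with ((rho ^ j * q ^ j) * (B / rho ^ j / (r - Cmod z)))%R
      by (field; lra).
    apply Rmult_le_compat_l; [|assumption]. apply Rmult_le_pos; lra.
  - rewrite <- Rpow_mult_distr, <- Rpow_mult_distr. f_equal. unfold q. field. lra. }
apply Cmod_eq_0. apply Rle_antisym; [|apply Cmod_ge_0].
apply le_epsilon. intros e He. rewrite Rplus_0_l.
assert (PB : (0 < B / (r - Cmod z))%R) by (apply Rdiv_lt_0_compat; lra).
destruct (pow_lt_1_zero q ltac:(rewrite Rabs_pos_eq; lra) (e / (B / (r - Cmod z)))%R) as [N HN].
{ now apply Rdiv_lt_0_compat. }
specialize (HN N (le_n N)). rewrite Rabs_pos_eq in HN by (apply pow_le; lra).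
eapply Rle_trans; [apply (Est N)|].
apply Rle_trans with (B / (r - Cmod z) * (e / (B / (r - Cmod z))))%R.
- apply Rmult_le_compat_l; lra.
- right. field. lra.
Qed.

Lemma lead_eqD (w : C) (j : nat) (f g : C -> C) (c : C) : eqD f g -> lead w j f c -> lead w j g c.
Proof.
intros E [h [H1 [H2 H3]]]. exists h. split; [assumption|]. split; [|assumption].
intros z Hz. rewrite <- E by assumption. auto.
Qed.

Lemma lead_0 (w : C) (f : C -> C) : analytic_D f -> lead w 0 f (f w).
Proof. intros H. exists f. split; [assumption|]. split; [intros; simpl; ring|reflexivity]. Qed.

(** A cofactor that vanishes at w yields one more factor z - w; the climb through all orders is an
    induction on this step. *)
Lemma lead_S (w : C) (j : nat) (f : C -> C) : inD w -> lead w j f 0 -> exists c, lead w (S j) f c.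
Proof.
intros Hw [h [H1 [H2 H3]]]. destruct (analytic_factor h w H1 Hw) as [k [K1 [K2 K3]]].
exists (k w), k. split; [assumption|]. split; [|reflexivity].
intros z Hz. rewrite H2, K2, H3 by assumption. simpl. ring.
Qed.

Lemma lead_weaken (w : C) (i j : nat) (f : C -> C) (c : C) :
  (i < j)%nat -> lead w j f c -> lead w i f 0.
Proof.
intros Hij [h [H1 [H2 H3]]].
exists (fun z => (z - w) ^ (j - i) * h z). split; [|split].
- apply analytic_mult; [|assumption]. apply analytic_pow.
  intros z _. exists (RtoC 1). apply cder_minus_const.
- intros z Hz. rewrite H2 by assumption. replace j with (i + (j - i))%nat at 1 by lia.
  rewrite Cpow_add_r. ring.
- replace (j - i)%nat with (S (j - i - 1)) by lia. simpl. ring.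
Qed.

(** The two cofactors agree off w, where (z - w)^j is nonzero, and both are continuous at w. *)
Lemma lead_unique (w : C) (j : nat) (f : C -> C) (a b : C) :
  inD w -> lead w j f a -> lead w j f b -> a = b.
Proof.
intros Hw [h [H1 [H2 H3]]] [k [K1 [K2 K3]]].
apply Cminus_eq_0, Cmod_eq_0. apply Rle_antisym; [|apply Cmod_ge_0].
apply le_epsilon. intros e He. rewrite Rplus_0_l.
assert (Hc := analytic_continuous _ _ H1 Hw). assert (Kc := analytic_continuous _ _ K1 Hw).
destruct (proj1 (continuous_C_eps _ _) Hc (e / 2)%R) as [d1 [D1 E1]]; [lra|].
destruct (proj1 (continuous_C_eps _ _) Kc (e / 2)%R) as [d2 [D2 E2]]; [lra|].
unfold inD in Hw.
set (d := Rmin (Rmin d1 d2) (1 - Cmod w)).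
assert (Hd : (0 < d)%R) by (unfold d; repeat apply Rmin_glb_lt; lra).
assert (Hd1 : (d <= d1)%R) by (unfold d; eapply Rle_trans; [apply Rmin_l|apply Rmin_l]).
assert (Hd2 : (d <= d2)%R) by (unfold d; eapply Rle_trans; [apply Rmin_l|apply Rmin_r]).
assert (Hd3 : (d <= 1 - Cmod w)%R) by apply Rmin_r.
set (y := w + RtoC (d / 2)).
assert (Ey : y - w = RtoC (d / 2)) by (unfold y; ring).
assert (Cy : Cmod (y - w) = (d / 2)%R) by (rewrite Ey, Cmod_R, Rabs_pos_eq; lra).
specialize (E1 y ltac:(lra)). specialize (E2 y ltac:(lra)).
assert (Iy : inD y).
{ unfold inD. replace y with (w + (y - w)) by ring. eapply Rle_lt_trans; [apply Cmod_triangle|]. lra. }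
assert (N : (y - w) ^ j <> 0).
{ apply Cpow_nz. rewrite Ey. intros F. apply RtoC_inj in F. lra. }
assert (Ehk : h y = k y).
{ apply Cminus_eq_0. destruct (Ceq_dec (h y - k y) 0) as [Z|Z]; [assumption|].
  exfalso. apply (Cmult_neq_0 _ _ N Z).
  replace ((y - w) ^ j * (h y - k y)) with ((y - w) ^ j * h y - (y - w) ^ j * k y) by ring.
  rewrite <- H2, <- K2 by assumption. ring. }
rewrite <- H3, <- K3.
replace (h w - k w) with ((k y - k w) - (h y - h w)) by (rewrite Ehk; ring).
eapply Rle_trans; [apply Cmod_triangle|]. rewrite Cmod_opp. lra.
Qed.

Lemma lead_plus (w : C) (j : nat) (f g : C -> C) (a b : C) :
  lead w j f a -> lead w j g b -> lead w j (fun z => f z + g z) (a + b).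
Proof.
intros [h [H1 [H2 H3]]] [k [K1 [K2 K3]]].
exists (fun z => h z + k z). split; [now apply analytic_plus|]. split.
- intros z Hz. rewrite H2, K2 by assumption. ring.
- now rewrite H3, K3.
Qed.

Lemma lead_scal (w : C) (j : nat) (f : C -> C) (a c : C) :
  lead w j f a -> lead w j (fun z => c * f z) (c * a).
Proof.
intros [h [H1 [H2 H3]]].
exists (fun z => c * h z). split; [apply (analytic_mult (fun _ => c)); [apply analytic_const|assumption]|]. split.
- intros z Hz. rewrite H2 by assumption. ring.
- now rewrite H3.
Qed.

Lemma lead_mult (w : C) (i j : nat) (f g : C -> C) (a b : C) :
  lead w i f a -> lead w j g b -> lead w (i + j) (fun z => f z * g z) (a * b).
Proof.
intros [h [H1 [H2 H3]]] [k [K1 [K2 K3]]].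
exists (fun z => h z * k z). split; [now apply analytic_mult|]. split.
- intros z Hz. rewrite H2, K2, Cpow_add_r by assumption. ring.
- now rewrite H3, K3.
Qed.

(** As w is fixed, phi(z) - w = (z - w) k(z) with k(w) = phi'(w), and k^j joins the cofactor. *)
Lemma lead_comp (w : C) (j : nat) (f phi : C -> C) (c : C) :
  inD w -> selfmap_D phi -> phi w = w -> lead w j f c ->
  lead w j (fun z => f (phi z)) (cderiv phi w ^ j * c).
Proof.
intros Hw Hp Hf [h [H1 [H2 H3]]].
destruct (analytic_factor phi w (proj1 Hp) Hw) as [k [K1 [K2 K3]]].
exists (fun z => k z ^ j * h (phi z)). split; [|split].
- apply analytic_mult; [now apply analytic_pow|now apply analytic_comp].
- intros z Hz. rewrite H2 by now apply Hp.
  replace (phi z - w) with ((z - w) * k z) by (rewrite (K2 z), Hf; ring).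
  rewrite Cpow_mult_l. ring.
- now rewrite K3, Hf, H3.
Qed.

Lemma lead_analytic (w : C) (j : nat) (f : C -> C) (c : C) : lead w j f c -> analytic_D f.
Proof.
intros [h [Hh [E _]]] y Hy.
assert (Hk : analytic_D (fun z => (z - w) ^ j * h z)).
{ apply analytic_mult; [|assumption]. apply analytic_pow.
  intros z _. exists (RtoC 1). apply cder_minus_const. }
destruct (Hk y Hy) as [l Hl]. exists l. unfold inD in Hy.
apply (cder_ext_loc _ f y l (1 - Cmod y)) in Hl; [exact Hl|lra|].
intros x Hx. rewrite E; [reflexivity|]. unfold inD. replace x with (y + (x - y)) by ring.
eapply Rle_lt_trans; [apply Cmod_triangle|]. lra.
Qed.

Lemma cder_pow_minus (w z : C) (j : nat) :
  cder (fun z => (z - w) ^ S j) z (RtoC (INR (S j)) * (z - w) ^ j).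
Proof.
induction j.
- apply (cder_eq _ _ (1 * (1) + (z - w) * 0)); [|simpl; ring].
  apply (cder_mult (fun z => z - w) (fun z => (z - w) ^ 0)); [apply cder_minus_const|].
  apply (cder_const 1).
- apply (cder_eq _ _ (1 * (z - w) ^ S j + (z - w) * (RtoC (INR (S j)) * (z - w) ^ j))).
  + apply (cder_mult (fun z => z - w) (fun z => (z - w) ^ S j)); [apply cder_minus_const|assumption].
  + rewrite (S_INR (S j)), RtoC_plus. simpl Cpow. ring.
Qed.

Lemma lead_cderiv (w : C) (j : nat) (f : C -> C) (c : C) :
  lead w (S j) f c -> lead w j (cderiv f) (RtoC (INR (S j)) * c).
Proof.
intros [h [H1 [H2 H3]]].
exists (fun z => RtoC (INR (S j)) * h z + (z - w) * cderiv h z). split; [|split].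
- apply analytic_plus.
  + apply (analytic_mult (fun _ => RtoC (INR (S j)))); [apply analytic_const|assumption].
  + apply analytic_mult; [|now apply analytic_cderiv].
    intros z _. exists (RtoC 1). apply cder_minus_const.
- intros z Hz. apply cderiv_eq.
  unfold inD in Hz. apply (cder_ext_loc (fun z => (z - w) ^ S j * h z) f z _ (1 - Cmod z)); [lra| |].
  + intros x Hx. rewrite H2; [reflexivity|]. unfold inD. replace x with (z + (x - z)) by ring.
    eapply Rle_lt_trans; [apply Cmod_triangle|]. lra.
  + apply (cder_eq _ _ ((RtoC (INR (S j)) * (z - w) ^ j) * h z + (z - w) ^ S j * cderiv h z)).
    * apply (cder_mult (fun z => (z - w) ^ S j) h); [apply cder_pow_minus|].
      apply cder_cderiv. now apply H1.
    * simpl Cpow. ring.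
- rewrite H3. ring.
Qed.

Lemma lead_cderiv_n (w : C) (n j : nat) (f : C -> C) (c : C) : (n <= j)%nat ->
  lead w j f c ->
  lead w (j - n) (cderiv_n n f) (RtoC (INR (fact j) / INR (fact (j - n))) * c).
Proof.
intros Hn Hf. induction n.
- rewrite Nat.sub_0_r. simpl cderiv_n.
  replace (INR (fact j) / INR (fact j))%R with 1%R by (field; apply INR_fact_neq_0).
  now rewrite Cmult_1_l.
- specialize (IHn ltac:(lia)). replace (j - n)%nat with (S (j - S n)) in IHn by lia.
  apply lead_cderiv in IHn. simpl cderiv_n.
  replace (INR (fact j) / INR (fact (j - S n)))%R
    with (INR (S (j - S n)) * (INR (fact j) / INR (fact (S (j - S n)))))%R.
  + rewrite RtoC_mult, <- Cmult_assoc. exact IHn.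
  + rewrite fact_simpl, mult_INR. field.
    split; [apply INR_fact_neq_0|]. apply not_0_INR. lia.
Qed.

(** Translates a zero of order at least n, given by derivatives, into a leading term. [lead_S]
    supplies some coefficient; differentiating down to order 0 and comparing values at w identifies
    it as the Taylor coefficient. *)
Lemma lead_of_derivatives (w : C) (n : nat) (f : C -> C) : inD w -> analytic_D f ->
  (forall j, (j < n)%nat -> cderiv_n j f w = RtoC 0) ->
  lead w n f (cderiv_n n f w / RtoC (INR (fact n))).
Proof.
intros Hw Hf H. induction n.
- simpl. replace (f w / RtoC 1) with (f w) by field. now apply lead_0.
- assert (IH := IHn (fun j Hj => H j (Nat.lt_lt_succ_r _ _ Hj))).
  rewrite H in IH by lia. unfold Cdiv in IH. rewrite Cmult_0_l in IH.
  apply lead_S in IH as [c Hc]; [|assumption].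
  assert (L := lead_cderiv_n w (S n) (S n) f c (le_n _) Hc).
  rewrite Nat.sub_diag in L.
  assert (L0 := lead_0 w _ (analytic_cderiv_n (S n) f Hf)).
  assert (E := lead_unique w 0 _ _ _ Hw L L0).
  rewrite <- E.
  replace (RtoC (INR (fact (S n)) / INR (fact 0)) * c / RtoC (INR (fact (S n)))) with c; [exact Hc|].
  rewrite RtoC_div by (apply INR_fact_neq_0). simpl (fact 0).
  simpl (INR 1). field. intros F. apply RtoC_inj in F. revert F. apply INR_fact_neq_0.
Qed.

(** One formula for all the families of the theorem: at l = 0 the power is 1, and for l < n the
    differentiation operator contributes nothing at order l. *)
Definition taylor_eigenvalue (n : nat) (psi0 psin phi0 phin : C -> C) (w : C) (l : nat) : C :=
  psi0 w * cderiv phi0 w ^ l +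
  (if le_dec n l then RtoC (Binomial.C l n) * cderiv_n n psin w * cderiv phin w ^ (l - n) else 0).

Lemma lead_op (n : nat) (psi0 psin phi0 phin : C -> C) (w : C) (j : nat) (f : C -> C) (c : C) :
  analytic_D psi0 -> analytic_D psin -> selfmap_D phi0 -> selfmap_D phin ->
  inD w -> phi0 w = w -> phin w = w ->
  (forall j, (j < n)%nat -> cderiv_n j psin w = RtoC 0) ->
  lead w j f c ->
  lead w j (op_add (Cop psi0 phi0) (Dop psin phin n) f)
    (taylor_eigenvalue n psi0 psin phi0 phin w j * c).
Proof.
intros A0 An S0 Sn Hw F0 Fn Hv Hf.
unfold taylor_eigenvalue. rewrite Cmult_plus_distr_r.
apply (lead_plus w j (Cop psi0 phi0 f) (Dop psin phin n f)).
- rewrite <- Cmult_assoc. apply (lead_mult w 0 j psi0 (fun z => f (phi0 z))); [now apply lead_0|].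
  now apply lead_comp.
- assert (L := lead_of_derivatives w n psin Hw An Hv).
  unfold Dop. destruct (le_dec n j) as [Hnj|Hnj].
  + assert (D := lead_comp w _ _ phin _ Hw Sn Fn (lead_cderiv_n w n j f c Hnj Hf)).
    assert (M := lead_mult _ _ _ _ _ _ _ L D).
    replace (n + (j - n))%nat with j in M by lia.
    match type of M with lead _ _ _ ?x => match goal with |- lead _ _ _ ?y => replace y with x end end.
    * exact M.
    (* The Taylor coefficient brings 1/n! and the n-fold derivative brings j!/(j - n)!; together
       they form the binomial coefficient. *)
    * unfold Binomial.C. rewrite !RtoC_div, RtoC_mult by (try apply Rmult_integral_contrapositive_currified; apply INR_fact_neq_0).
      field. split; intros F; apply RtoC_inj in F; revert F; apply INR_fact_neq_0.
  (* For j < n the factor [psin] alone already vanishes to order n, beyond j. *)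
  + rewrite Cmult_0_l.
    assert (D := lead_0 w _ (analytic_comp _ phin (analytic_cderiv_n n f (lead_analytic _ _ _ _ Hf)) Sn)).
    assert (M := lead_mult _ _ _ _ _ _ _ L D).
    apply (lead_weaken w j (n + 0) _ _ ltac:(lia) M).
Qed.

(** * The norms of the Hardy and Bergman spaces *)

Definition contD (f : C -> C) : Prop := forall z, inD z -> continuous f z.

Lemma analytic_contD (f : C -> C) : analytic_D f -> contD f.
Proof. intros Hf z Hz. now apply analytic_continuous. Qed.

Lemma polar_inD (r t : R) : (-1 < r < 1)%R -> inD (polar r t).
Proof.
intros Hr. unfold inD. destruct (Rle_dec 0 r).
- rewrite Cmod_polar; lra.
- replace (polar r t) with (- polar (- r) t) by (apply injective_projections; simpl; ring).
  rewrite Cmod_opp, Cmod_polar; lra.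
Qed.

Lemma continuous_sqmod_circle (f : C -> C) (r t : R) : contD f -> (-1 < r < 1)%R ->
  continuous (fun t => Cmod (f (polar r t)) ^ 2)%R t.
Proof.
intros Hf Hr. apply continuous_Rpow2, continuous_Cmod.
apply (continuous_comp (fun t => polar r t) f); [apply continuous_polar|].
now apply Hf, polar_inD.
Qed.

Lemma ex_sqmod_circle (f : C -> C) (r : R) : contD f -> (-1 < r < 1)%R ->
  ex_RInt (fun t => Cmod (f (polar r t)) ^ 2)%R 0 (2 * PI).
Proof.
intros Hf Hr. apply (ex_RInt_continuous (V := R_CompleteNormedModule)).
intros t _. now apply continuous_sqmod_circle.
Qed.

Lemma continuous_polar_2 (p : R * R) :
  continuous (fun p : R * R => polar (snd p) (fst p)) p.
Proof.
apply continuous_C_pair; simpl; apply (continuous_mult (K := R_AbsRing)).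
- apply continuous_snd.
- apply (continuous_comp fst cos); [apply continuous_fst|apply continuous_cos].
- apply continuous_snd.
- apply (continuous_comp fst sin); [apply continuous_fst|apply continuous_sin].
Qed.

Lemma continuous_circ_mean (f : C -> C) (r : R) : contD f -> (-1 < r < 1)%R ->
  continuous (circ_mean f) r.
Proof.
intros Hf Hr. pose proof PI_RGT_0.
unfold circ_mean. apply (continuous_mult (K := R_AbsRing)); [apply continuous_const|].
set (F := fun t r => (Cmod (f (polar r t)) ^ 2)%R).
apply filterlim_locally. intros eps.
assert (He : (0 < eps / (4 * PI))%R) by (apply Rdiv_lt_0_compat; [apply cond_pos|lra]).
destruct (uniform_continuity_2d_1d F 0 (2 * PI) r) with (eps := mkposreal _ He) as [d Hd].
{ intros t _. apply continuity_2d_pt_filterlim.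
  apply (continuous_Rpow2 (fun p : R * R => Cmod (f (polar (snd p) (fst p)))) (t, r)).
  apply continuous_Cmod.
  apply (continuous_comp (fun p : R * R => polar (snd p) (fst p)) f); [apply continuous_polar_2|].
  now apply Hf, polar_inD. }
set (e := Rmin (d / 2) (Rmin (1 - r) (1 + r))).
assert (Hee : (0 < e)%R).
{ unfold e. pose proof (cond_pos d). repeat apply Rmin_glb_lt; lra. }
exists (mkposreal e Hee). intros s Hs. change (Rabs (s - r) < e)%R in Hs.
assert (Hs1 := Rlt_le_trans _ _ _ Hs (Rmin_l _ _)).
assert (Hs2 := Rlt_le_trans _ _ _ Hs (Rle_trans _ _ _ (Rmin_r _ _) (Rmin_l _ _))).
assert (Hs3 := Rlt_le_trans _ _ _ Hs (Rle_trans _ _ _ (Rmin_r _ _) (Rmin_r _ _))).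
apply Rabs_lt_between in Hs1. apply Rabs_lt_between in Hs2. apply Rabs_lt_between in Hs3.
assert (Is : (-1 < s < 1)%R) by lra.
change (Rabs (RInt (fun t => F t s) 0 (2 * PI) - RInt (fun t => F t r) 0 (2 * PI)) < eps)%R.
assert (E1 := ex_sqmod_circle f s Hf Is). assert (E2 := ex_sqmod_circle f r Hf Hr).
change (ex_RInt (fun t => F t s) 0 (2 * PI)) in E1.
change (ex_RInt (fun t => F t r) 0 (2 * PI)) in E2.
change (Rabs (minus (RInt (fun t => F t s) 0 (2 * PI)) (RInt (fun t => F t r) 0 (2 * PI))) < eps)%R.
rewrite <- (RInt_minus (V := R_CompleteNormedModule)) by assumption.
apply Rle_lt_trans with ((2 * PI - 0) * (eps / (4 * PI)))%R.
- apply abs_RInt_le_const; [lra| |].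
  + apply (ex_RInt_minus (V := R_NormedModule)); assumption.
  + intros t Ht. left. apply (Hd t r t s); try lra; pose proof (cond_pos d).
    replace (t - t)%R with 0%R by ring. rewrite Rabs_R0. lra.
- replace ((2 * PI - 0) * (eps / (4 * PI)))%R with (eps / 2)%R by (field; lra).
  pose proof (cond_pos eps). lra.
Qed.

(** The radial density of the measure: dA = r dr dt / pi, and [circ_mean] already divides by 2 pi,
    which leaves the factor 2 r. *)
Definition bergman_weight (alpha r : R) : R := (2 * r * (alpha + 1) * Rpower (1 - r ^ 2) alpha)%R.

Lemma bergman_weight_pos (alpha r : R) : (-1 < alpha)%R -> (0 < r)%R -> (0 < bergman_weight alpha r)%R.
Proof.
intros Ha Hr. unfold bergman_weight.
apply Rmult_lt_0_compat; [nra|]. apply exp_pos.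
Qed.

Lemma continuous_bergman_weight (alpha r : R) : (-1 < r < 1)%R -> continuous (bergman_weight alpha) r.
Proof.
intros Hr. unfold bergman_weight. apply (continuous_mult (K := R_AbsRing)).
- apply (continuous_mult (K := R_AbsRing)); [|apply continuous_const].
  apply (continuous_mult (K := R_AbsRing)); [apply continuous_const|apply continuous_id].
- unfold Rpower. apply continuous_exp_comp. apply (continuous_mult (K := R_AbsRing)); [apply continuous_const|].
  apply (continuous_comp (fun r => 1 - r ^ 2)%R ln).
  + apply (continuous_minus (V := R_NormedModule)); [apply continuous_const|].
    apply continuous_Rpow2, continuous_id.
  + apply continuous_ln. nra.
Qed.

Lemma bergman_partial_weight (alpha : R) (f : C -> C) (rho : R) :
  bergman_partial alpha f rho = RInt (fun r => bergman_weight alpha r * circ_mean f r)%R 0 rho.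
Proof. apply RInt_ext. intros r _. unfold bergman_weight. simpl. ring. Qed.

Lemma continuous_bergman_integrand (alpha : R) (f : C -> C) (r : R) :
  contD f -> (-1 < r < 1)%R -> continuous (fun r => bergman_weight alpha r * circ_mean f r)%R r.
Proof.
intros Hf Hr. apply (continuous_mult (K := R_AbsRing)).
- now apply continuous_bergman_weight.
- now apply continuous_circ_mean.
Qed.

Lemma ex_bergman_integrand (alpha : R) (f : C -> C) (rho : R) : contD f -> (0 <= rho < 1)%R ->
  ex_RInt (fun r => bergman_weight alpha r * circ_mean f r)%R 0 rho.
Proof.
intros Hf Hr. apply (ex_RInt_continuous (V := R_CompleteNormedModule)).
intros r. rewrite Rmin_left, Rmax_right by lra. intros Hr'.
apply continuous_bergman_integrand; [assumption|lra].
Qed.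

Lemma circ_mean_comb (f g h : C -> C) (a b r : R) :
  contD f -> contD g -> contD h -> (0 <= r < 1)%R ->
  (forall z, inD z -> Cmod (h z) ^ 2 <= a * Cmod (f z) ^ 2 + b * Cmod (g z) ^ 2)%R ->
  (circ_mean h r <= a * circ_mean f r + b * circ_mean g r)%R.
Proof.
intros Hf Hg Hh Hr H. pose proof PI_RGT_0. unfold circ_mean.
assert (Ef := ex_sqmod_circle f r Hf ltac:(lra)).
assert (Eg := ex_sqmod_circle g r Hg ltac:(lra)).
assert (Eh := ex_sqmod_circle h r Hh ltac:(lra)).
set (F := fun t => (Cmod (f (polar r t)) ^ 2)%R) in *.
set (G := fun t => (Cmod (g (polar r t)) ^ 2)%R) in *.
assert (Ec : is_RInt (fun t => a * F t + b * G t)%R 0 (2 * PI) (a * RInt F 0 (2 * PI) + b * RInt G 0 (2 * PI))%R).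
{ apply (is_RInt_plus (V := R_NormedModule)); apply (is_RInt_scal (V := R_NormedModule));
  apply (RInt_correct (V := R_CompleteNormedModule)); assumption. }
assert (K : (RInt (fun t => Cmod (h (polar r t)) ^ 2)%R 0 (2 * PI) <= RInt (fun t => a * F t + b * G t)%R 0 (2 * PI))%R).
{ apply RInt_le; [lra|assumption|eexists; exact Ec|].
  intros t _. apply H. apply polar_inD. lra. }
rewrite (is_RInt_unique (V := R_CompleteNormedModule) _ _ _ _ Ec) in K.
assert (0 < / (2 * PI))%R by (apply Rinv_0_lt_compat; lra).
apply Rle_trans with (/ (2 * PI) * (a * RInt F 0 (2 * PI) + b * RInt G 0 (2 * PI)))%R.
- apply Rmult_le_compat_l; lra.
- right. ring.
Qed.

(** A circle mean is the Hardy quantity itself, and in the Bergman case it is integrated against a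
    positive weight. Comparing means rather than points admits orthogonality, which holds only on
    average over a circle. *)
Lemma Hpartial_comb (alpha : R) (f g h : C -> C) (a b rho : R) :
  (-1 <= alpha)%R -> contD f -> contD g -> contD h -> (0 <= rho < 1)%R ->
  (forall r, (0 <= r < 1)%R -> (circ_mean h r <= a * circ_mean f r + b * circ_mean g r)%R) ->
  (Hpartial alpha h rho <= a * Hpartial alpha f rho + b * Hpartial alpha g rho)%R.
Proof.
intros Ha Hf Hg Hh Hr H. unfold Hpartial.
destruct (Req_EM_T alpha (-1)) as [_|Hn]; [now apply H|].
rewrite !bergman_partial_weight.
assert (Ef := ex_bergman_integrand alpha f rho Hf Hr).
assert (Eg := ex_bergman_integrand alpha g rho Hg Hr).
assert (Eh := ex_bergman_integrand alpha h rho Hh Hr).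
set (F := fun r => (bergman_weight alpha r * circ_mean f r)%R) in *.
set (G := fun r => (bergman_weight alpha r * circ_mean g r)%R) in *.
assert (Ec : is_RInt (fun t => a * F t + b * G t)%R 0 rho (a * RInt F 0 rho + b * RInt G 0 rho)%R).
{ apply (is_RInt_plus (V := R_NormedModule)); apply (is_RInt_scal (V := R_NormedModule));
  apply (RInt_correct (V := R_CompleteNormedModule)); assumption. }
rewrite <- (is_RInt_unique (V := R_CompleteNormedModule) _ _ _ _ Ec).
apply RInt_le; [lra|assumption|eexists; exact Ec|].
intros t Ht. unfold F, G.
assert (Q := H t ltac:(lra)). assert (W := bergman_weight_pos alpha t ltac:(lra) ltac:(lra)). nra.
Qed.

Lemma Hpartial_pointwise (alpha : R) (f g h : C -> C) (a b rho : R) :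
  (-1 <= alpha)%R -> contD f -> contD g -> contD h -> (0 <= rho < 1)%R ->
  (forall z, inD z -> Cmod (h z) ^ 2 <= a * Cmod (f z) ^ 2 + b * Cmod (g z) ^ 2)%R ->
  (Hpartial alpha h rho <= a * Hpartial alpha f rho + b * Hpartial alpha g rho)%R.
Proof.
intros Ha Hf Hg Hh Hr H. apply Hpartial_comb; try assumption.
intros r Hr'. now apply circ_mean_comb.
Qed.

Lemma contD_const (c : C) : contD (fun _ => c).
Proof. intros z _. apply continuous_const. Qed.

Lemma Hpartial_0 (alpha rho : R) : Hpartial alpha (fun _ => RtoC 0) rho = 0%R.
Proof.
assert (Z : forall r, circ_mean (fun _ => RtoC 0) r = 0%R).
{ intros r. unfold circ_mean.
  rewrite (RInt_ext (V := R_CompleteNormedModule) _ (fun _ => 0%R)).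
  - rewrite (RInt_const (V := R_CompleteNormedModule)). change (scal ?x ?y) with (x * y)%R. ring.
  - intros t _. rewrite Cmod_0. simpl; ring. }
unfold Hpartial. destruct (Req_EM_T alpha (-1)); [apply Z|].
unfold bergman_partial. rewrite (RInt_ext (V := R_CompleteNormedModule) _ (fun _ => 0%R)).
- rewrite (RInt_const (V := R_CompleteNormedModule)). change (scal ?x ?y) with (x * y)%R. ring.
- intros r _. rewrite Z. simpl; ring.
Qed.

Lemma Hpartial_nonneg (alpha : R) (f : C -> C) (rho : R) :
  (-1 <= alpha)%R -> contD f -> (0 <= rho < 1)%R -> (0 <= Hpartial alpha f rho)%R.
Proof.
intros Ha Hf Hr.
assert (K := Hpartial_pointwise alpha f f (fun _ => RtoC 0) 1 0 rho Ha Hf Hf (contD_const 0) Hr).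
rewrite Hpartial_0 in K.
eapply Rle_trans; [apply K|lra].
intros z _. rewrite Cmod_0. pose proof (pow2_ge_0 (Cmod (f z))). nra.
Qed.

Lemma RInt_nonneg_eq_0 (F : R -> R) (a b t : R) : (a < b)%R ->
  (forall x, (a <= x <= b)%R -> continuous F x) ->
  (forall x, (a <= x <= b)%R -> (0 <= F x)%R) ->
  (RInt F a b <= 0)%R -> (a <= t <= b)%R -> F t = 0%R.
Proof.
intros Hab CF Fp HI Ht. apply Rle_antisym; [|now apply Fp].
apply Rnot_lt_le. intros Ft.
assert (Ft2 : (0 < F t / 2)%R) by lra.
destruct (proj1 (filterlim_locally F (F t)) (CF t Ht) (mkposreal _ Ft2)) as [d Hd].
pose proof (cond_pos d) as Pd.
set (u := Rmax a (t - d / 2)). set (v := Rmin b (t + d / 2)).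
assert (Hu : (a <= u /\ t - d / 2 <= u /\ u <= t)%R).
{ unfold u. split; [apply Rmax_l|]. split; [apply Rmax_r|]. apply Rmax_lub; lra. }
assert (Hv : (v <= b /\ v <= t + d / 2 /\ t <= v)%R).
{ unfold v. split; [apply Rmin_l|]. split; [apply Rmin_r|]. apply Rmin_glb; lra. }
assert (Huv : (u < v)%R).
{ unfold u, v. apply Rmax_lub_lt; apply Rmin_glb_lt; lra. }
assert (Ex : forall x y, (a <= x)%R -> (x <= y <= b)%R -> ex_RInt F x y).
{ intros x y H1 H2. apply (ex_RInt_continuous (V := R_CompleteNormedModule)).
  intros s. rewrite Rmin_left, Rmax_right by lra. intros Hs. apply CF; lra. }
assert (E1 := RInt_Chasles (V := R_CompleteNormedModule) F a u b (Ex a u ltac:(lra) ltac:(lra)) (Ex u b ltac:(lra) ltac:(lra))).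
assert (E2 := RInt_Chasles (V := R_CompleteNormedModule) F u v b (Ex u v ltac:(lra) ltac:(lra)) (Ex v b ltac:(lra) ltac:(lra))).
change plus with Rplus in E1, E2.
assert (G1 : (0 <= RInt F a u)%R).
{ apply RInt_ge_0; [lra|apply Ex; lra|]. intros s Hs. apply Fp; lra. }
assert (G2 : (0 <= RInt F v b)%R).
{ apply RInt_ge_0; [lra|apply Ex; lra|]. intros s Hs. apply Fp; lra. }
assert (G3 : (0 < RInt F u v)%R).
{ apply RInt_gt_0; [lra| |].
  - intros s Hs. assert (Q : ball t d s).
    { change (Rabs (s - t) < d)%R. apply Rabs_lt_between. lra. }
    apply Hd in Q. change (Rabs (F s - F t) < F t / 2)%R in Q. apply Rabs_lt_between in Q. lra.
  - intros s Hs. apply CF; lra. }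
lra.
Qed.

Lemma circ_mean_nonneg (f : C -> C) (r : R) : contD f -> (0 <= r < 1)%R -> (0 <= circ_mean f r)%R.
Proof.
intros Hf Hr. unfold circ_mean. pose proof PI_RGT_0. apply Rmult_le_pos.
- left. apply Rinv_0_lt_compat. lra.
- apply RInt_ge_0; [lra|apply ex_sqmod_circle; [assumption|lra]|]. intros; apply pow2_ge_0.
Qed.

(** Some circle of radius r > |z| has mean 0, in the Bergman case because the weight is positive at
    r. By continuity f vanishes on it, and the Cauchy estimate with bound 0 carries this to z. *)
Lemma normsq_le_0 (alpha : R) (f : C -> C) :
  (-1 <= alpha)%R -> analytic_D f -> normsq_le alpha f 0 -> forall z, inD z -> f z = 0.
Proof.
intros Ha Hfa H z Hz. assert (Hf := analytic_contD f Hfa). pose proof PI_RGT_0.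
unfold inD in Hz. pose proof (Cmod_ge_0 z).
set (r := ((1 + Cmod z) / 2)%R). assert (Hr : (Cmod z < r < 1)%R) by (unfold r; lra).
assert (Cz : circ_mean f r = 0%R).
{ unfold normsq_le, Hpartial in H. destruct (Req_EM_T alpha (-1)) as [_|Hn].
  { apply Rle_antisym; [apply H; lra|apply circ_mean_nonneg; [assumption|lra]]. }
  set (rho := ((1 + r) / 2)%R). assert (Hrho : (r < rho < 1)%R) by (unfold rho; lra).
  specialize (H rho ltac:(lra)). rewrite bergman_partial_weight in H.
  assert (W := bergman_weight_pos alpha r ltac:(lra) ltac:(lra)).
  assert (CI : forall x, (0 <= x <= rho)%R -> continuous (fun r => bergman_weight alpha r * circ_mean f r)%R x).
  { intros x Hx. apply continuous_bergman_integrand; [assumption|lra]. }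
  assert (E := RInt_nonneg_eq_0 _ 0 rho r ltac:(lra) CI). simpl in E.
  assert (Q : (bergman_weight alpha r * circ_mean f r)%R = 0%R).
  { apply E; [|assumption|lra]. intros x Hx. apply Rmult_le_pos.
    - unfold bergman_weight. apply Rmult_le_pos; [nra|]. left. apply exp_pos.
    - apply circ_mean_nonneg; [assumption|lra]. }
  apply Rmult_integral in Q. lra. }
assert (Pz : forall t, (0 <= t <= 2 * PI)%R -> (Cmod (f (polar r t)) <= 0)%R).
{ intros t Ht. unfold circ_mean in Cz.
  assert (E := RInt_nonneg_eq_0 _ 0 (2 * PI) t ltac:(lra)
    (fun x _ => continuous_sqmod_circle f r x Hf ltac:(lra))
    (fun x _ => pow2_ge_0 _)).
  assert (0 < / (2 * PI))%R by (apply Rinv_0_lt_compat; lra).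
  assert (Q : (Cmod (f (polar r t)) ^ 2 = 0)%R).
  { apply E; [|assumption]. apply Rmult_integral in Cz as [Cz|Cz]; [lra|right; exact Cz]. }
  pose proof (Cmod_ge_0 (f (polar r t))). nra. }
apply Cmod_eq_0. apply Rle_antisym; [|apply Cmod_ge_0].
assert (K := cauchy_estimate f z r 0 Hfa ltac:(lra) (Rle_refl 0) Pz).
unfold Rdiv in K. rewrite Rmult_0_l in K. exact K.
Qed.

(** The weight is the derivative of -(1 - r^2)^(alpha + 1). Its mass thus stays below 1, which puts
    bounded functions in the space. *)
Lemma bergman_weight_integral (alpha rho : R) : (-1 < alpha)%R -> (0 <= rho < 1)%R ->
  is_RInt (bergman_weight alpha) 0 rho (1 - Rpower (1 - rho ^ 2) (alpha + 1))%R.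
Proof.
intros Ha Hr.
assert (E := is_RInt_derive (V := R_CompleteNormedModule)
  (fun r => - Rpower (1 - r ^ 2) (alpha + 1))%R (bergman_weight alpha) 0 rho).
change minus with Rminus in E. cbv beta in E.
assert (R0 : Rpower (1 - 0 ^ 2) (alpha + 1) = 1%R).
{ rewrite pow_i by lia. rewrite Rminus_0_r. unfold Rpower. rewrite ln_1, Rmult_0_r. apply exp_0. }
replace (- Rpower (1 - rho ^ 2) (alpha + 1) - - Rpower (1 - 0 ^ 2) (alpha + 1))%R
  with (1 - Rpower (1 - rho ^ 2) (alpha + 1))%R in E.
- apply E; intros r; rewrite Rmin_left, Rmax_right by lra; intros Hr'.
  + assert (Q : (0 < 1 - r ^ 2)%R) by nra.
    assert (D := proj2 (is_derive_Reals _ _ _) (derivable_pt_lim_power (1 - r ^ 2) (alpha + 1) Q)).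
    assert (D2 : is_derive (fun r => 1 - r ^ 2)%R r (- (2 * r))%R) by (auto_derive; trivial; ring).
    assert (D3 := is_derive_comp (fun x => Rpower x (alpha + 1)) (fun r => 1 - r ^ 2)%R r _ _ D D2).
    apply (is_derive_opp (V := R_NormedModule)) in D3.
    replace (bergman_weight alpha r) with (opp (scal (- (2 * r)) ((alpha + 1) * Rpower (1 - r ^ 2) (alpha + 1 - 1)))%R).
    * exact D3.
    * change (- (- (2 * r) * ((alpha + 1) * Rpower (1 - r ^ 2) (alpha + 1 - 1))) = bergman_weight alpha r)%R.
      unfold bergman_weight. replace (alpha + 1 - 1)%R with alpha by ring. ring.
  + apply continuous_bergman_weight. lra.
- rewrite R0. ring.
Qed.

Lemma inH_bounded (alpha : R) (f : C -> C) (M : R) : (-1 <= alpha)%R -> analytic_D f ->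
  (forall z, inD z -> (Cmod (f z) <= M)%R) -> inH alpha f.
Proof.
intros Ha Hfa HM. assert (Hf := analytic_contD f Hfa). split; [assumption|].
pose proof PI_RGT_0.
assert (Cb : forall r, (0 <= r < 1)%R -> (circ_mean f r <= M ^ 2)%R).
{ intros r Hr. unfold circ_mean.
  assert (0 < / (2 * PI))%R by (apply Rinv_0_lt_compat; lra).
  replace (M ^ 2)%R with (/ (2 * PI) * ((2 * PI - 0) * M ^ 2))%R by (field; lra).
  apply Rmult_le_compat_l; [lra|].
  eapply Rle_trans; [apply Rle_abs|]. apply abs_RInt_le_const; [lra|apply ex_sqmod_circle; [assumption|lra]|].
  intros t _. rewrite Rabs_pos_eq by apply pow2_ge_0. apply pow_incr. split; [apply Cmod_ge_0|].
  apply HM, polar_inD. lra. }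
exists (M ^ 2)%R. intros rho Hr. unfold Hpartial. destruct (Req_EM_T alpha (-1)) as [_|Hn]; [now apply Cb|].
rewrite bergman_partial_weight.
assert (E := bergman_weight_integral alpha rho ltac:(lra) Hr).
apply (is_RInt_scal (V := R_NormedModule) _ _ _ (M ^ 2)%R) in E.
apply Rle_trans with (M ^ 2 * (1 - Rpower (1 - rho ^ 2) (alpha + 1)))%R.
- apply Rle_trans with (RInt (fun r => M ^ 2 * bergman_weight alpha r)%R 0 rho).
  2:{ right. exact (is_RInt_unique (V := R_CompleteNormedModule) _ _ _ _ E). }
  apply RInt_le; [lra|now apply ex_bergman_integrand|eexists; exact E|].
  intros r Hr'. rewrite Rmult_comm.
  apply Rmult_le_compat_r; [left; apply bergman_weight_pos; lra|]. apply Cb; lra.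
- assert (0 < Rpower (1 - rho ^ 2) (alpha + 1))%R by apply exp_pos.
  pose proof (pow2_ge_0 M). nra.
Qed.

(** * The squared norm as a least upper bound *)

Lemma inH_analytic (alpha : R) (f : C -> C) : inH alpha f -> analytic_D f.
Proof. now intros [H _]. Qed.

Lemma inH_contD (alpha : R) (f : C -> C) : inH alpha f -> contD f.
Proof. intros [H _]. now apply analytic_contD. Qed.

Definition normsq (alpha : R) (f : C -> C) : R :=
  epsilon (inhabits 0%R) (fun m => normsq_le alpha f m /\ forall M, normsq_le alpha f M -> (m <= M)%R).

Lemma normsq_spec (alpha : R) (f : C -> C) : inH alpha f ->
  normsq_le alpha f (normsq alpha f) /\
  forall M, normsq_le alpha f M -> (normsq alpha f <= M)%R.
Proof.
intros [_ [M HM]]. apply (epsilon_spec (inhabits 0%R)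
  (fun m => normsq_le alpha f m /\ forall M, normsq_le alpha f M -> (m <= M)%R)).
destruct (completeness (fun x => exists rho, (0 <= rho < 1)%R /\ x = Hpartial alpha f rho)) as [m [H1 H2]].
- exists M. intros x [rho [Hr ->]]. now apply HM.
- exists (Hpartial alpha f 0), 0%R. split; [lra|reflexivity].
- exists m. split.
  + intros rho Hr. apply H1. now exists rho.
  + intros N HN. apply H2. intros x [rho [Hr ->]]. now apply HN.
Qed.

Lemma normsq_le_iff (alpha : R) (f : C -> C) (M : R) : inH alpha f ->
  normsq_le alpha f M <-> (normsq alpha f <= M)%R.
Proof.
intros Hf. destruct (normsq_spec alpha f Hf) as [H1 H2]. split; [apply H2|].
intros H rho Hr. eapply Rle_trans; [now apply H1|assumption].
Qed.

(** This single form yields sums, multiples, comparison and invariance under equality on the disc;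
    with g = f and b = 0 it involves one function only. *)
Lemma normsq_le_pointwise (alpha : R) (f g h : C -> C) (a b M N : R) :
  (-1 <= alpha)%R -> (0 <= a)%R -> (0 <= b)%R -> contD f -> contD g -> contD h ->
  (forall z, inD z -> Cmod (h z) ^ 2 <= a * Cmod (f z) ^ 2 + b * Cmod (g z) ^ 2)%R ->
  normsq_le alpha f M -> normsq_le alpha g N -> normsq_le alpha h (a * M + b * N).
Proof.
intros Ha Pa Pb Hf Hg Hh H HM HN rho Hr.
eapply Rle_trans; [apply (Hpartial_pointwise alpha f g h a b); assumption|].
specialize (HM rho Hr). specialize (HN rho Hr).
apply Rplus_le_compat; apply Rmult_le_compat_l; assumption.
Qed.

Lemma Cmod_plus_sq (x y : C) : (Cmod (x + y) ^ 2 <= 2 * Cmod x ^ 2 + 2 * Cmod y ^ 2)%R.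
Proof.
pose proof (Cmod_triangle x y). pose proof (Cmod_ge_0 (x + y)).
apply Rle_trans with ((Cmod x + Cmod y) ^ 2)%R; [apply pow_incr; lra|].
pose proof (pow2_ge_0 (Cmod x - Cmod y)). nra.
Qed.

Lemma inH_fadd (alpha : R) (f g : C -> C) : (-1 <= alpha)%R -> inH alpha f -> inH alpha g ->
  inH alpha (fadd f g) /\ (normsq alpha (fadd f g) <= 2 * normsq alpha f + 2 * normsq alpha g)%R.
Proof.
intros Ha Hf Hg.
assert (A : analytic_D (fadd f g)) by (apply analytic_plus; eapply inH_analytic; eassumption).
assert (K : normsq_le alpha (fadd f g) (2 * normsq alpha f + 2 * normsq alpha g)).
{ apply (normsq_le_pointwise alpha f g); try lra; try (eapply inH_contD; eassumption).
  - now apply analytic_contD.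
  - intros z _. apply Cmod_plus_sq.
  - now apply normsq_spec.
  - now apply normsq_spec. }
assert (I : inH alpha (fadd f g)) by (split; [assumption|eexists; exact K]).
split; [assumption|]. now apply normsq_le_iff.
Qed.

Lemma inH_fscal (alpha : R) (c : C) (f : C -> C) : (-1 <= alpha)%R -> inH alpha f ->
  inH alpha (fscal c f) /\ (normsq alpha (fscal c f) <= Cmod c ^ 2 * normsq alpha f)%R.
Proof.
intros Ha Hf.
assert (A : analytic_D (fscal c f)).
{ apply (analytic_mult (fun _ => c)); [apply analytic_const|eapply inH_analytic; eassumption]. }
assert (K : normsq_le alpha (fscal c f) (Cmod c ^ 2 * normsq alpha f + 0 * normsq alpha f)).
{ apply (normsq_le_pointwise alpha f f); try lra; try (eapply inH_contD; eassumption).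
  - apply pow2_ge_0.
  - now apply analytic_contD.
  - intros z _. unfold fscal. rewrite Cmod_mult, Rpow_mult_distr. lra.
  - now apply normsq_spec.
  - now apply normsq_spec. }
assert (I : inH alpha (fscal c f)) by (split; [assumption|eexists; exact K]).
split; [assumption|]. apply normsq_le_iff in K; [|assumption]. lra.
Qed.

(** The inequality of [inH_fscal], applied to c and then to 1/c. *)
Lemma normsq_fscal (alpha : R) (c : C) (f : C -> C) : (-1 <= alpha)%R -> inH alpha f ->
  normsq alpha (fscal c f) = (Cmod c ^ 2 * normsq alpha f)%R.
Proof.
intros Ha Hf. destruct (inH_fscal alpha c f Ha Hf) as [I1 L1].
apply Rle_antisym; [assumption|].
destruct (Ceq_dec c 0) as [->|Hc].
- rewrite Cmod_0. apply Rle_trans with 0%R; [right; simpl; ring|].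
  eapply Rle_trans; [|apply (proj1 (normsq_spec _ _ I1) 0%R); lra].
  apply Hpartial_nonneg; [assumption|now apply (inH_contD alpha)|lra].
- destruct (inH_fscal alpha (/ c) _ Ha I1) as [I2 L2].
  replace (fscal (/ c) (fscal c f)) with f in L2.
  + rewrite Cmod_inv in L2 by assumption. apply Cmod_gt_0 in Hc.
    apply Rmult_le_compat_l with (r := (Cmod c ^ 2)%R) in L2; [|apply pow2_ge_0].
    replace (Cmod c ^ 2 * ((/ Cmod c) ^ 2 * normsq alpha (fscal c f)))%R with (normsq alpha (fscal c f)) in L2
      by (field; lra). exact L2.
  + apply functional_extensionality. intros z. unfold fscal. field. assumption.
Qed.

Lemma normsq_nonneg (alpha : R) (f : C -> C) : (-1 <= alpha)%R -> inH alpha f -> (0 <= normsq alpha f)%R.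
Proof.
intros Ha Hf. eapply Rle_trans; [|apply (proj1 (normsq_spec _ _ Hf) 0%R); lra].
apply Hpartial_nonneg; [assumption|now apply (inH_contD alpha)|lra].
Qed.

Lemma normsq_mono (alpha : R) (f g : C -> C) : (-1 <= alpha)%R -> inH alpha f -> inH alpha g ->
  (forall z, inD z -> (Cmod (f z) <= Cmod (g z))%R) -> (normsq alpha f <= normsq alpha g)%R.
Proof.
intros Ha Hf Hg H.
replace (normsq alpha g) with (1 * normsq alpha g + 0 * normsq alpha g)%R by ring.
apply normsq_le_iff; [assumption|].
apply (normsq_le_pointwise alpha g g); try lra; try (eapply inH_contD; eassumption).
- intros z Hz. assert (Q := H z Hz). assert (Cmod (f z) ^ 2 <= Cmod (g z) ^ 2)%R; [|lra].
  apply pow_incr. split; [apply Cmod_ge_0|assumption].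
- now apply normsq_spec.
- now apply normsq_spec.
Qed.

Lemma normsq_eqD (alpha : R) (f g : C -> C) : (-1 <= alpha)%R -> inH alpha f -> inH alpha g ->
  eqD f g -> normsq alpha f = normsq alpha g.
Proof.
intros Ha Hf Hg E. apply Rle_antisym; apply normsq_mono; try assumption; intros z Hz; rewrite E by assumption; lra.
Qed.

Lemma normsq_eq_0 (alpha : R) (f : C -> C) : (-1 <= alpha)%R -> inH alpha f ->
  (normsq alpha f <= 0)%R -> forall z, inD z -> f z = 0.
Proof.
intros Ha Hf H. apply (normsq_le_0 alpha); [assumption|now apply (inH_analytic alpha)|].
now apply normsq_le_iff.
Qed.

(** * Riesz theory of compact operators *)

Definition fzero : C -> C := fun _ => 0.

Ltac cring := unfold fzero; apply Cminus_eq_0; ring.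
Ltac cfield := unfold fzero; apply Cminus_eq_0; field.

Section RieszTheory.

Variables (alpha : R).
Hypothesis Ha : (-1 <= alpha)%R.

Lemma fsub_fadd (f g : C -> C) : fsub f g = fadd f (fscal (RtoC (-1)) g).
Proof. apply functional_extensionality. intros z. unfold fsub, fadd, fscal. cring. Qed.

Lemma inH_fsub (f g : C -> C) : inH alpha f -> inH alpha g ->
  inH alpha (fsub f g) /\ (normsq alpha (fsub f g) <= 2 * normsq alpha f + 2 * normsq alpha g)%R.
Proof using Ha.
intros Hf Hg. rewrite fsub_fadd.
destruct (inH_fscal alpha (RtoC (-1)) g Ha Hg) as [I _].
destruct (inH_fadd alpha f _ Ha Hf I) as [J L]. split; [assumption|].
rewrite normsq_fscal in L by assumption.
replace (Cmod (RtoC (-1))) with 1%R in L by (rewrite Cmod_R, Rabs_left; lra). lra.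
Qed.

Lemma inH_comb (f g : C -> C) (a : C) : inH alpha f -> inH alpha g -> inH alpha (fadd f (fscal a g)).
Proof using Ha.
intros Hf Hg. apply inH_fadd; [assumption|assumption|]. now apply inH_fscal.
Qed.

Lemma inH_0 : inH alpha fzero.
Proof using Ha.
apply (inH_bounded alpha _ 0 Ha); [apply analytic_const|]. intros z _. unfold fzero; rewrite Cmod_0. lra.
Qed.

Lemma inH_eqD (f g : C -> C) : inH alpha f -> eqD f g -> inH alpha g.
Proof using Ha.
intros Hf E. assert (Ag : analytic_D g).
{ intros z Hz. destruct (inH_analytic alpha f Hf z Hz) as [l Hl]. exists l. unfold inD in Hz.
  apply (cder_ext_loc f g z l (1 - Cmod z)); [lra| |exact Hl].
  intros x Hx. apply E. unfold inD. replace x with (z + (x - z)) by ring.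
  eapply Rle_lt_trans; [apply Cmod_triangle|]. lra. }
split; [assumption|]. exists (1 * normsq alpha f + 0 * normsq alpha f)%R.
apply (normsq_le_pointwise alpha f f); try lra; try (eapply inH_contD; eassumption).
- now apply analytic_contD.
- intros z Hz. rewrite (E z Hz). lra.
- now apply normsq_spec.
- now apply normsq_spec.
Qed.

Lemma normsq_sub_sym (f g : C -> C) : inH alpha f -> inH alpha g ->
  normsq alpha (fsub f g) = normsq alpha (fsub g f).
Proof using Ha.
intros Hf Hg. replace (fsub f g) with (fscal (RtoC (-1)) (fsub g f)).
- rewrite normsq_fscal; [|assumption|now apply inH_fsub].
  replace (Cmod (RtoC (-1))) with 1%R by (rewrite Cmod_R, Rabs_left; lra). ring.
- apply functional_extensionality. intros z. unfold fsub, fscal. cring.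
Qed.

(** The algebraic part of [bounded_op], without its norm bound; it passes from T to T - lam by pure
    algebra. *)
Definition linear_op (L : Op) : Prop :=
  (forall f, inH alpha f -> inH alpha (L f)) /\
  (forall f g a, inH alpha f -> inH alpha g ->
     eqD (L (fadd f (fscal a g))) (fadd (L f) (fscal a (L g)))) /\
  (forall f g, inH alpha f -> eqD f g -> eqD (L f) (L g)).

Lemma linear_sub (L : Op) (f g : C -> C) : linear_op L -> inH alpha f -> inH alpha g ->
  eqD (L (fsub f g)) (fsub (L f) (L g)).
Proof. intros [_ [H _]] Hf Hg. rewrite !fsub_fadd. now apply H. Qed.

Lemma linear_0 (L : Op) : linear_op L -> eqD (L fzero) fzero.
Proof using Ha.
intros HL z Hz. assert (E := linear_sub L _ _ HL inH_0 inH_0 z Hz).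
replace (fsub fzero fzero) with fzero in E.
- rewrite E. unfold fsub. cring.
- apply functional_extensionality. intros y. unfold fsub. cring.
Qed.

Lemma linear_scal (L : Op) (a : C) (f : C -> C) : linear_op L -> inH alpha f ->
  eqD (L (fscal a f)) (fscal a (L f)).
Proof using Ha.
intros HL Hf z Hz.
assert (E := proj1 (proj2 HL) fzero f a inH_0 Hf z Hz).
replace (fadd fzero (fscal a f)) with (fscal a f) in E.
- rewrite E. unfold fadd. rewrite (linear_0 L HL z Hz). cring.
- apply functional_extensionality. intros y. unfold fadd. cring.
Qed.

Lemma bounded_linear (T : Op) : bounded_op alpha T -> linear_op T.
Proof.
intros [H1 [H2 [K [_ H3]]]]. split; [|split; assumption].
intros f Hf. now apply H3.
Qed.

Lemma bounded_normsq (T : Op) : bounded_op alpha T ->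
  exists K, (0 <= K)%R /\ forall f, inH alpha f -> (normsq alpha (T f) <= K * normsq alpha f)%R.
Proof.
intros [_ [_ [K [HK H]]]]. exists K. split; [assumption|].
intros f Hf. destruct (H f Hf) as [I J]. apply normsq_le_iff; [assumption|].
apply J. now apply normsq_spec.
Qed.

Lemma shift_linear (T : Op) (lam : C) : linear_op T -> linear_op (fun f => fsub (T f) (fscal lam f)).
Proof using Ha.
intros [H1 [H2 H3]]. split; [|split].
- intros f Hf. apply inH_fsub; [now apply H1|now apply inH_fscal].
- intros f g a Hf Hg z Hz. assert (E := H2 f g a Hf Hg z Hz).
  unfold fsub, fadd, fscal in *. rewrite E. cring.
- intros f g Hf E z Hz. unfold fsub, fscal. rewrite (H3 f g Hf E z Hz), (E z Hz). reflexivity.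
Qed.

Lemma normalise (f : C -> C) : inH alpha f -> (0 < normsq alpha f)%R ->
  exists c : C, c <> 0 /\ (Cmod c ^ 2 * normsq alpha f = 1)%R /\
    inH alpha (fscal c f) /\ normsq alpha (fscal c f) = 1%R.
Proof using Ha.
intros Hf Hp.
assert (Hs : (0 < sqrt (normsq alpha f))%R) by now apply sqrt_lt_R0.
exists (RtoC (/ sqrt (normsq alpha f))).
assert (E : (Cmod (RtoC (/ sqrt (normsq alpha f))) ^ 2 * normsq alpha f = 1)%R).
{ rewrite Cmod_R, Rabs_pos_eq by (left; now apply Rinv_0_lt_compat).
  rewrite <- (sqrt_sqrt (normsq alpha f)) at 2 by lra. field. lra. }
split; [|split; [exact E|split]].
- intros F. apply RtoC_inj in F. assert (0 < / sqrt (normsq alpha f))%R by now apply Rinv_0_lt_compat. lra.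
- now apply inH_fscal.
- now rewrite normsq_fscal.
Qed.

Variables (T : Op) (lam : C).
Hypothesis HT : compact_op alpha T.
Hypothesis Hlam : lam <> 0.

Lemma subseq_ge (s : nat -> nat) : (forall j, (s j < s (S j))%nat) -> forall j, (j <= s j)%nat.
Proof. intros H j. induction j; [lia|]. specialize (H j). lia. Qed.

(** [compact_op] speaks of the unit ball, so the sequence is divided by sqrt B and the limit scaled
    back. *)
Lemma compact_bounded_seq (u : nat -> C -> C) (B : R) : (0 < B)%R ->
  (forall k, inH alpha (u k) /\ (normsq alpha (u k) <= B)%R) ->
  exists (s : nat -> nat) (g : C -> C), (forall j, (s j < s (S j))%nat) /\ inH alpha g /\
    forall eps, (0 < eps)%R -> exists N, forall j, (N <= j)%nat ->
      (normsq alpha (fsub (T (u (s j))) g) <= eps)%R.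
Proof using Ha HT.
intros HB Hu. assert (LT := bounded_linear T (proj1 HT)).
assert (Hs : (0 < sqrt B)%R) by now apply sqrt_lt_R0.
set (c := RtoC (/ sqrt B)). set (c' := RtoC (sqrt B)).
assert (Ec : (Cmod c ^ 2 * B = 1)%R).
{ unfold c. rewrite Cmod_R, Rabs_pos_eq by (left; now apply Rinv_0_lt_compat).
  rewrite <- (sqrt_sqrt B) at 2 by lra. field. lra. }
assert (Ec' : (Cmod c' ^ 2 = B)%R).
{ unfold c'. rewrite Cmod_R, Rabs_pos_eq by lra. rewrite pow2_sqrt; lra. }
assert (Ecc : c' * c = 1).
{ unfold c, c'. rewrite <- RtoC_mult. f_equal. field. lra. }
destruct (proj2 HT (fun k => fscal c (u k))) as [s [g [H1 [H2 H3]]]].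
{ intros k. destruct (Hu k) as [I L]. assert (I' := proj1 (inH_fscal alpha c _ Ha I)).
  split; [assumption|]. apply normsq_le_iff; [assumption|].
  rewrite normsq_fscal by assumption. rewrite <- Ec. apply Rmult_le_compat_l; [apply pow2_ge_0|assumption]. }
exists s, (fscal c' g). split; [assumption|].
assert (Ig := proj1 (inH_fscal alpha c' g Ha H2)). split; [assumption|].
intros eps He. destruct (H3 (eps / B)%R) as [N HN].
{ now apply Rdiv_lt_0_compat. }
exists N. intros j Hj. specialize (HN j Hj). destruct (Hu (s j)) as [I L].
assert (I' := proj1 (inH_fscal alpha c _ Ha I)).
assert (J : inH alpha (fsub (T (fscal c (u (s j)))) g)).
{ apply inH_fsub; [|assumption]. now apply LT. }
apply normsq_le_iff in HN; [|assumption].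
rewrite (normsq_eqD alpha _ (fscal c' (fsub (T (fscal c (u (s j)))) g))); [|assumption| | |].
- rewrite normsq_fscal, Ec' by assumption.
  apply Rle_trans with (B * (eps / B))%R; [apply Rmult_le_compat_l; lra|right; field; lra].
- apply inH_fsub; [|assumption]. now apply LT.
- now apply inH_fscal.
- intros z Hz. assert (E := linear_scal T c (u (s j)) LT I z Hz).
  unfold fsub, fscal in *. rewrite E.
  replace (c' * (c * T (u (s j)) z - g z)) with ((c' * c) * T (u (s j)) z - c' * g z) by ring.
  rewrite Ecc. cring.
Qed.

Definition shifted (f : C -> C) : C -> C := fsub (T f) (fscal lam f).

Lemma shifted_linear : linear_op shifted.
Proof using Ha HT. apply (shift_linear T lam). apply bounded_linear, HT. Qed.

Lemma shifted_bounded : exists K, (0 < K)%R /\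
  forall f, inH alpha f -> (normsq alpha (shifted f) <= K * normsq alpha f)%R.
Proof using Ha HT.
destruct (bounded_normsq T (proj1 HT)) as [K [HK H]].
exists (2 * K + 2 * Cmod lam ^ 2 + 1)%R. split; [pose proof (pow2_ge_0 (Cmod lam)); lra|].
intros f Hf. specialize (H f Hf).
assert (I := proj1 (bounded_linear T (proj1 HT)) f Hf).
destruct (inH_fsub _ _ I (proj1 (inH_fscal alpha lam f Ha Hf))) as [_ L].
rewrite normsq_fscal in L by assumption. pose proof (normsq_nonneg alpha f Ha Hf).
unfold shifted. lra.
Qed.

Hypothesis Hinj : forall f, inH alpha f -> eqD (shifted f) fzero -> eqD f fzero.

Lemma shifted_inj (f g : C -> C) : inH alpha f -> inH alpha g ->
  eqD (shifted f) (shifted g) -> eqD f g.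
Proof using Ha HT Hinj.
intros Hf Hg E z Hz. apply Cminus_eq_0.
apply (Hinj (fsub f g)); [now apply inH_fsub| |assumption].
intros y Hy. rewrite (linear_sub shifted f g shifted_linear Hf Hg y Hy).
unfold fsub. rewrite (E y Hy). cring.
Qed.

Lemma lam_sq_pos : (0 < Cmod lam ^ 2)%R.
Proof using Hlam. apply pow_lt. now apply Cmod_gt_0. Qed.

Lemma inv_INR_small (e : R) : (0 < e)%R -> exists N, forall k, (N <= k)%nat -> (/ (INR k + 1) <= e)%R.
Proof.
intros He. destruct (INR_unbounded (/ e)) as [N HN]. exists N. intros k Hk.
apply le_INR in Hk. assert (0 < / e)%R by now apply Rinv_0_lt_compat.
rewrite <- (Rinv_inv e). apply Rinv_le_contravar; lra.
Qed.

(* Only [normsq (f + g) <= 2 normsq f + 2 normsq g] is available, which is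
   enough for Riesz's argument; completeness is never used. *)
Lemma shifted_bounded_below : exists c, (0 < c)%R /\
  forall f, inH alpha f -> (normsq alpha f <= c * normsq alpha (shifted f))%R.
Proof using All.
apply NNPP. intros Hno.
assert (B : forall k : nat, exists u, inH alpha u /\ normsq alpha u = 1%R /\
   (normsq alpha (shifted u) <= / (INR k + 1))%R).
{ intros k. pose proof (pos_INR k).
  assert (E : exists f, inH alpha f /\ ((INR k + 1) * normsq alpha (shifted f) < normsq alpha f)%R).
  { apply NNPP. intros Hn. apply Hno. exists (INR k + 1)%R. split; [lra|].
    intros f Hf. apply Rnot_lt_le. intros F. apply Hn. now exists f. }
  destruct E as [f [Hf Lf]].
  assert (If := proj1 shifted_linear f Hf).
  assert (Pf := normsq_nonneg alpha _ Ha If).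
  destruct (normalise f Hf) as [c [C0 [C1 [C2 C3]]]]; [nra|].
  exists (fscal c f). split; [assumption|]. split; [assumption|].
  rewrite (normsq_eqD alpha _ (fscal c (shifted f))); try assumption.
  - rewrite normsq_fscal by assumption.
    apply Rmult_le_reg_l with (INR k + 1)%R; [lra|]. rewrite Rinv_r by lra.
    pose proof (pow2_ge_0 (Cmod c)).
    replace ((INR k + 1) * (Cmod c ^ 2 * normsq alpha (shifted f)))%R with
      (Cmod c ^ 2 * ((INR k + 1) * normsq alpha (shifted f)))%R by ring.
    rewrite <- C1 at 2. apply Rmult_le_compat_l; lra.
  - now apply shifted_linear.
  - now apply inH_fscal.
  - apply linear_scal; [apply shifted_linear|assumption]. }
set (u := fun k => proj1_sig (constructive_indefinite_description _ (B k))).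
assert (Hu : forall k, inH alpha (u k) /\ normsq alpha (u k) = 1%R /\
   (normsq alpha (shifted (u k)) <= / (INR k + 1))%R).
{ intros k. unfold u. apply proj2_sig. }
destruct (compact_bounded_seq u 1) as [s [g [H1 [H2 H3]]]]; [lra| |].
{ intros k. destruct (Hu k) as [I [N _]]. split; [assumption|lra]. }
(* lam v = T v - (T - lam) v, where T v is close to g and (T - lam) v is small. So g is a limit of
   the vectors lam v and lies in the kernel of T - lam. *)
assert (Small : forall e, (0 < e)%R -> exists v, inH alpha v /\ normsq alpha v = 1%R /\
   (normsq alpha (shifted v) <= e)%R /\ (normsq alpha (fsub (fscal lam v) g) <= 4 * e)%R).
{ intros e He. destruct (H3 e He) as [N1 K1]. destruct (inv_INR_small e He) as [N2 K2].
  set (j := max N1 N2). exists (u (s j)).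
  destruct (Hu (s j)) as [I [N L]]. split; [assumption|]. split; [assumption|].
  assert (L' : (normsq alpha (shifted (u (s j))) <= e)%R).
  { eapply Rle_trans; [apply L|]. apply K2. pose proof (subseq_ge s H1 j). lia. }
  split; [assumption|].
  specialize (K1 j ltac:(lia)).
  assert (IT := proj1 (bounded_linear T (proj1 HT)) _ I).
  replace (fsub (fscal lam (u (s j))) g) with (fsub (fsub (T (u (s j))) g) (shifted (u (s j)))).
  - destruct (inH_fsub _ _ (proj1 (inH_fsub _ _ IT H2)) (proj1 shifted_linear _ I)) as [_ Q]. lra.
  - apply functional_extensionality. intros z. unfold shifted, fsub, fscal. cring. }
destruct shifted_bounded as [K [HK KB]].
assert (Pl := lam_sq_pos).
assert (Zg : eqD (shifted g) fzero).
{ intros z Hz. apply (normsq_eq_0 alpha); [assumption|now apply shifted_linear| |assumption].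
  apply le_epsilon. intros e He. rewrite Rplus_0_l.
  set (e' := (e / (8 * K + 2 * Cmod lam ^ 2))%R).
  assert (He' : (0 < e')%R) by (apply Rdiv_lt_0_compat; lra).
  destruct (Small e' He') as [v [Iv [Nv [Lv Mv]]]].
  assert (Il := proj1 (inH_fscal alpha lam v Ha Iv)).
  assert (Is := proj1 (inH_fsub g _ H2 Il)).
  assert (J1 := proj1 shifted_linear _ Is). assert (J2 := proj1 shifted_linear _ Iv).
  assert (J3 := proj1 (inH_fscal alpha lam _ Ha J2)).
  rewrite (normsq_eqD alpha _ (fadd (shifted (fsub g (fscal lam v))) (fscal lam (shifted v)))).
  - destruct (inH_fadd alpha _ _ Ha J1 J3) as [_ Q].
    rewrite normsq_fscal in Q by assumption.
    assert (Q2 := KB _ Is). rewrite normsq_sub_sym in Q2 by assumption.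
    apply Rle_trans with ((8 * K + 2 * Cmod lam ^ 2) * e')%R; [nra|].
    unfold e'. right. field. lra.
  - assumption.
  - now apply shifted_linear.
  - now apply inH_fadd.
  - intros y Hy. unfold fadd. rewrite (linear_sub shifted _ _ shifted_linear H2 Il y Hy).
    unfold fsub at 1. rewrite (linear_scal shifted lam v shifted_linear Iv y Hy). cring. }
assert (Eg := Hinj g H2 Zg).
assert (Ng : normsq alpha g = 0%R).
{ rewrite (normsq_eqD alpha g (fscal (RtoC 0) g) Ha H2).
  - rewrite normsq_fscal, Cmod_0 by assumption. simpl; ring.
  - now apply inH_fscal.
  - intros z Hz. unfold fscal. rewrite (Eg z Hz). cring. }
(* Once g = 0, the squared norm |lam|^2 of lam v would be at most 2 times 4 |lam|^2 / 16, half of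
   itself. *)
destruct (Small (Cmod lam ^ 2 / 16)%R) as [v [Iv [Nv [_ Mv]]]]; [lra|].
assert (Il := proj1 (inH_fscal alpha lam v Ha Iv)).
destruct (inH_fadd alpha _ g Ha (proj1 (inH_fsub _ g Il H2)) H2) as [_ Q].
replace (fadd (fsub (fscal lam v) g) g) with (fscal lam v) in Q.
- rewrite normsq_fscal in Q by assumption. rewrite Nv, Ng in Q. lra.
- apply functional_extensionality. intros z. unfold fadd, fsub. cring.
Qed.

Definition closed_subspace (Y : (C -> C) -> Prop) : Prop :=
  (forall f, Y f -> inH alpha f) /\
  (forall f g a, Y f -> Y g -> Y (fadd f (fscal a g))) /\
  (forall f, inH alpha f ->
     (forall eps, (0 < eps)%R -> exists y, Y y /\ (normsq alpha (fsub y f) <= eps)%R) -> Y f).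

(** Members count up to equality on the disc, since values of an operator outside it carry no
    information. *)
Definition image (Y : (C -> C) -> Prop) (g : C -> C) : Prop :=
  inH alpha g /\ exists f, Y f /\ eqD (shifted f) g.

(** If (T - lam) u_k tends to g, the lower bound makes the u_k bounded, and compactness gives a
    subsequence with T u_k tending to some h. Then u_k tends to (h - g) / lam along it; this limit
    lies in Y and is mapped to g. *)
Lemma image_closed (Y : (C -> C) -> Prop) : closed_subspace Y -> closed_subspace (image Y).
Proof using All.
intros [Y1 [Y2 Y3]]. split; [|split].
- now intros f [Hf _].
- intros f g a [Hf [f' [F1 F2]]] [Hg [g' [G1 G2]]]. split; [now apply inH_comb|].
  exists (fadd f' (fscal a g')). split; [now apply Y2|].
  intros z Hz. rewrite (proj1 (proj2 shifted_linear) f' g' a (Y1 _ F1) (Y1 _ G1) z Hz).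
  unfold fadd, fscal. rewrite (F2 z Hz), (G2 z Hz). reflexivity.
- intros g Hg Happ. split; [assumption|].
  assert (B : forall k : nat, exists f, Y f /\ (normsq alpha (fsub (shifted f) g) <= / (INR k + 1))%R).
  { intros k. pose proof (pos_INR k).
    destruct (Happ (/ (INR k + 1))%R) as [y [[Iy [f [F1 F2]]] Ly]]; [apply Rinv_0_lt_compat; lra|].
    exists f. split; [assumption|].
    assert (I := proj1 shifted_linear f (Y1 f F1)).
    rewrite (normsq_eqD alpha _ (fsub y g)); try assumption.
    - now apply inH_fsub.
    - now apply inH_fsub.
    - intros z Hz. unfold fsub at 1. rewrite (F2 z Hz). reflexivity. }
  set (u := fun k => proj1_sig (constructive_indefinite_description _ (B k))).
  assert (Hu : forall k, Y (u k) /\ (normsq alpha (fsub (shifted (u k)) g) <= / (INR k + 1))%R).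
  { intros k. unfold u. apply proj2_sig. }
  destruct shifted_bounded_below as [c [Hc Bc]].
  assert (Pg := normsq_nonneg alpha g Ha Hg).
  destruct (compact_bounded_seq u (c * (2 + 2 * normsq alpha g))%R) as [s [h [H1 [H2 H3]]]].
  { apply Rmult_lt_0_compat; lra. }
  { intros k. destruct (Hu k) as [Yk Lk]. assert (Ik := Y1 _ Yk). split; [assumption|].
    assert (Is := proj1 shifted_linear _ Ik).
    eapply Rle_trans; [now apply Bc|]. apply Rmult_le_compat_l; [lra|].
    destruct (inH_fadd alpha _ g Ha (proj1 (inH_fsub _ g Is Hg)) Hg) as [_ Q].
    replace (fadd (fsub (shifted (u k)) g) g) with (shifted (u k)) in Q
      by (apply functional_extensionality; intros z; unfold fadd, fsub; cring).
    assert (/ (INR k + 1) <= 1)%R.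
    { rewrite <- Rinv_1. apply Rinv_le_contravar; [lra|]. pose proof (pos_INR k). lra. }
    lra. }
  assert (Small : forall e, (0 < e)%R -> exists v, Y v /\
     (normsq alpha (fsub (shifted v) g) <= e)%R /\ (normsq alpha (fsub (T v) h) <= e)%R).
  { intros e He. destruct (H3 e He) as [N1 K1]. destruct (inv_INR_small e He) as [N2 K2].
    set (j := max N1 N2). exists (u (s j)). destruct (Hu (s j)) as [I L]. split; [assumption|].
    split; [|apply K1; lia]. eapply Rle_trans; [apply L|]. apply K2.
    pose proof (subseq_ge s H1 j). lia. }
  assert (Ihg := proj1 (inH_fsub h g H2 Hg)).
  set (f := fscal (/ lam) (fsub h g)).
  assert (Hf : inH alpha f) by now apply inH_fscal.
  assert (Pl : (0 < Cmod (/ lam) ^ 2)%R).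
  { apply pow_lt. rewrite Cmod_inv by assumption. apply Rinv_0_lt_compat. now apply Cmod_gt_0. }
  assert (Near : forall v, Y v -> (normsq alpha (fsub v f) <=
     Cmod (/ lam) ^ 2 * (2 * normsq alpha (fsub (T v) h) + 2 * normsq alpha (fsub (shifted v) g)))%R).
  { intros v Hv. assert (Iv := Y1 v Hv).
    assert (IT := proj1 (bounded_linear T (proj1 HT)) _ Iv).
    assert (Is := proj1 shifted_linear _ Iv).
    destruct (inH_fsub _ _ (proj1 (inH_fsub _ _ IT H2)) (proj1 (inH_fsub _ _ Is Hg))) as [I Q].
    replace (fsub v f) with (fscal (/ lam) (fsub (fsub (T v) h) (fsub (shifted v) g))).
    - rewrite normsq_fscal by assumption. apply Rmult_le_compat_l; lra.
    - apply functional_extensionality. intros z. unfold f, shifted, fsub, fscal. cfield. assumption. }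
  assert (Yf : Y f).
  { apply Y3; [assumption|]. intros e He.
    destruct (Small (e / (4 * Cmod (/ lam) ^ 2))%R) as [v [Yv [L1 L2]]]; [apply Rdiv_lt_0_compat; lra|].
    exists v. split; [assumption|]. eapply Rle_trans; [now apply Near|].
    apply Rle_trans with (Cmod (/ lam) ^ 2 * (4 * (e / (4 * Cmod (/ lam) ^ 2))))%R.
    - apply Rmult_le_compat_l; lra.
    - right. field. intros F. rewrite F in Pl. simpl in Pl. lra. }
  exists f. split; [assumption|].
  intros z Hz. apply Cminus_eq_0.
  assert (If := proj1 shifted_linear f Hf). assert (Ifg := proj1 (inH_fsub _ g If Hg)).
  apply (normsq_eq_0 alpha (fsub (shifted f) g)); try assumption.
  destruct shifted_bounded as [K [HK KB]].
  apply le_epsilon. intros e He. rewrite Rplus_0_l.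
  (* (T - lam) f - g = (T - lam)(f - v) + ((T - lam) v - g). The first term costs 2 K times the
     squared distance of f and v, itself at most 4 |1/lam|^2 e/m; the second costs 2 e/m. *)
  set (m := (2 * (K * (Cmod (/ lam) ^ 2 * 4)) + 2)%R).
  assert (Hm : (0 < m)%R) by (unfold m; nra).
  destruct (Small (e / m)%R) as [v [Yv [L1 L2]]]; [now apply Rdiv_lt_0_compat|].
  assert (Iv := Y1 v Yv). assert (Is := proj1 shifted_linear v Iv).
  assert (Ivf := proj1 (inH_fsub _ _ Hf Iv)).
  assert (J := proj1 shifted_linear _ Ivf).
  rewrite (normsq_eqD alpha _ (fadd (shifted (fsub f v)) (fsub (shifted v) g))); try assumption.
  + destruct (inH_fadd alpha _ _ Ha J (proj1 (inH_fsub _ g Is Hg))) as [_ Q].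
    assert (Q2 := KB _ Ivf). rewrite normsq_sub_sym in Q2 by assumption.
    assert (Q3 := Near v Yv).
    assert (Q4 : (normsq alpha (fsub v f) <= Cmod (/ lam) ^ 2 * 4 * (e / m))%R).
    { eapply Rle_trans; [apply Q3|]. rewrite Rmult_assoc. apply Rmult_le_compat_l; lra. }
    apply Rle_trans with (m * (e / m))%R; [|right; field; lra].
    assert (Q5 : (K * normsq alpha (fsub v f) <= K * (Cmod (/ lam) ^ 2 * 4 * (e / m)))%R)
      by (apply Rmult_le_compat_l; lra).
    unfold m at 1. lra.
  + apply inH_fadd; [assumption|assumption|now apply inH_fsub].
  + intros y Hy. unfold fadd. rewrite (linear_sub shifted _ _ shifted_linear Hf Iv y Hy).
    unfold fsub. cring.
Qed.

(** If every point of Y could be replaced by one at less than half the squared distance to x, these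
    distances would sink below the gap that closedness provides. So some y0 is optimal up to a
    factor 2, and scaling x - y0 to norm 1 turns this into the bound 1/2. *)
Lemma riesz_lemma (Y : (C -> C) -> Prop) (x : C -> C) :
  closed_subspace Y -> Y fzero -> inH alpha x -> ~ Y x ->
  exists (y0 : C -> C) (c : C), Y y0 /\ c <> 0 /\ normsq alpha (fscal c (fsub x y0)) = 1%R /\
    forall y, Y y -> (1 / 2 <= normsq alpha (fsub (fscal c (fsub x y0)) y))%R.
Proof using Ha.
intros [Y1 [Y2 Y3]] Y0 Hx Nx.
assert (Hgap : exists e, (0 < e)%R /\ forall y, Y y -> (e < normsq alpha (fsub x y))%R).
{ apply NNPP. intros Hno. apply Nx. apply Y3; [assumption|]. intros e He.
  apply NNPP. intros Hno'. apply Hno. exists e. split; [assumption|]. intros y Hy.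
  apply Rnot_le_lt. intros F. apply Hno'. exists y. split; [assumption|].
  rewrite normsq_sub_sym; [assumption|now apply Y1|assumption]. }
destruct Hgap as [e [He Hgap]].
assert (Near : exists y0, Y y0 /\ forall y, Y y -> (normsq alpha (fsub x y0) / 2 <= normsq alpha (fsub x y))%R).
{ apply NNPP. intros Hno.
  assert (D : forall k, exists y, Y y /\ (normsq alpha (fsub x y) <= normsq alpha (fsub x fzero) * (/ 2) ^ k)%R).
  { induction k.
    - exists fzero. split; [assumption|]. simpl. lra.
    - destruct IHk as [y [Yy Ly]].
      assert (E : exists y', Y y' /\ (normsq alpha (fsub x y') < normsq alpha (fsub x y) / 2)%R).
      { apply NNPP. intros Hn. apply Hno. exists y. split; [assumption|].
        intros y' Yy'. apply Rnot_lt_le. intros F. apply Hn. now exists y'. }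
      destruct E as [y' [Yy' Ly']]. exists y'. split; [assumption|]. simpl. lra. }
  set (M := normsq alpha (fsub x fzero)) in *.
  assert (HM : (e < M)%R) by now apply Hgap.
  destruct (pow_lt_1_zero (/ 2) ltac:(rewrite Rabs_pos_eq; lra) (e / M)%R) as [N HN].
  { apply Rdiv_lt_0_compat; lra. }
  specialize (HN N (le_n N)). rewrite Rabs_pos_eq in HN by (apply pow_le; lra).
  destruct (D N) as [y [Yy Ly]]. specialize (Hgap y Yy).
  assert (M * (/ 2) ^ N < M * (e / M))%R by (apply Rmult_lt_compat_l; lra).
  replace (M * (e / M))%R with e in * by (field; lra). lra. }
destruct Near as [y0 [Yy0 Hy0]].
assert (Ix := proj1 (inH_fsub x y0 Hx (Y1 _ Yy0))).
destruct (normalise _ Ix) as [c [C0 [C1 [C2 C3]]]]; [specialize (Hgap y0 Yy0); lra|].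
exists y0, c. split; [assumption|]. split; [assumption|]. split; [assumption|].
intros y Yy.
assert (Yz : Y (fadd y0 (fscal (/ c) y))) by now apply Y2.
assert (Iz := proj1 (inH_fsub x _ Hx (Y1 _ Yz))).
replace (fsub (fscal c (fsub x y0)) y) with (fscal c (fsub x (fadd y0 (fscal (/ c) y)))).
- rewrite normsq_fscal by assumption. specialize (Hy0 _ Yz).
  pose proof (pow2_ge_0 (Cmod c)).
  assert (Cmod c ^ 2 * (normsq alpha (fsub x y0) / 2) <= Cmod c ^ 2 * normsq alpha (fsub x (fadd y0 (fscal (Cinv c) y))))%R
    by (apply Rmult_le_compat_l; lra). lra.
- apply functional_extensionality. intros z. unfold fsub, fadd, fscal. cfield. assumption.
Qed.

Fixpoint range (k : nat) : (C -> C) -> Prop :=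
  match k with O => inH alpha | S k => image (range k) end.

Lemma range_closed (k : nat) : closed_subspace (range k).
Proof using All.
induction k; [|now apply image_closed].
split; [auto|]. split; [intros; now apply inH_comb|auto].
Qed.

Lemma range_eqD (k : nat) (f g : C -> C) : inH alpha g -> eqD f g -> range k f -> range k g.
Proof.
intros Hg E. destruct k; [auto|]. intros [Hf [h [H1 H2]]]. split; [assumption|].
exists h. split; [assumption|]. intros z Hz. rewrite (H2 z Hz). now apply E.
Qed.

Lemma range_shifted (k : nat) (f : C -> C) : range k f -> range (S k) (shifted f).
Proof using All.
intros Hf. split; [apply shifted_linear; now apply (range_closed k)|].
exists f. split; [assumption|]. intros z _. reflexivity.
Qed.

Lemma range_decr_S (k : nat) (f : C -> C) : range (S k) f -> range k f.
Proof using All.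
revert f. induction k; intros f Hf; [apply Hf|].
destruct Hf as [Hf [g [G1 G2]]]. split; [assumption|]. exists g. split; [now apply IHk|assumption].
Qed.

Lemma range_decr (k m : nat) (f : C -> C) : (k <= m)%nat -> range m f -> range k f.
Proof using All.
intros Hkm. induction Hkm; [auto|]. intros Hf. now apply IHHkm, range_decr_S.
Qed.

Lemma range_0 (k : nat) : range k fzero.
Proof using All.
induction k; [apply inH_0|]. apply (range_eqD (S k) (shifted fzero)).
- apply inH_0.
- apply linear_0, shifted_linear.
- now apply range_shifted.
Qed.

(** Otherwise injectivity makes the ranges of the powers of T - lam a strictly decreasing chain of
    closed subspaces. Riesz's lemma picks a unit vector in each, away from the next, and the images
    of these vectors under T stay apart, against compactness. *)
Theorem shifted_surjective (g : C -> C) : inH alpha g -> exists f, inH alpha f /\ eqD (shifted f) g.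
Proof using All.
intros Hg. apply NNPP. intros Hno.
assert (Strict : forall k, exists x, range k x /\ ~ range (S k) x).
{ induction k.
  - exists g. split; [assumption|]. intros [_ [f [F1 F2]]]. apply Hno. now exists f.
  - destruct IHk as [x [X1 X2]]. exists (shifted x). split; [now apply range_shifted|].
    intros [_ [f [F1 F2]]]. apply X2.
    assert (Ix := proj1 (range_closed k) x X1).
    apply (range_eqD (S k) f x Ix); [|assumption].
    apply shifted_inj; [exact (proj1 (range_closed (S k)) f F1)|assumption|assumption]. }
assert (B : forall k, exists u, range k u /\ normsq alpha u = 1%R /\
   forall y, range (S k) y -> (1 / 2 <= normsq alpha (fsub u y))%R).
{ intros k. destruct (Strict k) as [x [X1 X2]].
  destruct (riesz_lemma (range (S k)) x (range_closed (S k)) (range_0 (S k)) (proj1 (range_closed k) x X1) X2)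
    as [y0 [c [Yy0 [C0 [C1 C2]]]]].
  exists (fscal c (fsub x y0)). split; [|now split].
  destruct (range_closed k) as [R1 [R2 R3]].
  replace (fscal c (fsub x y0)) with (fadd fzero (fscal c (fadd x (fscal (RtoC (-1)) y0)))).
  - apply R2; [apply range_0|]. apply R2; [assumption|]. now apply range_decr_S.
  - apply functional_extensionality. intros z. unfold fadd, fscal, fsub. cring. }
set (u := fun k => proj1_sig (constructive_indefinite_description _ (B k))).
assert (Hu : forall k, range k (u k) /\ normsq alpha (u k) = 1%R /\
   forall y, range (S k) y -> (1 / 2 <= normsq alpha (fsub (u k) y))%R).
{ intros k. unfold u. apply proj2_sig. }
assert (Iu : forall k, inH alpha (u k)).
{ intros k. apply (range_closed k). apply Hu. }
destruct (compact_bounded_seq u 1) as [s [h [H1 [H2 H3]]]]; [lra| |].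
{ intros k. split; [apply Iu|]. right. apply Hu. }
assert (Pl := lam_sq_pos).
(* Two approximations, each counted twice, put the two images within |lam|^2 / 4, below the forced
   separation |lam|^2 / 2. *)
destruct (H3 (Cmod lam ^ 2 / 16)%R) as [N HN]; [lra|].
assert (HN1 := HN N (le_n N)). assert (HN2 := HN (S N) (le_S _ _ (le_n N))).
specialize (H1 N). set (a := s N) in *. set (b := s (S N)) in *.
assert (IT := fun k => proj1 (bounded_linear T (proj1 HT)) _ (Iu k)).
assert (Q1 : (normsq alpha (fsub (T (u a)) (T (u b))) <= Cmod lam ^ 2 / 4)%R).
{ destruct (inH_fsub _ _ (proj1 (inH_fsub _ h (IT a) H2)) (proj1 (inH_fsub _ h (IT b) H2))) as [_ Q].
  replace (fsub (fsub (T (u a)) h) (fsub (T (u b)) h)) with (fsub (T (u a)) (T (u b))) in Q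
    by (apply functional_extensionality; intros z; unfold fsub; cring).
  lra. }
(* Chosen so that T u_a - T u_b = lam (u_a - y). As b > a, every summand lies in [range (S a)],
   where the separation of u_a applies. *)
set (y := fscal (/ lam) (fadd (fadd (fscal lam (u b)) (shifted (u b))) (fscal (RtoC (-1)) (shifted (u a))))).
assert (Ry : range (S a) y).
{ destruct (range_closed (S a)) as [R1 [R2 R3]].
  assert (Rb : range (S a) (u b)) by (apply (range_decr (S a) b); [lia|apply Hu]).
  assert (Rsb : range (S a) (shifted (u b))).
  { apply (range_decr (S a) (S b)); [lia|]. apply range_shifted, Hu. }
  assert (Rsa : range (S a) (shifted (u a))) by (apply range_shifted, Hu).
  replace y with (fadd fzero (fscal (/ lam)
    (fadd (fadd (shifted (u b)) (fscal lam (u b))) (fscal (RtoC (-1)) (shifted (u a)))))).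
  - apply R2; [apply range_0|]. apply R2; [now apply R2|assumption].
  - apply functional_extensionality. intros z. unfold y, fadd, fscal. cring. }
assert (Q2 := proj2 (proj2 (Hu a)) y Ry).
assert (Iy := proj1 (range_closed (S a)) y Ry).
assert (E : fsub (T (u a)) (T (u b)) = fscal lam (fsub (u a) y)).
{ apply functional_extensionality. intros z. unfold y, shifted, fsub, fadd, fscal. cfield. assumption. }
rewrite E, normsq_fscal in Q1; [|assumption|now apply inH_fsub].
nra.
Qed.

(** The inverse is a choice of preimages: injectivity makes it linear and compatible with equality
    on the disc, and the lower bound makes it bounded. *)
Theorem not_in_spectrum : ~ in_spectrum alpha T lam.
Proof using All.
intros Hs. apply Hs.
set (S := fun g : C -> C => epsilon (inhabits g) (fun f => inH alpha f /\ eqD (shifted f) g)).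
assert (HS : forall g, inH alpha g -> inH alpha (S g) /\ eqD (shifted (S g)) g).
{ intros g Hg. apply (epsilon_spec (inhabits g) (fun f => inH alpha f /\ eqD (shifted f) g)).
  now apply shifted_surjective. }
destruct shifted_bounded_below as [c [Hc Bc]].
exists S. split; [split; [|split]|].
- intros f g a Hf Hg. destruct (HS f Hf) as [F1 F2]. destruct (HS g Hg) as [G1 G2].
  destruct (HS _ (inH_comb f g a Hf Hg)) as [K1 K2].
  apply shifted_inj; [assumption|now apply inH_comb|].
  intros z Hz. rewrite (K2 z Hz), (proj1 (proj2 shifted_linear) _ _ a F1 G1 z Hz).
  unfold fadd, fscal. now rewrite (F2 z Hz), (G2 z Hz).
- intros f g Hf E z Hz.
  assert (Hg := inH_eqD f g Hf E).
  destruct (HS f Hf) as [F1 F2]. destruct (HS g Hg) as [G1 G2]. revert z Hz.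
  apply shifted_inj; [assumption|assumption|].
  intros z Hz. rewrite (F2 z Hz), (G2 z Hz). now apply E.
- exists c. split; [lra|]. intros f Hf. destruct (HS f Hf) as [F1 F2]. split; [assumption|].
  intros M HM. apply normsq_le_iff in HM; [|assumption]. apply normsq_le_iff; [assumption|].
  eapply Rle_trans; [now apply Bc|]. apply Rmult_le_compat_l; [lra|].
  rewrite (normsq_eqD alpha _ f); [assumption|assumption|now apply shifted_linear|assumption|assumption].
- intros f Hf. assert (If := proj1 shifted_linear f Hf). destruct (HS _ If) as [F1 F2].
  destruct (HS f Hf) as [G1 G2]. split; [|exact G2].
  now apply shifted_inj.
Qed.

End RieszTheory.

(** * The spectrum *)

Lemma polar_pow (r t : R) (k : nat) : polar r t ^ k = polar (r ^ k) (INR k * t).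
Proof.
induction k.
- simpl. unfold polar. rewrite Rmult_0_l, cos_0, sin_0. apply injective_projections; simpl; ring.
- rewrite Cpow_S, IHk, S_INR, Rmult_plus_distr_r, Rmult_1_l.
  unfold polar. rewrite cos_plus, sin_plus. apply injective_projections; simpl; ring.
Qed.

Definition monomial (k : nat) : C -> C := fun z => z ^ k.

Lemma monomial_diff_sq (a b r t : R) (j k : nat) :
  (Cmod (fsub (fscal (RtoC a) (monomial j)) (fscal (RtoC b) (monomial k)) (polar r t)) ^ 2 =
   Cmod (fscal (RtoC a) (monomial j) (polar r t)) ^ 2 + (b * r ^ k) ^ 2
   - 2 * a * b * r ^ j * r ^ k * cos ((INR j - INR k) * t))%R.
Proof.
unfold fsub, fscal, monomial. rewrite !polar_pow, !Cmod2_alt.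
rewrite Rmult_minus_distr_r, cos_minus. simpl.
set (cj := cos (INR j * t)). set (ck := cos (INR k * t)).
set (sj := sin (INR j * t)). set (sk := sin (INR k * t)).
assert (E : (ck ^ 2 + sk ^ 2 = 1)%R).
{ unfold ck, sk. rewrite <- (sin2_cos2 (INR k * t)). unfold Rsqr. ring. }
replace ((b * r ^ k) * (b * r ^ k * 1))%R with ((b * r ^ k) ^ 2 * (ck ^ 2 + sk ^ 2))%R by (rewrite E; ring).
ring.
Qed.

Lemma cos_integral_0 (j k : nat) : j <> k ->
  is_RInt (fun t => cos ((INR j - INR k) * t)) 0 (2 * PI) 0%R.
Proof.
intros Hjk. set (m := (INR j - INR k)%R).
assert (Hm : m <> 0%R).
{ unfold m. intros E. apply Hjk, INR_eq. lra. }
assert (D := is_RInt_derive (V := R_CompleteNormedModule) (fun t => sin (m * t) / m)%R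
  (fun t => cos (m * t)) 0 (2 * PI)).
change minus with Rminus in D. cbv beta in D.
replace (sin (m * (2 * PI)) / m - sin (m * 0) / m)%R with 0%R in D.
- apply D.
  + intros t _. auto_derive; [trivial|]. field. exact Hm.
  + intros t _. apply (continuous_comp (fun t => m * t)%R cos); [|apply continuous_cos].
    apply (continuous_mult (K := R_AbsRing)); [apply continuous_const|apply continuous_id].
- rewrite Rmult_0_r, sin_0.
  assert (S : forall i, sin (INR i * (2 * PI)) = 0%R).
  { intros i. replace (INR i * (2 * PI))%R with (0 + 2 * INR i * PI)%R by ring.
    rewrite sin_period. apply sin_0. }
  unfold m at 1. rewrite Rmult_minus_distr_r, sin_minus, !S. field. assumption.
Qed.

Lemma monomial_inH (alpha : R) (k : nat) (c : C) : (-1 <= alpha)%R -> inH alpha (fscal c (monomial k)).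
Proof.
intros Ha. apply inH_fscal; [assumption|].
apply (inH_bounded alpha _ 1 Ha); [apply (analytic_pow (fun z => z)), analytic_id|].
intros z Hz. unfold monomial. rewrite Cmod_pow. rewrite <- (pow1 k). apply pow_incr.
split; [apply Cmod_ge_0|]. unfold inD in Hz. lra.
Qed.

(** Distinct monomials are orthogonal on every circle about 0, so one argument serves all alpha; the
    nonnegative term (b r^k)^2 is dropped. *)
Lemma monomial_orthogonal (alpha a b : R) (j k : nat) : (-1 <= alpha)%R -> j <> k ->
  (normsq alpha (fscal (RtoC a) (monomial j)) <=
   normsq alpha (fsub (fscal (RtoC a) (monomial j)) (fscal (RtoC b) (monomial k))))%R.
Proof.
intros Ha Hjk.
set (h := fscal (RtoC a) (monomial j)). set (g := fscal (RtoC b) (monomial k)).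
assert (Ih : inH alpha h) by now apply monomial_inH.
assert (Ig : inH alpha g) by now apply monomial_inH.
assert (If := proj1 (inH_fsub alpha Ha h g Ih Ig)).
assert (Ch := inH_contD _ _ Ih). assert (Cf := inH_contD _ _ If).
apply normsq_le_iff; [assumption|]. intros rho Hr.
apply Rle_trans with (Hpartial alpha (fsub h g) rho); [|now apply (normsq_spec alpha (fsub h g) If)].
eapply Rle_trans; [apply (Hpartial_comb alpha (fsub h g) (fsub h g) h 1 0 rho Ha)|]; try assumption; [|lra].
intros r Hr'. rewrite Rmult_0_l, Rplus_0_r, Rmult_1_l. unfold circ_mean. pose proof PI_RGT_0.
apply Rmult_le_compat_l; [left; apply Rinv_0_lt_compat; lra|].
assert (Ef := ex_sqmod_circle _ r Cf ltac:(lra)). assert (Eh := ex_sqmod_circle _ r Ch ltac:(lra)).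
assert (Ec := cos_integral_0 j k Hjk).
apply (is_RInt_scal (V := R_NormedModule) _ _ _ (2 * a * b * r ^ j * r ^ k)%R) in Ec.
assert (Es := is_RInt_plus (V := R_NormedModule) _ _ _ _ _ _
   (RInt_correct (V := R_CompleteNormedModule) _ _ _ Ef) Ec).
(* Adding back the cross term makes the comparison true pointwise and leaves the integral
   unchanged. *)
apply Rle_trans with (RInt (fun t => Cmod (fsub h g (polar r t)) ^ 2 + 2 * a * b * r ^ j * r ^ k * cos ((INR j - INR k) * t))%R 0 (2 * PI)).
- apply RInt_le; [lra|assumption|eexists; exact Es|].
  intros t _. unfold h, g. rewrite monomial_diff_sq. pose proof (pow2_ge_0 (b * r ^ k)). lra.
- right. etransitivity; [exact (is_RInt_unique (V := R_CompleteNormedModule) _ _ _ _ Es)|].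
  change (RInt (fun t => Cmod (fsub h g (polar r t)) ^ 2)%R 0 (2 * PI) + (2 * a * b * r ^ j * r ^ k) * 0 =
    RInt (fun t => Cmod (fsub h g (polar r t)) ^ 2)%R 0 (2 * PI))%R. ring.
Qed.

Lemma monomial_normsq_pos (alpha : R) (k : nat) : (-1 <= alpha)%R ->
  (0 < normsq alpha (monomial k))%R.
Proof.
intros Ha. apply Rnot_le_lt. intros F.
assert (I : inH alpha (monomial k)).
{ apply (inH_eqD alpha Ha (fscal (RtoC 1) (monomial k))); [now apply monomial_inH|].
  intros z _. unfold fscal. cring. }
assert (Hz : inD (RtoC (/ 2))) by (unfold inD; rewrite Cmod_R, Rabs_pos_eq; lra).
assert (E := normsq_eq_0 alpha _ Ha I F (RtoC (/ 2)) Hz).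
revert E. apply Cpow_nz. intros E. apply RtoC_inj in E. lra.
Qed.

(** A bounded inverse would send two nearly equal images T u_a, T u_b back to normalised monomials,
    whose squared distance is at least 1 by orthogonality. *)
Theorem zero_in_spectrum (alpha : R) (T : Op) : (-1 <= alpha)%R -> compact_op alpha T ->
  in_spectrum alpha T (RtoC 0).
Proof.
intros Ha HT [S [HS HST]].
set (c := fun k => (/ sqrt (normsq alpha (monomial k)))%R).
set (u := fun k => fscal (RtoC (c k)) (monomial k)).
assert (Iu : forall k, inH alpha (u k)) by (intros; now apply monomial_inH).
assert (Nu : forall k, normsq alpha (u k) = 1%R).
{ intros k. assert (P := monomial_normsq_pos alpha k Ha).
  assert (Hs := sqrt_lt_R0 _ P).
  unfold u. assert (I : inH alpha (monomial k)).
  { apply (inH_eqD alpha Ha (fscal (RtoC 1) (monomial k))); [now apply monomial_inH|].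
    intros z _. unfold fscal. cring. }
  rewrite normsq_fscal by assumption. unfold c.
  rewrite Cmod_R, Rabs_pos_eq by (left; now apply Rinv_0_lt_compat).
  rewrite <- (sqrt_sqrt (normsq alpha (monomial k))) at 2 by lra. field. lra. }
destruct (compact_bounded_seq alpha Ha T HT u 1) as [s [g [H1 [H2 H3]]]]; [lra| |].
{ intros k. split; [apply Iu|]. right. apply Nu. }
destruct (bounded_normsq alpha S HS) as [K [HK KB]].
assert (LT := bounded_linear alpha T (proj1 HT)). assert (LS := bounded_linear alpha S HS).
(* The images are then at squared distance at most 4/(8(K + 1)), which the inverse enlarges to at
   most 1/2. *)
destruct (H3 (/ (8 * (K + 1)))%R) as [N HN]; [apply Rinv_0_lt_compat; lra|].
assert (HN1 := HN N (le_n N)). assert (HN2 := HN (Datatypes.S N) (le_S _ _ (le_n N))).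
specialize (H1 N). set (a := s N) in *. set (b := s (Datatypes.S N)) in *.
assert (IT := fun k => proj1 LT _ (Iu k)).
destruct (inH_fsub alpha Ha _ _ (proj1 (inH_fsub alpha Ha _ g (IT a) H2)) (proj1 (inH_fsub alpha Ha _ g (IT b) H2))) as [I Q].
replace (fsub (fsub (T (u a)) g) (fsub (T (u b)) g)) with (fsub (T (u a)) (T (u b))) in *
  by (apply functional_extensionality; intros z; unfold fsub; cring).
assert (Q2 := KB _ I).
assert (Z : forall f, fsub (T f) (fscal (RtoC 0) f) = T f).
{ intros f. apply functional_extensionality. intros z. unfold fsub, fscal. cring. }
assert (Iab := proj1 (inH_fsub alpha Ha _ _ (Iu a) (Iu b))).
assert (E : eqD (S (fsub (T (u a)) (T (u b)))) (fsub (u a) (u b))).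
{ intros z Hz. rewrite (linear_sub alpha S _ _ LS (IT a) (IT b) z Hz). unfold fsub.
  destruct (HST (u a) (Iu a)) as [A _]. destruct (HST (u b) (Iu b)) as [B _].
  rewrite Z in A, B. rewrite (A z Hz), (B z Hz). reflexivity. }
rewrite (normsq_eqD alpha _ _ Ha (proj1 LS _ I) Iab E) in Q2.
assert (O := monomial_orthogonal alpha (c a) (c b) a b Ha ltac:(lia)).
change (normsq alpha (u a) <= normsq alpha (fsub (u a) (u b)))%R in O. rewrite Nu in O.
assert (Q3 : (normsq alpha (fsub (T (u a)) (T (u b))) <= 4 * / (8 * (K + 1)))%R) by lra.
assert (Q4 : (K * normsq alpha (fsub (T (u a)) (T (u b))) <= K * (4 * / (8 * (K + 1))))%R)
  by (apply Rmult_le_compat_l; lra).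
assert (Q5 : (K * (4 * / (8 * (K + 1))) <= / 2)%R).
{ replace (K * (4 * / (8 * (K + 1))))%R with (/ 2 * (K * / (K + 1)))%R by (field; lra).
  assert (K * / (K + 1) <= 1)%R; [|lra].
  apply Rmult_le_reg_r with (K + 1)%R; [lra|]. rewrite Rmult_assoc, Rinv_l by lra. lra. }
lra.
Qed.

(* The operator is triangular, with diagonal [mu], for the filtration of the
   space by the order of vanishing at [w]. *)
Definition triangular_at (alpha : R) (T : Op) (w : C) (mu : nat -> C) : Prop :=
  forall j f c, inH alpha f -> lead w j f c -> lead w j (T f) (mu j * c).

Lemma lead_shifted (alpha : R) (T : Op) (w : C) (mu : nat -> C) (lam : C) (j : nat) (f : C -> C) (c : C) :
  triangular_at alpha T w mu -> inH alpha f -> lead w j f c ->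
  lead w j (shifted T lam f) ((mu j - lam) * c).
Proof.
intros HT Hf Hl.
replace ((mu j - lam) * c) with (mu j * c + (- lam) * c) by ring.
apply (lead_eqD w j (fun z => T f z + (- lam) * f z)).
- intros z _. unfold shifted, fsub, fscal. cring.
- apply lead_plus; [now apply HT|]. now apply lead_scal.
Qed.

(** At order j the leading coefficient c of f satisfies (mu_j - lam) c = 0, hence vanishes, and f
    climbs to order j + 1. It serves twice: with g = 0 and every N for injectivity, and with g = (z
    - w)^m and N = m for diagonal entries. *)
Lemma triangular_kernel (alpha : R) (T : Op) (w : C) (mu : nat -> C) (lam : C) (N : nat) (f g : C -> C) :
  inD w -> triangular_at alpha T w mu -> inH alpha f -> eqD (shifted T lam f) g ->
  (forall j, (j < N)%nat -> mu j <> lam /\ lead w j g 0) ->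
  exists c, lead w N f c.
Proof.
intros Hw HT Hf E H. induction N.
- exists (f w). apply lead_0. now apply (inH_analytic alpha).
- destruct IHN as [c Hc]; [intros j Hj; apply H; lia|].
  destruct (H N (Nat.lt_succ_diag_r N)) as [Hn Hg].
  assert (L := lead_shifted alpha T w mu lam N f c HT Hf Hc).
  apply (lead_eqD w N _ _ _ E) in L.
  assert (Z := lead_unique w N _ _ _ Hw L Hg).
  assert (c = 0).
  { destruct (Ceq_dec c 0) as [?|Hc0]; [assumption|]. exfalso.
    revert Z. apply Cmult_neq_0; [now apply Cminus_neq_0|assumption]. }
  subst c. now apply lead_S.
Qed.

Theorem diagonal_in_spectrum (alpha : R) (T : Op) (w : C) (mu : nat -> C) (l : nat) :
  (-1 <= alpha)%R -> inD w -> triangular_at alpha T w mu -> in_spectrum alpha T (mu l).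
Proof.
intros Ha Hw HT [S [HS HST]].
assert (Hmin : exists m, mu m = mu l /\ forall j, (j < m)%nat -> mu j <> mu l).
{ clear HST HS S.
  assert (P : forall k, (exists m, (m < k)%nat /\ mu m = mu l) ->
    exists m, mu m = mu l /\ forall j, (j < m)%nat -> mu j <> mu l).
  { induction k; intros [m [Hm E]]; [lia|].
    destruct (classic (exists m', (m' < k)%nat /\ mu m' = mu l)) as [Y|N]; [now apply IHk|].
    exists m. split; [assumption|]. intros j Hj F. apply N. exists j. split; [lia|assumption]. }
  apply (P (Datatypes.S l)). exists l. split; [lia|reflexivity]. }
destruct Hmin as [m [Em Hm]].
set (g := fun z : C => (z - w) ^ m).
assert (Lg : lead w m g 1).
{ exists (fun _ => RtoC 1). split; [apply analytic_const|]. split; [|reflexivity].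
  intros z _. unfold g. ring. }
assert (Ig : inH alpha g).
{ apply (inH_bounded alpha g (2 ^ m) Ha); [now apply (lead_analytic w m g 1)|].
  intros z Hz. unfold g. rewrite Cmod_pow. apply pow_incr. split; [apply Cmod_ge_0|].
  eapply Rle_trans; [apply Cmod_triangle|]. rewrite Cmod_opp. unfold inD in *. lra. }
destruct (HST g Ig) as [_ E].
assert (If := proj1 (bounded_linear alpha S HS) g Ig).
destruct (triangular_kernel alpha T w mu (mu l) m (S g) g Hw HT If E) as [c Hc].
{ intros j Hj. split; [now apply Hm|]. now apply (lead_weaken w j m g 1). }
assert (L := lead_shifted alpha T w mu (mu l) m _ c HT If Hc).
apply (lead_eqD w m _ _ _ E) in L.
assert (Z := lead_unique w m _ _ _ Hw L Lg).
(* The coefficients at order m give (mu_m - mu_l) c = 1 with mu_m = mu_l; in real parts this reads 0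
   = 1. *)
rewrite Em in Z. apply (f_equal fst) in Z. simpl in Z.
replace ((fst (mu l) + - fst (mu l)) * fst c - (snd (mu l) + - snd (mu l)) * snd c)%R with 0%R in Z by ring.
lra.
Qed.

Theorem triangular_spectrum (alpha : R) (T : Op) (w : C) (mu : nat -> C) (lam : C) :
  (-1 <= alpha)%R -> inD w -> compact_op alpha T -> triangular_at alpha T w mu ->
  in_spectrum alpha T lam <-> (lam = 0 \/ exists l, lam = mu l).
Proof.
intros Ha Hw HT Htri. split.
- intros Hs. apply NNPP. intros Hno. revert Hs.
  assert (H0 : lam <> 0) by tauto.
  assert (Hmu : forall j, mu j <> lam).
  { intros j E. apply Hno. right. now exists j. }
  apply not_in_spectrum; [assumption|assumption|assumption|].
  intros f Hf E. intros z Hz. apply (identity_theorem f w Hw); [|assumption].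
  intros N. apply (triangular_kernel alpha T w mu lam N f fzero Hw Htri Hf E).
  intros j _. split; [apply Hmu|]. exists (fun _ => RtoC 0). split; [apply analytic_const|].
  split; [|reflexivity]. intros y _. unfold fzero. ring.
- intros [-> | [l ->]]; [now apply zero_in_spectrum|now apply (diagonal_in_spectrum alpha T w)].
Qed.

Close Scope C_scope.

Theorem theorem2p4 (alpha : R) (n : nat) :
  -1 <= alpha -> (0 < n)%nat ->
  (forall (psi0 psin phi0 phin : CC -> CC) (w : CC),
     analytic_D psi0 -> analytic_D psin ->
     selfmap_D phi0 -> selfmap_D phin ->
     bounded_op alpha (Cop psi0 phi0) ->
     bounded_op alpha (Dop psin phin n) ->
     inD w -> phi0 w = w -> phin w = w ->
     (forall j, (j < n)%nat -> cderiv_n j psin w = RtoC 0) ->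
     compact_op alpha (op_add (Cop psi0 phi0) (Dop psin phin n)) ->
     forall lam : CC,
       in_spectrum alpha (op_add (Cop psi0 phi0) (Dop psin phin n)) lam <->
       (lam = RtoC 0 \/
        lam = psi0 w \/
        (exists l, (1 <= l <= n - 1)%nat /\
           lam = Cmult (psi0 w) (Cpow (cderiv phi0 w) l)) \/
        (exists l, (n <= l)%nat /\
           lam = Cplus (Cmult (psi0 w) (Cpow (cderiv phi0 w) l))
                       (Cmult (Cmult (RtoC (Binomial.C l n)) (cderiv_n n psin w))
                              (Cpow (cderiv phin w) (l - n))))))
  /\
  (forall (psin phin : CC -> CC) (w : CC),
     analytic_D psin -> selfmap_D phin ->
     compact_op alpha (Dop psin phin n) ->
     inD w -> phin w = w ->
     (forall j, (j <= n)%nat -> cderiv_n j psin w = RtoC 0) ->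
     forall lam : CC, in_spectrum alpha (Dop psin phin n) lam <-> lam = RtoC 0).
Proof.
intros Ha Hn.
assert (Tri : forall (psi0 psin phi0 phin : CC -> CC) (w : CC),
     analytic_D psi0 -> analytic_D psin -> selfmap_D phi0 -> selfmap_D phin ->
     inD w -> phi0 w = w -> phin w = w ->
     (forall j, (j < n)%nat -> cderiv_n j psin w = RtoC 0) ->
     triangular_at alpha (op_add (Cop psi0 phi0) (Dop psin phin n)) w
       (taylor_eigenvalue n psi0 psin phi0 phin w)).
{ intros psi0 psin phi0 phin w A0 An S0 Sn Hw F0 Fn Hv j f c _ Hl. now apply lead_op. }
split.
- intros psi0 psin phi0 phin w A0 An S0 Sn _ _ Hw F0 Fn Hv HT lam.
  rewrite (triangular_spectrum alpha _ w _ lam Ha Hw HT (Tri _ _ _ _ _ A0 An S0 Sn Hw F0 Fn Hv)).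
  unfold taylor_eigenvalue. split.
  + intros [H | [l H]]; [now left|right].
    destruct (le_dec n l) as [Hl|Hl].
    * right. right. now exists l.
    * rewrite Cplus_0_r in H. destruct l as [|l].
      (* The case l = 0 is the isolated value psi0(w): the zeroth power is 1 even when phi0'(w) =
         0. *)
      -- left. rewrite H. apply Cmult_1_r.
      -- right. left. exists (S l). split; [lia|assumption].
  + intros [H | [H | [[l [Hl H]] | [l [Hl H]]]]].
    * now left.
    * right. exists 0%nat. destruct (le_dec n 0) as [F|_]; [lia|].
      rewrite Cplus_0_r, H. symmetry. apply Cmult_1_r.
    * right. exists l. destruct (le_dec n l) as [F|_]; [lia|]. now rewrite Cplus_0_r.
    * right. exists l. destruct (le_dec n l) as [_|F]; [assumption|lia].
- intros psin phin w An Sn HT Hw Fn Hv lam.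
  (* Adding the composition operator of weight 0 and symbol the identity brings the single operator
     under the triangular form already established. *)
  assert (E : op_add (Cop fzero (fun z => z)) (Dop psin phin n) = Dop psin phin n).
  { apply functional_extensionality. intros f. apply functional_extensionality. intros z.
    unfold op_add, Cop, fadd. cring. }
  assert (T := Tri fzero psin (fun z => z) phin w (analytic_const 0) An
    (conj analytic_id (fun z Hz => Hz)) Sn Hw eq_refl Fn (fun j Hj => Hv j (Nat.lt_le_incl _ _ Hj))).
  rewrite E in T. rewrite (triangular_spectrum alpha _ w _ lam Ha Hw HT T).
  (* From l = n on, the entry carries the factor psi_n^(n)(w), which is 0 because here the vanishing
     extends to j = n. *)
  assert (Z : forall l, taylor_eigenvalue n fzero psin (fun z => z) phin w l = RtoC 0).
  { intros l. unfold taylor_eigenvalue, fzero.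
    destruct (le_dec n l) as [Hl|Hl]; [rewrite (Hv n (le_n n))|]; ring. }
  split; [|now left]. intros [H | [l H]]; [assumption|]. now rewrite H, Z.
Qed.
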